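(* There is a deterministic algorithm (the paper's CONSTRUCT_CUB_REP) which, given a $k$-degenerate graph $G$ on $n$ vertices with $k\ge1$, outputs an $8k(\lceil 2.42\log n\rceil+1)$-dimensional cube representation of $G$ and runs in $O(n^2k)$ time.
   Context: Graphs are simple, finite and undirected; $\log$ is the natural logarithm. $G$ is $k$-degenerate if its vertices can be enumerated so that every vertex is succeeded by at most $k$ of its neighbors. A $d$-cube is a Cartesian product of $d$ closed intervals of unit length on the real line. A $d$-dimensional cube representation of $G$ is an assignment of $d$-cubes to the vertices such that two distinct vertices are adjacent iff their $d$-cubes intersect; equivalently, $d$ unit interval graphs on $V(G)$ (each given by intervals of one common length) whose edge sets have intersection $E(G)$. Running time is the number of elementary steps of a standard (unit-cost RAM) model. *)

(* Defs.v *)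
From HB Require Import structures.
From mathcomp Require Import all_boot all_order all_algebra.
From mathcomp Require Import all_classical all_reals all_analysis.

Set Implicit Arguments.
Unset Strict Implicit.
Unset Printing Implicit Defensive.

Import Order.TTheory GRing.Theory Num.Theory.

(** Written over MathComp and MathComp-Analysis.  A simple graph on a finite
    type [T] is a symmetric irreflexive [e : rel T]. *)

Section Graphs.
Variable T : finType.

Definition degenerate (k : nat) (e : rel T) : Prop :=
  exists2 s : seq T, perm_eq s (enum T) &
    forall x : T, #|[set y | e x y & index x s < index y s]| <= k.

Local Open Scope classical_set_scope.
Local Open Scope ring_scope.

Definition unit_cube (R : realType) (d : nat) (a : 'rV[R]_d) : set 'rV[R]_d :=
  [set p | forall i : 'I_d, a 0 i <= p 0 i <= a 0 i + 1].

(** [a x] is the corner with least coordinates of the cube assigned to [x]. *)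
Definition cube_representation (R : realType) (d : nat) (e : rel T)
    (a : T -> 'rV[R]_d) : Prop :=
  forall x y : T, x != y ->
    (e x y <-> (unit_cube (a x) `&` unit_cube (a y)) !=set0).

End Graphs.

(** The random access machine of Cook and Reckhow (1973), with registers
    [X_0, X_1, ...] holding natural numbers: the arithmetic is addition and
    truncated subtraction only, and each instruction executed costs one step.
    There is no multiplication, since at unit cost on unbounded registers it
    would make the machine unreasonably powerful. *)
Inductive instr : Type :=
  | IConst of nat & nat        (* IConst i c  : X_i <- c                   *)
  | IAdd of nat & nat & nat    (* IAdd i j k  : X_i <- X_j + X_k           *)
  | ISub of nat & nat & nat    (* ISub i j k  : X_i <- X_j - X_k           *)
  | ILoad of nat & nat         (* ILoad i j   : X_i <- X_(X_j)             *)
  | IStore of nat & nat        (* IStore i j  : X_(X_i) <- X_j             *)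
  | IJpos of nat & nat         (* IJpos i l   : go to l if X_i > 0         *)
  | IRead of nat               (* IRead i     : X_i <- next input number   *)
  | IPrint of nat.             (* IPrint i    : append X_i to the output   *)

Record config : Type := Config {
  pc : nat;
  regs : nat -> nat;
  input : seq nat;
  output : seq nat }.

(** Past its end the input tape reads as 0. *)
Definition exec (ins : instr) (c : config) : config :=
  let: Config p X inp out := c in
  match ins with
  | IConst i v => Config p.+1 [eta X with i |-> v] inp out
  | IAdd i j k => Config p.+1 [eta X with i |-> X j + X k] inp out
  | ISub i j k => Config p.+1 [eta X with i |-> X j - X k] inp out
  | ILoad i j => Config p.+1 [eta X with i |-> X (X j)] inp out
  | IStore i j => Config p.+1 [eta X with X i |-> X j] inp out
  | IJpos i l => Config (if 0 < X i then l else p.+1) X inp out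
  | IRead i => Config p.+1 [eta X with i |-> head 0 inp] (behead inp) out
  | IPrint i => Config p.+1 X inp (rcons out (X i))
  end.

Definition halted (P : seq instr) (c : config) : bool := size P <= pc c.

Definition step (P : seq instr) (c : config) : config :=
  if onth P (pc c) is Some ins then exec ins c else c.

Definition init (x : seq nat) : config := Config 0 (fun=> 0) x [::].

(** Halted configurations are fixed by [step P], so this says that the run on
    [x] halts after at most [t] steps and that its whole output is [y]. *)
Definition runs_within (P : seq instr) (x : seq nat) (t : nat) (y : seq nat) :
    Prop :=
  let c := iter t (step P) (init x) in halted P c /\ output c = y.

(** [n], [k], and then the adjacency matrix of the graph, row by row. *)
Definition graph_input (n k : nat) (e : rel 'I_n) : seq nat :=
  n :: k :: [seq nat_of_bool (e i j) | i <- enum 'I_n, j <- enum 'I_n].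

(** A sequence of numbers is read as [d] blocks of length [n + 1].  The block
    [L, l_0, ..., l_(n-1)] describes the intervals [[l_v, l_v + L]] of common
    length [L], that is, up to scaling, the unit intervals [[l_v / L, l_v / L + 1]]
    in one coordinate. *)
Definition block_length (n : nat) (y : seq nat) (i : nat) : nat :=
  nth 0 y (i * n.+1).

Definition block_left (n : nat) (y : seq nat) (i v : nat) : nat :=
  nth 0 y (i * n.+1 + v.+1).

Definition decoded_corner (R : realType) (n d : nat) (y : seq nat) (v : 'I_n) :
    'rV[R]_d :=
  (\row_(i < d) ((block_left n y i v)%:R / (block_length n y i)%:R))%R.

Definition encodes_cube_representation (R : realType) (n d : nat)
    (e : rel 'I_n) (y : seq nat) : Prop :=
  [/\ size y = d * n.+1,
      forall i : 'I_d, 0 < block_length n y i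
    & cube_representation e (@decoded_corner R n d y)].

(** The ceiling is nonnegative for [0 < n], so [absz] only casts it to [nat]. *)
Definition cub_dim (R : realType) (n k : nat) : nat :=
  8 * k * (`|Num.ceil (242%:R / 100%:R * ln (n%:R : R))%R|%N + 1).

(* Main.v *)
Require Import Defs.
From HB Require Import structures.
From mathcomp Require Import all_boot all_order all_algebra.
From mathcomp Require Import all_classical all_reals all_analysis.
From mathcomp Require Import zify ring lra.

Set Implicit Arguments.
Unset Strict Implicit.
Unset Printing Implicit Defensive.

(** Vertices are removed by minimum degree, so that each is followed by at most
    [k] neighbours.  Colour the vertices with [8 k] colours.  In the dimension of
    colour [c], with intervals of length [n], the vertex in position [w] starts
    at [n - w] if it has colour [c], and otherwise at [2 n - m], where [m] is the
    position of its last following neighbour of colour [c] (or its own position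
    if there is none).  Edges survive, and a nonadjacent pair [u < w] is separated
    in the dimension of the colour of [w] unless [u], or a neighbour of [u] after
    [w], has that colour too.  Colouring greedily from the last vertex to the
    first divides the number of unseparated pairs by 4, so the rounds form a
    geometric series of total cost [O(n^2 k)], and since [n <= 2 ^ m] for
    [m = ceil (2.42 log n)], no pair is left after [m + 1] rounds.

    The machine must compute [m], the least [m] with [n ^ 121 <= exp (50 m)],
    exactly.  By Hermite's method, for [0 < a] integers [A], [B] of controlled
    size make [A e^a - B] positive and small, which keeps [e^a] away from every
    integer [b] by more than the tail of the exponential series after [a ^ 3]
    terms.  So the test may be done on that partial sum, in polylogarithmic time. *)

(** * A loop language compiled to the random access machine *)

(** The output must have exactly [8 k (m + 1)] blocks, so [m] has to be the exact ceiling, and an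
    approximation of [2.42 log n] has no evident stopping precision when the value is close to an
    integer. This obstacle is what brings transcendence theory in. As [2.42 = 121 / 50], only
    integers are compared with [e^(50 m)]. They are huge, but an addition costs one step whatever
    its operands, and a product by repeated addition is paid by its multiplier alone; all
    multipliers used are small. A test of [m] costs [O(m^6)], which is [O(n)] because [m] is
    logarithmic, so [O(n)] tests fit in the time bound. The number of rounds leaves slack:
    [4^m >= n^2] only asks for [m >= log n / log 2], about [1.45 log n], so the crude bound [e <= 4]
    is good enough there. *)

Definition upd (A : Type) (f : nat -> A) (j : nat) (v : A) : nat -> A :=
  fun i => if eqn i j then v else f i.

Definition seta (A : nat -> nat -> nat) (j : nat) (f : nat -> nat) :
    nat -> nat -> nat :=
  fun j' => if eqn j' j then f else A j'.
Arguments seta _ _ _ _ /.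
Arguments upd : simpl never.

Lemma updE (A : Type) (f : nat -> A) j v i :
  upd f j v i = if i == j then v else f i.
Proof. by []. Qed.

Inductive expr : Type :=
  | ECst of nat
  | EVar of nat
  | EAdd of expr & expr
  | ESub of expr & expr
  | EGet of nat & expr.

(** [EVar i] is the variable of the [i]-th enclosing binder, counted from the
    outside.  All loops are bounded ([CFor e c] evaluates [e] once and binds the
    round number), so that [run] is a function; [ticks] counts the executed
    commands, each of which takes boundedly many machine steps. *)
Inductive cmd : Type :=
  | CSet of nat & expr & expr
  | CRead of nat & expr
  | CPrint of expr
  | CSeq of cmd & cmd
  | CIf of expr & cmd & cmd
  | CLet of expr & cmd
  | CFor of expr & cmd.

Record state : Type := State {
  arr : nat -> nat -> nat;
  inp : seq nat;
  out : seq nat;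
  ticks : nat }.

Definition tick (s : state) : state :=
  State (arr s) (inp s) (out s) (ticks s).+1.

Fixpoint eval (e : expr) (env : seq nat) (A : nat -> nat -> nat) : nat :=
  match e with
  | ECst c => c
  | EVar i => nth 0 env i
  | EAdd a b => eval a env A + eval b env A
  | ESub a b => eval a env A - eval b env A
  | EGet j a => A j (eval a env A)
  end.

Definition put (s : state) (j i v : nat) : state :=
  State (seta (arr s) j (upd (arr s j) i v)) (inp s) (out s) (ticks s).+1.

Fixpoint run (c : cmd) (env : seq nat) (s : state) : state :=
  match c with
  | CSet j i e => put s j (eval i env (arr s)) (eval e env (arr s))
  | CRead j i =>
      let s' := put s j (eval i env (arr s)) (head 0 (inp s)) in
      State (arr s') (behead (inp s)) (out s') (ticks s')
  | CPrint e =>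
      State (arr s) (inp s) (rcons (out s) (eval e env (arr s))) (ticks s).+1
  | CSeq c1 c2 => run c2 env (run c1 env s)
  | CIf e c1 c2 =>
      if 0 < eval e env (arr s) then run c1 env (tick s) else run c2 env (tick s)
  | CLet e c => run c (rcons env (eval e env (arr s))) (tick s)
  | CFor e c =>
      iteri (eval e env (arr s)) (fun i s => run c (rcons env i) (tick s)) (tick s)
  end.

(** * Code generation and its simulation by the machine *)

Section Compile.
Variable w : nat.
Local Notation M := (2 ^ w).

(** In the absence of multiplication [M] is a power of two: [w] doublings turn an index [x] into
    [M x], and adding [M + j] gives [M (x + 1) + j]. *)
Definition addr (d j : nat) : seq instr :=
  nseq w (IAdd d d d) ++ [:: IConst d.+1 (M + j); IAdd d d d.+1].

Fixpoint cexp (e : expr) (d : nat) : seq instr :=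
  match e with
  | ECst c => [:: IConst d c]
  | EVar i => [:: IConst d.+1 0; IAdd d i.*2 d.+1]
  | EAdd a b => cexp a d ++ cexp b d.+1 ++ [:: IAdd d d d.+1]
  | ESub a b => cexp a d ++ cexp b d.+1 ++ [:: ISub d d d.+1]
  | EGet j a => cexp a d ++ addr d j ++ [:: ILoad d d]
  end.

(** Jumps are absolute, hence the parameter [pos]. Variables occupy every second register, so that a
    loop keeps its round number in [b] and the remaining rounds in [b + 1], while its body works
    from [b + 2]. A loop is entered at its test, which allows zero rounds; the else branch comes
    first because the only jump is taken on a positive register. *)
Fixpoint compile (c : cmd) (p pos : nat) : seq instr :=
  let b := p.*2 in
  match c with
  | CSet j i e => cexp i b ++ addr b j ++ cexp e b.+1 ++ [:: IStore b b.+1]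
  | CRead j i => cexp i b ++ addr b j ++ [:: IRead b.+1; IStore b b.+1]
  | CPrint e => cexp e b ++ [:: IPrint b]
  | CSeq c1 c2 =>
      let k1 := compile c1 p pos in k1 ++ compile c2 p (pos + size k1)
  | CIf e c1 c2 =>
      let ke := cexp e b in
      let k2 := compile c2 p (pos + size ke).+1 in
      let l1 := (pos + size ke).+1 + size k2 + 2 in
      let k1 := compile c1 p l1 in
      ke ++ IJpos b l1 :: k2 ++ [:: IConst b 1; IJpos b (l1 + size k1)] ++ k1
  | CLet e c =>
      let ke := cexp e b in ke ++ compile c p.+1 (pos + size ke)
  | CFor e c =>
      let ke := cexp e b.+1 in
      let start := pos + size ke + 3 in
      let k := compile c p.+1 start in
      ke ++ [:: IConst b 0; IConst b.+2 1; IJpos b.+2 (start + size k + 3)] ++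
      k ++ [:: IConst b.+2 1; IAdd b b b.+2; ISub b.+1 b.+1 b.+2; IJpos b.+1 start]
  end.

Fixpoint wfe (e : expr) (p d : nat) : bool :=
  match e with
  | ECst _ => d < M
  | EVar i => (i < p) && (d.+1 < M)
  | EAdd a b | ESub a b => wfe a p d && wfe b p d.+1
  | EGet j a => [&& j < M, d.+1 < M & wfe a p d]
  end.

Lemma wfe_lt e p d : wfe e p d -> d < M.
Proof.
elim: e p d => [?|?|? H ? _|? H ? _|? ? H] ? ? /=; first by [].
- by case/andP; lia.
- by case/andP=> /H.
- by case/andP=> /H.
- by case/and3P=> _ _ /H.
Qed.

Fixpoint wf (c : cmd) (p : nat) : bool :=
  let b := p.*2 in
  match c with
  | CSet j i e => [&& j < M, wfe i p b, b.+1 < M & wfe e p b.+1]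
  | CRead j i => [&& j < M, wfe i p b & b.+1 < M]
  | CPrint e => wfe e p b
  | CSeq c1 c2 => wf c1 p && wf c2 p
  | CIf e c1 c2 => [&& wfe e p b, wf c1 p & wf c2 p]
  | CLet e c => wfe e p b && wf c p.+1
  | CFor e c => [&& wfe e p b.+1, b.+2 < M & wf c p.+1]
  end.

Definition code_at (P : seq instr) (pos : nat) (k : seq instr) : Prop :=
  exists pre post, P = pre ++ k ++ post /\ size pre = pos.

Lemma code_at_cat P pos k1 k2 :
  code_at P pos (k1 ++ k2) -> code_at P pos k1 /\ code_at P (pos + size k1) k2.
Proof.
move=> [pre [post [-> <-]]]; split.
  by exists pre, (k2 ++ post); rewrite -!catA.
by exists (pre ++ k1), post; rewrite size_cat -!catA.
Qed.

Lemma code_at_size P pos k : code_at P pos k -> size k <= size P.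
Proof. by move=> [pre [post [-> _]]]; rewrite !size_cat; lia. Qed.

Lemma code_at_cons P pos i k :
  code_at P pos (i :: k) -> onth P pos = Some i /\ code_at P pos.+1 k.
Proof.
move=> [pre [post [-> <-]]]; split.
  by rewrite onth_cat ltnn subnn.
by exists (rcons pre i), post; rewrite size_rcons -cats1 -!catA.
Qed.

Definition steps (P : seq instr) (c : config) (t : nat) (c' : config) : Prop :=
  iter t (step P) c = c'.

Lemma steps_trans P c1 t1 c2 t2 c3 :
  steps P c1 t1 c2 -> steps P c2 t2 c3 -> steps P c1 (t1 + t2) c3.
Proof. by rewrite /steps addnC iterD => -> ->. Qed.

Lemma steps_snoc P c t pos X ip o ins :
  steps P c t (Config pos X ip o) -> onth P pos = Some ins ->
  steps P c t.+1 (exec ins (Config pos X ip o)).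
Proof. by rewrite /steps iterS => -> /= h; rewrite /step /= h. Qed.

Lemma steps1 P ins pos X ip o :
  onth P pos = Some ins ->
  steps P (Config pos X ip o) 1 (exec ins (Config pos X ip o)).
Proof. by rewrite /steps /= /step /= => ->. Qed.

(** Register [2 * i] holds the variable of level [i]; cell [i] of array [j]
    lives at address [M * (i + 1) + j], so that the arrays neither overlap nor
    have to be allocated. *)
Definition rep (env : seq nat) (X : nat -> nat) (A : nat -> nat -> nat) : Prop :=
  (forall i, i < size env -> X i.*2 = nth 0 env i) /\
  (forall j i, j < M -> X (M * i.+1 + j) = A j i).

(** The registers in [[d, M)] are scratch: live variables lie below [d], arrays from [M] on. *)
Definition agree (d : nat) (X X' : nat -> nat) : Prop :=
  (forall r, r < d -> X' r = X r) /\ (forall r, M <= r -> X' r = X r).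

Lemma agree_trans d X1 X2 X3 : agree d X1 X2 -> agree d X2 X3 -> agree d X1 X3.
Proof.
by move=> [h1 h2] [h3 h4]; split=> r hr; [rewrite h3 // h1|rewrite h4 // h2].
Qed.

Lemma agreeW d d' X X' : d <= d' -> agree d' X X' -> agree d X X'.
Proof. by move=> dd [h1 h2]; split=> // r hr; apply: h1; lia. Qed.

Lemma agree_upd d d' X v : d <= d' < M -> agree d X [eta X with d' |-> v].
Proof. by move=> /andP[h1 h2]; split=> r hr /=; case: eqP => // ?; lia. Qed.

Ltac agree_upds :=
  repeat ((apply: agree_upd; lia) || (apply: agree_trans; last by apply: agree_upd; lia)).

Lemma agree_rep env X X' A :
  agree (size env).*2 X X' -> rep env X A -> rep env X' A.
Proof.
move=> [h1 h2] [r1 r2]; split=> [i hi|j i hj].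
  by rewrite h1 ?r1 //; lia.
by rewrite h2 ?r2 //; nia.
Qed.

Lemma double_steps P pos d X ip o m :
  d < M -> code_at P pos (nseq m (IAdd d d d)) ->
  exists X', [/\ steps P (Config pos X ip o) m (Config (pos + m) X' ip o),
     X' d = 2 ^ m * X d & agree d X X'].
Proof.
move=> dM; elim: m pos X => [|m IH] pos X hc.
  by exists X; split=> //; rewrite ?addn0 ?mul1n.
have [h1 h2] := code_at_cons hc.
have [X' [s1 e1 a1]] := IH _ [eta X with d |-> X d + X d] h2.
exists X'; split.
- rewrite -[in steps _ _ m.+1]add1n; apply: steps_trans (steps1 _ _ _ h1) _.
  by rewrite /= -addSnnS.
- by rewrite e1 /= eqxx expnS; lia.
- by apply: agree_trans a1; apply: agree_upd; lia.
Qed.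

Lemma addr_steps P pos d j X ip o :
  d.+1 < M -> code_at P pos (addr d j) ->
  exists X', [/\ steps P (Config pos X ip o) (size (addr d j))
                   (Config (pos + size (addr d j)) X' ip o),
     X' d = M * (X d).+1 + j & agree d X X'].
Proof.
move=> dM /code_at_cat[hc1]; rewrite size_nseq => hc2.
have [|X1 [s1 e1 a1]] := double_steps X ip o _ hc1; first by lia.
have [h3 /code_at_cons[h4 _]] := code_at_cons hc2.
have s2 := steps1 X1 ip o h3; have s3 := steps_trans s2 (steps1 _ ip o h4).
eexists; split.
- rewrite size_cat size_nseq; apply: steps_trans s1 _.
  by rewrite addnA addn2; exact: s3.
- by rewrite /= eqxx; case: eqP => [|_]; [lia|]; rewrite eqxx e1; nia.
- apply: agree_trans a1 _; agree_upds.
Qed.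

Lemma cexp_steps e P pos env X A ip o d :
  rep env X A -> (size env).*2 <= d -> wfe e (size env) d ->
  code_at P pos (cexp e d) ->
  exists X', [/\ steps P (Config pos X ip o) (size (cexp e d))
                   (Config (pos + size (cexp e d)) X' ip o),
     X' d = eval e env A & agree d X X'].
Proof.
elim: e pos X d => [c|i|a IHa b IHb|a IHa b IHb|j a IHa] pos X d rX hd /=.
- move=> dM /code_at_cons[h _]; eexists; split.
  + by rewrite /= addn1; apply: steps1 h.
  + by rewrite /= eqxx.
  + by apply: agree_upd; rewrite leqnn.
- move=> /andP[hi dM] /code_at_cons[h1 /code_at_cons[h2 _]].
  eexists; split.
  + by rewrite addn2; exact: steps_trans (steps1 _ _ _ h1) (steps1 _ _ _ h2).
  + rewrite /= !eqxx addn0; case: eqP => [|_]; first by lia.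
    by case: rX => ->.
  + agree_upds.
- move=> /andP[wa wb] /code_at_cat[ha /code_at_cat[hb /code_at_cons[h _]]].
  have [X1 [s1 e1 a1]] := IHa _ _ _ rX hd wa ha.
  have r1 := agree_rep (agreeW hd a1) rX.
  have [|X2 [s2 e2 a2]] := IHb _ _ _ r1 _ wb hb; first by lia.
  have dM := wfe_lt wb.
  eexists; split.
  + rewrite !size_cat /= !addnA !addn1.
    exact: steps_snoc (steps_trans s1 s2) h.
  + by rewrite /= eqxx e2; case: a2 => -> //; rewrite e1.
  + apply: agree_trans a1 _; apply: agree_trans (agreeW _ a2) _; first by lia.
    agree_upds.
- move=> /andP[wa wb] /code_at_cat[ha /code_at_cat[hb /code_at_cons[h _]]].
  have [X1 [s1 e1 a1]] := IHa _ _ _ rX hd wa ha.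
  have r1 := agree_rep (agreeW hd a1) rX.
  have [|X2 [s2 e2 a2]] := IHb _ _ _ r1 _ wb hb; first by lia.
  have dM := wfe_lt wb.
  eexists; split.
  + rewrite !size_cat /= !addnA !addn1.
    exact: steps_snoc (steps_trans s1 s2) h.
  + by rewrite /= eqxx e2; case: a2 => -> //; rewrite e1.
  + apply: agree_trans a1 _; apply: agree_trans (agreeW _ a2) _; first by lia.
    agree_upds.
- move=> /and3P[hj dM wa] /code_at_cat[ha /code_at_cat[hb /code_at_cons[h _]]].
  have [X1 [s1 e1 a1]] := IHa _ _ _ rX hd wa ha.
  have r1 := agree_rep (agreeW hd a1) rX.
  have [X2 [s2 e2 a2]] := addr_steps X1 ip o dM hb.
  have r2 := agree_rep (agreeW hd a2) r1.
  eexists; split.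
  + rewrite size_cat [size (addr d j ++ _)]size_cat addn1 !addnS addnA.
    exact: steps_snoc (steps_trans s1 s2) h.
  + by rewrite /= eqxx e2 e1; case: r2 => _ ->.
  + apply: agree_trans a1 _; apply: agree_trans a2 _; agree_upds.
Qed.

Lemma rep_rcons env v X A :
  rep (rcons env v) X A <-> rep env X A /\ X (size env).*2 = v.
Proof.
split=> [[h1 h2]|[[h1 h2] hv]].
  split; first split=> // i hi.
    by have := h1 i; rewrite size_rcons nth_rcons hi; apply; lia.
  by have := h1 (size env); rewrite size_rcons nth_rcons ltnn eqxx; apply.
split=> // i; rewrite size_rcons ltnS leq_eqVlt => /orP[/eqP ->|hi].
  by rewrite nth_rcons ltnn eqxx.
by rewrite nth_rcons hi h1.
Qed.

Lemma rep_store env X A a j i v :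
  (size env).*2 < M -> j < M -> rep env X A -> a = M * i.+1 + j ->
  rep env [eta X with a |-> v] (seta A j (upd (A j) i v)).
Proof.
move=> eM jM [h1 h2] ->; split=> [l hl|j' i' hj'] /=.
  by case: eqP => [|_]; [nia|exact: h1].
rewrite /seta -[eqn j' j]/(j' == j); case: eqP => [hE|hN].
  have ? : i' = i by nia.
  have -> : j' = j by nia.
  by rewrite eqxx updE; case: eqP.
rewrite h2 //; case: eqP => [ej|//]; rewrite updE ej.
by case: eqP => // ei; case: hN; rewrite ei ej.
Qed.

Lemma store_low r d x j : r < d -> d < M -> r = M * x.+1 + j -> False.
Proof. by rewrite mulnS; lia. Qed.

Lemma rep_agree_low env X X' A d :
  (size env).*2 <= d -> agree d X X' -> rep env X A -> rep env X' A.
Proof. by move=> hd hA; apply: agree_rep (agreeW hd hA). Qed.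

(** Every command with code of its own, and every round of a loop, has a tick; it pays for executing
    these own instructions once, which takes at most [size P + 8] steps. The bound has a term on
    both sides to avoid a subtraction. *)
Lemma compile_steps c P pos env X s :
  rep env X (arr s) -> wf c (size env) ->
  code_at P pos (compile c (size env) pos) ->
  let s' := run c env s in
  exists X' t, [/\ steps P (Config pos X (inp s) (out s)) t
      (Config (pos + size (compile c (size env) pos)) X' (inp s') (out s')),
    t + (size P + 8) * ticks s <= (size P + 8) * ticks s',
    rep env X' (arr s') & forall r, r < (size env).*2 -> X' r = X r].
Proof.
elim: c pos env X s => [j i e|j i|e|c1 IH1 c2 IH2|e c1 IH1 c2 IH2|e c IH|e c IH]
  pos env X s rX /=.
- move=> /and4P[jM wi bM we] hc; have szP := code_at_size hc.
  move: hc => /code_at_cat[hi /code_at_cat[ha /code_at_cat[he /code_at_cons[h _]]]].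
  have [//|X1 [s1 e1 a1]] := cexp_steps (inp s) (out s) rX _ wi hi.
  have r1 := agree_rep a1 rX.
  have [X2 [s2 e2 a2]] := addr_steps X1 (inp s) (out s) bM ha.
  have r2 := agree_rep a2 r1.
  have [|X3 [s3 e3 a3]] := cexp_steps (inp s) (out s) r2 _ we he; first by lia.
  have r3 : rep env X3 (arr s) by apply: rep_agree_low a3 r2; lia.
  have e3' : X3 (size env).*2 = X2 (size env).*2 by case: a3 => -> //; lia.
  eexists; eexists; split.
  + have := steps_snoc (steps_trans s1 (steps_trans s2 s3)) h.
    rewrite /= => hs; rewrite 3!size_cat addn1 !addnS !addnA; exact: hs.
  + move: szP; rewrite !size_cat /=; nia.
  + rewrite e3; apply: rep_store => //; first by lia.
    by rewrite e3' e2 e1.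
  + move=> r hr /=; rewrite e3' e2; case: eqP => [rE|_].
      by case: (store_low hr _ rE); lia.
    by case: a3 => -> //; [|lia]; case: a2 => -> //; case: a1 => ->.
- move=> /and3P[jM wi bM] hc; have szP := code_at_size hc.
  move: hc => /code_at_cat[hi /code_at_cat[ha /code_at_cons[h1 /code_at_cons[h2 _]]]].
  have [//|X1 [s1 e1 a1]] := cexp_steps (inp s) (out s) rX _ wi hi.
  have r1 := agree_rep a1 rX.
  have [X2 [s2 e2 a2]] := addr_steps X1 (inp s) (out s) bM ha.
  have r2 := agree_rep a2 r1.
  eexists; eexists; split.
  + have := steps_snoc (steps_snoc (steps_trans s1 s2) h1) h2.
    rewrite /= => hs; rewrite 2!size_cat !addnS !addn0 !addnA; exact: hs.
  + move: szP; rewrite !size_cat /=; nia.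
  + rewrite /= eqxx; case: eqP => [|_]; first by lia.
    apply: rep_store => //; [by lia| |by rewrite e2 e1].
    by apply: rep_agree_low r2; last by apply: (@agree_upd (size env).*2); lia.
  + move=> r hr /=.
    have -> : (r == (size env).*2.+1) = false by apply/eqP; lia.
    have -> : ((size env).*2 == (size env).*2.+1) = false by apply/eqP; lia.
    rewrite e2; case: eqP => [/(store_low hr)|_]; first by lia.
    by case: a2 => -> //; case: a1 => ->.
- move=> we hc; have szP := code_at_size hc.
  move: hc => /code_at_cat[hi /code_at_cons[h1 _]].
  have [//|X1 [s1 e1 a1]] := cexp_steps (inp s) (out s) rX _ we hi.
  exists X1; eexists; split.
  + have := steps_snoc s1 h1.
    rewrite /= e1 size_cat addn1 addnS => hs; exact: hs.
  + by move: szP; rewrite !size_cat /=; nia.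
  + exact: agree_rep a1 rX.
  + by case: a1.
- move=> /andP[w1 w2] /code_at_cat[h1 h2].
  have [X1 [t1 [s1 l1 r1 a1]]] := IH1 _ _ _ _ rX w1 h1.
  have [X2 [t2 [s2 l2 r2 a2]]] := IH2 _ _ _ _ r1 w2 h2.
  exists X2, (t1 + t2); split=> //.
  + by rewrite size_cat addnA; exact: steps_trans s1 s2.
  + by lia.
  + by move=> r hr; rewrite a2 // a1.
- move=> /and3P[we w1 w2] hc; have szP := code_at_size hc.
  move: hc => /code_at_cat[he /code_at_cons[h1 /code_at_cat[hk2]]].
  move=> /code_at_cons[h3 /code_at_cons[h4 hk1]].
  have [//|X1 [s1 e1 a1]] := cexp_steps (inp s) (out s) rX _ we he.
  have r1 := agree_rep a1 rX.
  have st := steps_snoc s1 h1; rewrite /= e1 in st.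
  move: szP; rewrite !size_cat /= ?size_cat /= => szP.
  set ke := cexp e _ in h1 h3 h4 hk2 hk1 szP st *.
  set k2 := compile c2 _ _ in h1 h3 h4 hk2 hk1 szP st *.
  set l1 := _ + 2 in h1 h3 h4 hk2 hk1 szP st *.
  set k1 := compile c1 _ _ in h1 h3 h4 hk2 hk1 szP st *.
  case: ifP st => hpos st.
  + have hk1' : code_at P l1 k1 by move: hk1; rewrite /l1 addn2.
    have [X2 [t2 [s2 l2 r2 a2]]] := IH1 _ _ _ (tick s) r1 w1 hk1'.
    exists X2; eexists; split.
    * have := steps_trans st s2; rewrite -/k1 /l1 => hs.
      rewrite (_ : pos + (size ke + _) = (pos + size ke).+1 + size k2 + 2 + size k1);
        [exact: hs|lia].
    * by move: l2 => /=; nia.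
    * exact: r2.
    * by move=> r hr; rewrite a2 //; case: a1 => ->.
  + have [X2 [t2 [s2 l2 r2 a2]]] := IH2 _ _ _ (tick s) r1 w2 hk2.
    have bM := wfe_lt we.
    exists [eta X2 with (size env).*2 |-> 1]; eexists; split.
    * have := steps_snoc (steps_snoc (steps_trans st s2) h3) h4.
      rewrite /= eqxx /l1 -/k1 => hs.
      rewrite (_ : pos + (size ke + _) = (pos + size ke).+1 + size k2 + 2 + size k1);
        [exact: hs|lia].
    * by move: l2 => /=; nia.
    * by apply: rep_agree_low r2; last by apply: (@agree_upd (size env).*2); lia.
    * move=> r hr /=; case: eqP => [|_]; first by lia.
      by rewrite a2 //; case: a1 => ->.
- move=> /andP[we w1] hc; have szP := code_at_size hc.
  move: hc => /code_at_cat[he hk].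
  have [//|X1 [s1 e1 a1]] := cexp_steps (inp s) (out s) rX _ we he.
  have r1 : rep (rcons env (eval e env (arr s))) X1 (arr (tick s)).
    by apply/rep_rcons; split=> //; exact: agree_rep a1 rX.
  have := IH (pos + size (cexp e (size env).*2)) _ _ (tick s) r1.
  rewrite size_rcons => /(_ w1 hk)[X2 [t2 [s2 l2 /rep_rcons[r2 _] a2]]].
  exists X2; eexists; split.
  + rewrite size_cat addnA; exact: steps_trans s1 s2.
  + by move: szP l2; rewrite size_cat /=; nia.
  + exact: r2.
  + by move=> r hr; rewrite a2; [case: a1 => ->|lia].
- move=> /and3P[we bM wc] hc; have szP := code_at_size hc.
  move: hc => /code_at_cat[he /code_at_cons[h1 /code_at_cons[h2 /code_at_cons[h3]]]].
  move=> /code_at_cat[hk /code_at_cons[h4 /code_at_cons[h5 /code_at_cons[h6]]]].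
  move=> /code_at_cons[h7 _].
  move: szP; rewrite !size_cat /= ?size_cat /= => szP.
  have [|X1 [s1 e1 a1]] := cexp_steps (inp s) (out s) rX _ we he; first by lia.
  have r1 : rep env X1 (arr s) by apply: rep_agree_low a1 rX; lia.
  have low1 r : r < (size env).*2 -> X1 r = X r by move=> hr; case: a1 => -> //; lia.
  have st0 := steps_snoc (steps_snoc (steps_snoc s1 h1) h2) h3.
  rewrite /= !eqxx /= in st0.
  set b := (size env).*2 in st0 s1 e1 h1 h2 h3 h4 h5 h6 h7 hk he szP low1 bM *.
  set ke := cexp e _ in st0 s1 h1 h2 h3 h4 h5 h6 h7 hk he szP *.
  set start := pos + size ke + 3 in st0 h1 h2 h3 h4 h5 h6 h7 hk he szP *.
  set k := compile c _ _ in st0 h1 h2 h3 h4 h5 h6 h7 hk he szP *.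
  set test := start + size k + 3 in st0.
  rewrite -/test in h3.
  have startE : (pos + size ke).+3 = start by rewrite /start addn3.
  have testE : (start + size k).+3 = test by rewrite /test addn3.
  rewrite startE in h4 h5 h6 h7 hk; rewrite testE in h7.
  set N := eval e env (arr s).
  pose body i s := run c (rcons env i) (tick s).
  (* The machine is described at the test instruction after [m] rounds; the slack of 1 pays for the
     final, failing jump. *)
  suff loop m : m <= N -> exists X' t, [/\
      steps P (Config pos X (inp s) (out s)) t
        (Config test X' (inp (iteri m body (tick s))) (out (iteri m body (tick s)))),
      t + (size P + 8) * ticks s + 1 <=
        (size P + 8) * ticks (iteri m body (tick s)),
      rep env X' (arr (iteri m body (tick s))), X' b = m & X' b.+1 = N - m /\
      forall r, r < b -> X' r = X r].
    have [X' [t [st lt rt Xb [Xb1 low]]]] := loop N (leqnn N).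
    exists X'; eexists; split.
    * have := steps_snoc st h7; rewrite /= Xb1 subnn /= => hs.
      rewrite (_ : pos + (size ke + _) = test.+1); [exact: hs|].
      by rewrite /test /start; lia.
    * by rewrite addSn -addn1; exact: lt.
    * exact: rt.
    * exact: low.
  elim: m => [_|m IHm lt_mN].
    exists [eta [eta X1 with b |-> 0] with b.+2 |-> 1], (size ke).+3; split.
    * exact: st0.
    * by rewrite /=; nia.
    * apply: rep_agree_low r1; last by
        (apply: (@agree_trans b); apply: agree_upd; lia).
      by [].
    * rewrite /= eqxx; by case: eqP => // ?; lia.
    * rewrite /=; split.
        do 2 (case: eqP => [?|_]; first by lia).
        by rewrite subn0.
      move=> r hr; do 2 (case: eqP => [?|_]; first by lia).
      exact: low1.
  have [|X' [t [st lt rt Xb [Xb1 low]]]] := IHm; first by lia.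
  set sm := iteri m body (tick s) in st lt rt.
  have st1 := steps_snoc st h7; rewrite /= Xb1 subn_gt0 lt_mN in st1.
  have rr : rep (rcons env m) X' (arr (tick sm)) by apply/rep_rcons.
  have := IH start _ _ (tick sm) rr; rewrite size_rcons.
  move=> /(_ wc hk)[X2 [t2 [st2 lt2 /rep_rcons[r2 X2b] low2]]].
  have st3 := steps_snoc (steps_snoc (steps_snoc (steps_trans st1 st2) h4) h5) h6.
  have X2b1 : X2 b.+1 = N - m by rewrite low2 //; lia.
  have F1 : (b == b.+2) = false by apply/eqP; lia.
  have F2 : (b.+1 == b) = false by apply/eqP; lia.
  have F3 : (b.+1 == b.+2) = false by apply/eqP; lia.
  have F4 : (b.+2 == b) = false by apply/eqP; lia.
  rewrite /= -/b !eqxx ?F1 ?F2 ?F3 ?F4 ?eqxx X2b X2b1 in st3.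
  eexists; eexists; split.
  + rewrite -testE; exact: st3.
  + by apply: leq_trans lt2; rewrite /= mulnS; lia.
  + apply: rep_agree_low r2; last first.
      apply: (@agree_trans b); last by apply: agree_upd; lia.
      apply: (@agree_trans b); last by apply: agree_upd; lia.
      by apply: agree_upd; lia.
    by [].
  + by rewrite /= ?F1 ?F2 ?F3 ?F4 ?eqxx ?addn1; case: eqP => [?|_] //; lia.
  + split; first by rewrite /= ?eqxx; lia.
    move=> r hr /=; do 3 (case: eqP => [?|_]; first by lia).
    by rewrite low2 ?low //; lia.
Qed.

Theorem compile_runs_within c x :
  wf c 0 -> let s := run c [::] (State (fun _ _ => 0) x [::] 0) in
  exists t, runs_within (compile c 0 0) x t (out s) /\
    t <= (size (compile c 0 0) + 8) * ticks s.
Proof.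
move=> wc s; set P := compile c 0 0.
have hP : code_at P 0 (compile c (size (@nil nat)) 0).
  by exists [::], [::]; rewrite cats0.
have hr : rep [::] (fun=> 0) (fun _ _ => 0) by split.
have [X' [t [st lt _ _]]] :=
  @compile_steps c P 0 [::] _ (State (fun _ _ => 0) x [::] 0) hr wc hP.
exists t; split; last by move: lt; rewrite muln0 addn0.
rewrite /runs_within /=; move: st; rewrite /steps /= => ->; split=> //.
exact: leqnn.
Qed.

End Compile.

(** * Deciding [n ^ 121 <= exp (50 m)] by a partial sum of the exponential series *)

Import Order.TTheory GRing.Theory Num.Theory.

(** * Hermite's polynomials: divisibility and size of their integer values *)

Section HermitePoly.
Local Open Scope ring_scope.

(** For [N >= size p] this is [F = p + p' + p'' + ...], the solution of [F - F' = p]. Hence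
    [e^(-x) F] has derivative [- e^(-x) p], which links exponentials to the integers [F(0)] and
    [F(a)]. *)
Definition deriv_sum (N : nat) (p : {poly int}) : {poly int} :=
  \sum_(i < N) p^`(i).

Lemma deriv_sumE N (p : {poly int}) :
  (size p <= N)%N -> p = deriv_sum N p - (deriv_sum N p)^`().
Proof.
move=> szp; rewrite /deriv_sum raddf_sum -sumrB.
under eq_bigr => i _ do rewrite /= -derivnS -opprB.
rewrite sumrN -(big_mkord xpredT (fun i => p^`(i.+1) - p^`(i))) telescope_sumr //.
by rewrite (derivn_poly0 szp) derivn0 sub0r opprK.
Qed.

Lemma deriv_sum_horner0 N (p : {poly int}) :
  (deriv_sum N p).[0] = \sum_(i < N) p`_i *+ i`!.
Proof.
rewrite /deriv_sum horner_sum; apply: eq_bigr => i _.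
by rewrite horner_coef0 coef_derivn addn0 ffactnn.
Qed.

Lemma leq_fact_dvdn m n : (m <= n)%N -> (m`! %| n`!)%N.
Proof. by move=> mn; rewrite -(bin_fact mn) mulnCA dvdn_mulr. Qed.

(** The [i]-th derivative at 0 is [i!] times the [i]-th coefficient; only coefficients with [i >= j]
    survive, and [j!] divides those [i!]. *)
Lemma deriv_sum_dvd N j (g : {poly int}) :
  exists z : int, (deriv_sum N ('X^j * g)).[0] = j`!%:Z * z.
Proof.
exists (\sum_(i < N) ('X^j * g)`_i *+ (i`! %/ j`!)).
rewrite deriv_sum_horner0 mulr_sumr; apply: eq_bigr => i _.
rewrite coefXnM; case: ltnP => [_|ji]; first by rewrite !mul0rn mulr0.
by rewrite -[in LHS](divnK (leq_fact_dvdn ji)) mulrnA -[LHS]mulr_natl natz.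
Qed.

Lemma deriv_sum_comp N (p : {poly int}) (a : int) :
  (deriv_sum N p).[a] = (deriv_sum N (p \Po ('X + a%:P))).[0].
Proof.
have comp i : (p \Po ('X + a%:P))^`(i) = p^`(i) \Po ('X + a%:P).
  elim: i => [//|i IH].
  by rewrite !derivnS IH deriv_comp derivD derivX derivC addr0 mulr1.
rewrite /deriv_sum !horner_sum; apply: eq_bigr => i _.
by rewrite comp horner_comp hornerD hornerX hornerC add0r.
Qed.

Definition hermite_poly (a j : nat) : {poly int} :=
  'X^j * ((Posz a)%:P - 'X) ^+ j.

Definition hermite_sum a j := deriv_sum j.*2.+1 (hermite_poly a j).

Lemma size_hermite_poly a j : (size (hermite_poly a j) <= j.*2.+1)%N.
Proof.
apply: leq_trans (size_polyMleq _ _) _; rewrite size_polyXn /=.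
have szX : (size ((Posz a)%:P - 'X)%R <= 2)%N.
  apply: leq_trans (size_polyD _ _) _.
  by rewrite size_polyN size_polyX geq_max size_polyC; case: eqP.
have : (size (((Posz a)%:P - 'X) ^+ j)%R <= j.+1)%N.
  apply: leq_trans (size_poly_exp_leq _ _) _.
  rewrite ltnS -[leqRHS]mul1n leq_mul2r.
  by case: (size _) szX => [|[|[]]] //; rewrite orbT.
by move: (size _) => m hm; rewrite -addnn; lia.
Qed.

Lemma hermite_poly0 a j : exists z : int,
  (hermite_sum a j).[0] = j`!%:Z * z.
Proof. exact: deriv_sum_dvd. Qed.

(** The polynomial [x^j (a - x)^j] also vanishes to order [j] at [a]: translated by [a] it is again
    a multiple of [x^j]. *)
Lemma hermite_polya a j : exists z : int,
  (hermite_sum a j).[a%:Z] = j`!%:Z * z.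
Proof.
rewrite /hermite_sum deriv_sum_comp.
have -> : hermite_poly a j \Po ('X + (Posz a)%:P) =
    'X^j * ((-1) ^+ j * ('X + (Posz a)%:P) ^+ j).
  rewrite /hermite_poly comp_polyM !comp_Xn_poly rmorphXn /=.
  rewrite comp_polyB comp_polyC comp_polyX mulrC mulrA -exprMn opprD addrCA subrr addr0.
  by rewrite exprMn [(- 'X) ^+ j]exprNn [(-1) ^+ j * _]mulrC.
exact: deriv_sum_dvd.
Qed.

(** Up to sign, the coefficients of [(a - x)^j] are those of [(a + x)^j], which sum to
    [(a + 1)^j]. *)
Lemma hermite_coef a j i : `|(hermite_poly a j)`_i| <= ((a.+1) ^ j)%:Z.
Proof.
rewrite coefXnM; case: ltnP => // _; move: (i - j)%N => {}i.
elim: j i => [|j IH] i; first by rewrite expr0 coef1; case: eqP.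
rewrite exprS mulrBl coefB coefCM coefXM; apply: le_trans (ler_normB _ _) _.
rewrite normrM expnS mulSn addnC PoszD PoszM; apply: lerD.
  by rewrite [`|Posz a|]ger0_norm // ler_wpM2l.
by case: eqP => [|_]; rewrite ?normr0.
Qed.

Lemma hermite_horner0_le a j :
  `|(hermite_sum a j).[0]| <=
    (j.*2.+1`! * a.+1 ^ j)%:Z.
Proof.
rewrite /hermite_sum deriv_sum_horner0; apply: le_trans (ler_norm_sum _ _ _) _.
apply: (@le_trans _ _ (\sum_(i < j.*2.+1) (j.*2`! * a.+1 ^ j)%:Z)).
  apply: ler_sum => i _; rewrite -mulr_natr normrM mulrC PoszM ler_pM //.
    rewrite natz ger0_norm // lez_nat; apply: dvdn_leq; first exact: fact_gt0.
    by apply: leq_fact_dvdn; rewrite -ltnS.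
  exact: hermite_coef.
by rewrite sumr_const card_ord -mulr_natl natz -PoszM mulnA -factS.
Qed.
End HermitePoly.

(** * The distance from [e^a] to integers, against the tail of the exponential series *)

Section HermiteExp.
Variable R : realType.
Local Open Scope ring_scope.
Local Open Scope classical_set_scope.
Import numFieldNormedType.Exports.
Local Notation toR := (map_poly (intr : int -> R)).

(** The mean value theorem for [e^(-t) F(t)] stands in for the integral of [e^(-t) p(t)] over
    [[x, y]]. *)
Lemma deriv_sum_MVT N (p : {poly int}) (x y : R) : x < y -> (size p <= N)%N ->
  exists2 c, c \in `]x, y[%R &
    expR (- x) * (toR (deriv_sum N p)).[x] - expR (- y) * (toR (deriv_sum N p)).[y]
      = expR (- c) * (toR p).[c] * (y - x).
Proof.
move=> xy szp; set F := toR _.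
pose g t := expR (- t) * F.[t].
pose dg t := - (expR (- t) * (toR p).[t]).
have dF t : (toR p).[t] = F.[t] - F^`().[t].
  by rewrite {1}(deriv_sumE szp) rmorphB /= -deriv_map hornerD hornerN.
have Dg (t : R) : is_derive t (1 : R) g (dg t).
  rewrite /g.
  apply: trigger_derive.
  by rewrite /dg dF /GRing.scale /=; ring.
have cg : {within `[x, y], continuous g}.
  apply: continuous_subspaceT => t; apply/differentiable_continuous.
  by apply/derivable1_diffP; case: (Dg t).
have [c cxy Ec] := MVT xy (fun t _ => Dg t) cg.
exists c => //; transitivity (- (g y - g x)); first by rewrite opprB.
have {}Ec : g y - g x = dg c * (y - x) := Ec.
by rewrite Ec /dg mulNr opprK.
Qed.

Lemma horner_hermite_poly a j (c : R) :
  (toR (hermite_poly a j)).[c] = (c * (a%:R - c)) ^+ j.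
Proof.
rewrite /hermite_poly rmorphM /= !rmorphXn /= map_polyX rmorphB /= map_polyX map_polyC /=.
by rewrite hornerM !horner_exp hornerX hornerD hornerN hornerX hornerC -exprMn.
Qed.

(** The remainder is the integral of [f x * exp (a - x)] over [[0, a]], with
    [f = x^j (a - x)^j]; only [[1, 2]] is used for the lower bound. *)
Lemma hermite_remainder a j : (2 < a)%N ->
  (1 : R) <= expR (a%:R : R) * ((hermite_sum a j).[0])%:~R -
      ((hermite_sum a j).[a%:Z])%:~R
    <= expR (a%:R : R) * (a%:R * (a%:R ^+ 2 / 4%:R) ^+ j).
Proof.
move=> a2; set F := hermite_sum a j.
have a3 : 3%:R <= a%:R :> R by rewrite ler_nat.
have F0 : (F.[0])%:~R = (toR F).[0] by rewrite -horner_map /= rmorph0.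
have Fa : (F.[a%:Z])%:~R = (toR F).[a%:R] by rewrite -horner_map.
pose h t : R := expR (- t) * (toR F).[t].
have hE x y : x < y -> exists2 c, c \in `]x, y[%R &
    h x - h y = expR (- c) * (c * (a%:R - c)) ^+ j * (y - x).
  move=> xy; have [c cxy Ec] := deriv_sum_MVT xy (size_hermite_poly a j).
  by exists c => //; rewrite -horner_hermite_poly -Ec.
have pos c : 0 <= c <= a%:R -> 0 <= expR (- c) * (c * (a%:R - c)) ^+ j.
  by move=> hc; rewrite mulr_ge0 ?expR_ge0 // exprn_ge0 // mulr_ge0; lra.
have Eh : expR a%:R * (F.[0])%:~R - (F.[a%:Z])%:~R = expR a%:R * (h 0 - h a%:R) :> R.
  rewrite F0 Fa /h oppr0 expR0 mul1r mulrBr; congr (_ - _).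
  by rewrite mulrA expRxMexpNx_1 mul1r.
rewrite Eh; apply/andP; split; last first.
  rewrite ler_wpM2l ?expR_ge0 //.
  have [|c] := hE 0 a%:R; first by lra.
  rewrite in_itv /= => /andP[c0 ca] ->; rewrite subr0 mulrC ler_wpM2l //.
  rewrite -[leRHS]mul1r ler_pM ?expR_ge0 //.
  - by rewrite exprn_ge0 // mulr_ge0; lra.
  - by rewrite expR_le1; lra.
  - rewrite lerXn2r ?nnegrE ?mulr_ge0 ?divr_ge0 ?exprn_ge0 //; try lra.
    by have := sqr_ge0 (c - a%:R / 2%:R); rewrite !expr2; nra.
have h01 : h 1 <= h 0.
  have [|c] := hE 0 1; first by lra.
  rewrite in_itv /= => /andP[c0 ca] e; rewrite -subr_ge0 e.
  by apply: mulr_ge0; [apply: pos|]; lra.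
have h2a : h a%:R <= h 2%:R.
  have [|c] := hE 2%:R a%:R; first by lra.
  rewrite in_itv /= => /andP[c0 ca] e; rewrite -subr_ge0 e.
  by apply: mulr_ge0; [apply: pos|]; lra.
have h12 : expR (- 2%:R) <= h 1 - h 2%:R.
  have [|c] := hE 1 2%:R; first by lra.
  rewrite in_itv /= => /andP[c0 ca] ->.
  rewrite (_ : 2%:R - 1 = 1 :> R) ?mulr1; last by lra.
  rewrite -[leLHS]mulr1 ler_pM ?expR_ge0 //; first by rewrite ler_expR; lra.
  by apply: exprn_ege1; rewrite -[leLHS]mulr1 ler_pM; lra.
apply: (@le_trans _ _ (expR a%:R * expR (- 2%:R))).
  by rewrite -expRD -[leLHS]expR0 ler_expR; lra.
by rewrite ler_wpM2l ?expR_ge0 //; lra.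
Qed.

(** The inequality [1 + x <= e^x] at [x = -1/2] gives [e^(1/2) <= 2]. An integer base keeps the
    later estimates among natural numbers. *)
Lemma expR1_le4 : expR 1 <= 4%:R :> R.
Proof.
have h : 1 / 2 <= expR (- (1 / 2)) :> R.
  by apply: le_trans (expR_ge1Dx _); lra.
have p := expR_gt0 (1 / 2 : R).
have e1 : expR (1 / 2) * expR (- (1 / 2)) = 1 :> R by rewrite expRxMexpNx_1.
have -> : expR 1 = expR (1 / 2) * expR (1 / 2) :> R by rewrite -expRD; congr expR; lra.
nra.
Qed.

Lemma expR_nat_le4 a : expR a%:R <= 4%:R ^+ a :> R.
Proof.
rewrite -[a%:R]mulr1 expRM_natl lerXn2r ?nnegrE ?expR_ge0 //.
exact: expR1_le4.
Qed.

(** The quotient [j^j / j!] is one term of the series of [e^j], and [e^j <= 4^j]. *)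
Lemma expn_fact_le4 j : (j ^ j <= 4 ^ j * j`!)%N.
Proof.
rewrite -(@ler_nat R) natrX natrM natrX.
case: j => [|j]; first by rewrite !expr0 fact0 mulr1.
have := @expR_ge1Dxn R j.+1%:R j (ler0n _ _) => h.
rewrite -ler_pdivrMr ?ltr0n ?fact_gt0 //.
apply: le_trans (expR_nat_le4 _); apply: le_trans h; rewrite lerDr; exact: ler01.
Qed.

(** This is where [j = 3 a^2] comes from: as [j! >= (j / 4)^j = (3 a^2 / 4)^j], the bound
    [4^a a (a^2 / 4)^j] on the remainder is at most [j! / 2] once [2 * 4^a * a <= 3^j]. *)
Lemma hermite_remainder_small a : (2 < a)%N ->
  (2 * (4 ^ a * a * a ^ (2 * (3 * a ^ 2))) <=
    4 ^ (3 * a ^ 2) * (3 * a ^ 2)`!)%N.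
Proof.
move=> a2; set j := (3 * a ^ 2)%N.
apply: leq_trans (expn_fact_le4 j); rewrite {3}/j expnMn -expnM.
rewrite [(2 * j)%N]mulnC [(j * 2)%N]mulnC mulnA leq_mul2r; apply/orP; right.
apply: (@leq_trans (4 ^ a * 4 ^ a)).
  rewrite mulnCA leq_mul2l; apply/orP; right.
  apply: (@leq_trans (2 * 2 ^ a)); first by rewrite leq_mul2l ltnW ?orbT // ltn_expl.
  by rewrite -expnS -[4%N]/(2 ^ 2)%N -expnM leq_exp2l //; lia.
rewrite -expnMn; apply: (@leq_trans ((3 ^ 3) ^ a)%N).
  by rewrite leq_exp2r; lia.
by rewrite -expnM leq_exp2l // /j; nia.
Qed.

(** With [X = A b - B], an integer, [A (e^a - b) = (A e^a - B) - X]: if [X = 0]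
    the lower bound on the remainder applies, otherwise its upper bound. *)
Lemma exp_gap a b : (2 < a)%N -> b%:R <= expR a%:R :> R ->
  (1 : R) <= (expR (a%:R : R) - b%:R) *
    ((3 * a ^ 2)`! * (((3 * a ^ 2).*2.+1)`! * a.+1 ^ (3 * a ^ 2)))%:R.
Proof.
move=> a2 ba; set j := (3 * a ^ 2)%N; set K := (_`! * a.+1 ^ j)%N.
have [A hA] := hermite_poly0 a j; have [B hB] := hermite_polya a j.
have := hermite_remainder j a2; rewrite /= hA hB !intrM => /andP[h1 h2].
have hK : `|A| <= K%:Z.
  apply: le_trans (hermite_horner0_le a j); rewrite hA normrM ler_peMl //.
  by rewrite ger0_norm // lez_nat fact_gt0.
have {}hK : `|A%:~R| <= K%:R :> R by rewrite -intr_norm [K%:R]pmulrn ler_int.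
set e := expR a%:R in ba h1 h2 *.
have e0 : 0 <= e - b%:R by rewrite subr_ge0.
have jf : j`!%:~R = j`!%:R :> R by rewrite pmulrn.
rewrite jf in h1 h2.
have j2 : 2%:R <= j`!%:R :> R.
  by rewrite ler_nat (leq_trans _ (leq_fact (_ : 2 <= j)%N)) // /j; nia.
have I0 : j`!%:R * (e * A%:~R - B%:~R) >= 1.
  by apply: le_trans h1 _; rewrite le_eqVlt; apply/orP; left; apply/eqP; ring.
(* The remainder is [j!] times this linear form and at most [j! / 2]. A nonzero integer is then at
   distance at least [1/2] from the form. *)
have I1 : e * A%:~R - B%:~R <= 1 / 2.
  have h3 : 2%:R * (e * (a%:R * (a%:R ^+ 2 / 4%:R) ^+ j)) <= j`!%:R :> R.
    have := hermite_remainder_small a2; rewrite -/j -(@ler_nat R) !natrM !natrX => h3.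
    rewrite -(@ler_pM2l _ (4%:R ^+ j)) ?exprn_gt0 //; apply: le_trans h3.
    rewrite expr_div_n -exprM [_ ^+ (2 * j)]lock -(@ler_pM2l _ 1) // !mul1r.
    have -> : 4 ^+ j * (2 * (e * (a%:R * (locked (a%:R ^+ (2 * j)) / 4 ^+ j)))) =
      2 * (e * a%:R * locked (a%:R ^+ (2 * j))) :> R.
      by field; rewrite expf_neq0.
    rewrite ler_pM2l // ler_wpM2r // -?lock ?exprn_ge0 ?ler0n // ler_wpM2r ?ler0n //.
    exact: expR_nat_le4.
  have h4 : j`!%:R * (e * A%:~R - B%:~R) <= j`!%:R * (1 / 2).
    by move: h1 h2 h3; lra.
  by move: h4; rewrite ler_pM2l // ltr0n fact_gt0.
have key : 1 <= j`!%:R * (`|A%:~R| * (e - b%:R)) :> R.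
  set x := e * A%:~R - B%:~R in I0 I1.
  have Ex : A%:~R * (e - b%:R) = x - (A * b%:Z - B)%:~R :> R.
    by rewrite /x intrB intrM -[in RHS]pmulrn; ring.
  rewrite -(ger0_norm e0) -normrM Ex.
  have [->|X0] := eqVneq (A * b%:Z - B) 0.
    by rewrite subr0; apply: le_trans I0 _; rewrite ler_wpM2l ?ler0n // ler_norm.
  have X1 : 1 <= `|(A * b%:Z - B)%:~R| :> R by rewrite -intr_norm ler1z; lia.
  have x0 : 0 <= x.
    by rewrite -(@ler_pM2l _ j`!%:R) ?ltr0n ?fact_gt0 // mulr0; lra.
  have hx : 1 / 2 <= `|x - (A * b%:Z - B)%:~R|.
    rewrite distrC; apply: le_trans (lerB_dist _ _).
    by rewrite (ger0_norm x0); lra.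
  nra.
apply: le_trans key _; rewrite natrM [leRHS]mulrCA ler_wpM2l ?ler0n //.
by rewrite [leRHS]mulrC ler_wpM2r.
Qed.

Lemma leq_fact_mul m n : (m`! * n`! <= (m + n)`!)%N.
Proof.
rewrite -(bin_fact (leq_addr n m)) addKn leq_pmull //.
by rewrite bin_gt0 leq_addr.
Qed.

Lemma exp_partial_le a N : \sum_(i < N) a%:R ^+ i / i`!%:R <= expR a%:R :> R.
Proof.
have := @nondecreasing_cvgn_le R (series (exp_coeff a%:R)) _
  (is_cvg_series_exp_coeff _) N.
rewrite /series /= big_mkord; apply; apply: nondecreasing_series => n _ _.
by apply: exp_coeff_ge0.
Qed.

(** Since [(M + i)! >= M! i!], the terms from index [M] on sum to at most the [M]-th term times the
    whole series. *)
Lemma exp_tail a M :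
  expR a%:R <= \sum_(i < M) a%:R ^+ i / i`!%:R
    + expR a%:R * (a%:R ^+ M / M`!%:R) :> R.
Proof.
have pos i : 0 <= a%:R ^+ i / i`!%:R :> R.
  by rewrite mulr_ge0 ?invr_ge0 ?exprn_ge0 ?ler0n.
have tail K : series (exp_coeff (a%:R : R)) (M + K)%N <=
    \sum_(i < M) a%:R ^+ i / i`!%:R + expR a%:R * (a%:R ^+ M / M`!%:R).
  rewrite /series /= big_mkord big_split_ord /= lerD2l.
  apply: (@le_trans _ _ ((\sum_(i < K) a%:R ^+ i / i`!%:R) * (a%:R ^+ M / M`!%:R))).
    rewrite mulr_suml; apply: ler_sum => i _.
    have fn0 n : n`!%:R != 0 :> R by rewrite pnatr_eq0 -lt0n fact_gt0.
    have -> : a%:R ^+ i / i`!%:R * (a%:R ^+ M / M`!%:R) =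
        a%:R ^+ (M + i) / (M`! * i`!)%:R :> R.
      by rewrite exprD natrM; field; rewrite !fn0.
    rewrite /exp_coeff /= ler_wpM2l ?exprn_ge0 ?ler0n //.
    by rewrite lef_pV2 ?posrE ?ltr0n ?muln_gt0 ?fact_gt0 // ler_nat leq_fact_mul.
  by rewrite ler_wpM2r // exp_partial_le.
rewrite {1}/expR; apply: limr_le; first exact: is_cvg_series_exp_coeff.
near=> K; have hK : (M <= K)%N by near: K; exact: nbhs_infty_ge.
by rewrite -(subnKC hK); exact: tail.
Unshelve. all: by end_near.
Qed.

(** The cube and the threshold 34 originate here: bounding each factor by a power of [a], and using
    [M! >= (M / 4)^M] with [M = a^3], reduces the claim to [a + 33 a^2 + 3 <= a^3], which holds from
    [a = 34] on. *)
Lemma exp_tail_small a : (34 <= a)%N ->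
  (4 ^ a * a ^ (a ^ 3) * ((3 * a ^ 2)`! *
    (((3 * a ^ 2).*2.+1)`! * a.+1 ^ (3 * a ^ 2))) <= (a ^ 3)`!)%N.
Proof.
move=> a34; set j := (3 * a ^ 2)%N; set M := (a ^ 3)%N.
have a0 : (0 < a)%N by lia.
have factX m : (m`! <= m ^ m)%N.
  elim: m => // m IH; rewrite factS expnS leq_mul2l (leq_trans IH) ?orbT //.
  by case: m {IH} => // m; rewrite leq_exp2r.
have ea : (a ^ 3 = a * a * a)%N by rewrite !expnS expn0; lia.
have e2 : (a ^ 2 = a * a)%N by [].
have hj : (j`! <= a ^ (3 * j))%N.
  apply: leq_trans (factX j) _; rewrite expnM.
  have [->|j0] := posnP j; first by [].
  by rewrite leq_exp2r // /j ea e2; nia.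
have hj2 : ((j.*2.+1)`! <= a ^ (3 * j.*2.+1))%N.
  apply: leq_trans (factX _) _; rewrite expnM leq_exp2r // /j ea e2; nia.
have hj3 : (a.+1 ^ j <= a ^ (2 * j))%N.
  rewrite expnM; have [->|j0] := posnP j; first by [].
  by rewrite leq_exp2r // e2; nia.
have h4 m : (4 ^ m <= a ^ m)%N.
  by have [->|m0] := posnP m; [|rewrite leq_exp2r //; lia].
rewrite -(@leq_pmul2l (4 ^ M)) ?expn_gt0 //.
apply: leq_trans (expn_fact_le4 M).
have -> : (M ^ M = a ^ (3 * M))%N by rewrite expnM.
apply: (@leq_trans (a ^ M * (a ^ a * a ^ M *
    (a ^ (3 * j) * (a ^ (3 * j.*2.+1) * a ^ (2 * j)))))%N).
  by rewrite !leq_mul.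
rewrite -!expnD leq_pexp2l //.
have -> : (3 * M = M + M + M)%N by lia.
rewrite -!addnA leq_add2l addnCA leq_add2l /M ea /j e2; nia.
Qed.

(** With [K] the factor in [exp_gap], [e^a - b] is at least [1 / K] and the tail at most [1 / K], so
    [b] cannot fall between the partial sum and [e^a]. *)
Lemma exp_partial_ge a b : (34 <= a)%N -> b%:R <= expR a%:R :> R ->
  b%:R <= \sum_(i < a ^ 3) a%:R ^+ i / i`!%:R :> R.
Proof.
move=> a34 ba; have [|] := (exp_gap _ ba, exp_tail_small a34); first by lia.
set K := (_`! * _)%N; set M := (a ^ 3)%N => gap small.
have tail := exp_tail a M.
suff : expR a%:R * (a%:R ^+ M / M`!%:R) <= expR a%:R - b%:R :> R by move: tail; lra.
have K0 : 0 < K%:R :> R.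
  by rewrite ltr0n /K !muln_gt0 !fact_gt0 expn_gt0.
rewrite -(@ler_pM2r _ K%:R) //; apply: le_trans gap.
rewrite mulrA mulrAC ler_pdivrMr ?ltr0n ?fact_gt0 // mul1r.
move: small; rewrite -(@ler_nat R) => small; apply: le_trans small.
clearbody K; rewrite !natrM !natrX ler_wpM2r ?ler0n // ler_wpM2r ?exprn_ge0 ?ler0n //.
exact: expR_nat_le4.
Qed.
End HermiteExp.

(** * The integer test for [ceil (2.42 log n)], and bounds on this number *)

Fixpoint exp_numer (a N : nat) : nat :=
  if N is i.+1 then exp_numer a i * i.+1 + a ^ i.+1 else 1.

(** Clearing denominators by [N!] makes the test a comparison of integers, and the recurrence
    multiplies only by [a] and by the term index. *)
Lemma exp_numerE (R : realType) (a N : nat) :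
  ((exp_numer a N)%:R = (\sum_(i < N.+1) a%:R ^+ i / i`!%:R) * N`!%:R :> R)%R.
Proof.
elim: N => [|N IH]; first by rewrite big_ord1 expr0 fact0 mulr1n invr1 !mulr1.
rewrite /= natrD natrM IH natrX [in RHS]big_ord_recr /= mulrDl divfK; last first.
  by rewrite pnatr_eq0 -lt0n fact_gt0.
by congr (_ + _)%R; rewrite factS natrM mulrA mulrAC.
Qed.

Definition log_dim (R : realType) (n : nat) : nat :=
  `|Num.ceil (242%:R / 100%:R * ln (n%:R : R))%R|%N.

Lemma log_dim_le (R : realType) n m : 0 < n ->
  (log_dim R n <= m) = ((n ^ 121)%:R <= expR (50 * m)%:R :> R)%R.
Proof.
move=> n0; have ln0 : (0 <= ln (n%:R : R))%R by rewrite ln_ge0 // ler1n.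
rewrite /log_dim -lez_nat gez0_abs; last first.
  by rewrite ceil_ge0; lra.
rewrite ceil_le_int natrX -[in RHS](@lnK R n%:R%R) ?posrE ?ltr0n //.
rewrite -expRM_natl ler_expR natrM -pmulrn.
by apply/idP/idP; lra.
Qed.

(** [exp_numer] includes the term of degree [a^3], one more than the estimate requires; it is
    nonnegative, and the longer sum is still at most [e^a]. *)
Lemma log_dim_test (R : realType) n m : 0 < n ->
  (n ^ 121 * ((50 * m) ^ 3)`! <= exp_numer (50 * m) ((50 * m) ^ 3)) =
    (log_dim R n <= m).
Proof.
move=> n0; rewrite (log_dim_le R _ n0); set a := 50 * m; set b := n ^ 121.
have f0 : (0 < (a ^ 3)`!%:R :> R)%R by rewrite ltr0n fact_gt0.
rewrite -(@ler_nat R) natrM exp_numerE ler_pM2r //.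
apply/idP/idP => [h|h]; first exact: le_trans h (exp_partial_le _ _ _).
(* For [m = 0] the sum is the single term 1 and exact; for [m > 0], [a >= 50] is beyond the
   threshold 34. *)
have [m0|m0] := posnP m.
  move: h; rewrite /a m0 muln0 expR0 exp0n // big_ord1 expr0 fact0 divr1 //.
rewrite big_ord_recr /=; apply: ler_wpDr.
  by rewrite mulr_ge0 ?invr_ge0 ?exprn_ge0 ?ler0n.
by apply: exp_partial_ge h; rewrite /a; lia.
Qed.

(** The chain is [n^121 <= e^(50 m) <= 4^(50 m) = 2^(100 m) <= 2^(121 m)]. *)
Lemma log_dim_expn (R : realType) n : 0 < n -> n <= 2 ^ log_dim R n.
Proof.
move=> n0; have := leqnn (log_dim R n).
rewrite {1}(log_dim_le R _ n0) mulnC => h.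
rewrite -(@leq_exp2r _ _ 121) // -(@ler_nat R); apply: le_trans h _.
rewrite mulnC natrM expRM_natl.
apply: (@le_trans _ _ ((4 ^+ log_dim R n) ^+ 50))%R.
  by rewrite lerXn2r ?nnegrE ?expR_ge0 ?exprn_ge0 // expR_nat_le4.
rewrite -natrX -natrX ler_nat -[4]/(2 ^ 2) -!expnM leq_exp2l //; lia.
Qed.

(** It turns the cost [O(m^6)] of a test into [O(n)]. As [m - 1] fails the test,
    [n^121 > 2^(50 (m - 1))], whence [(x + 1)^6 <= 2^(6 x) < n] for [x = (m - 1) %/ 15]; 15 is the
    least integer with [50 * 15 >= 6 * 121]. *)
Lemma log_dim_poly (R : realType) n : 0 < n -> log_dim R n ^ 6 <= 15 ^ 6 * n.
Proof.
move=> n0; case E: (log_dim R n) => [|p]; first by rewrite exp0n.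
have : ~~ (log_dim R n <= p) by rewrite E ltnn.
rewrite (log_dim_le R _ n0) -ltNge => lt_en.
set x := p %/ 15; have px : 15 * x <= p < 15 * x + 15.
  by rewrite /x; have := divn_eq p 15; have := ltn_pmod p (isT : 0 < 15); lia.
have xn : x.+1 ^ 6 < n.
  rewrite -(@ltn_exp2r _ _ 121) // -(@ltr_nat R); apply: le_lt_trans lt_en.
  apply: (@le_trans _ _ (2 ^ (50 * p))%:R)%R.
    rewrite ler_nat -expnM; apply: (@leq_trans ((2 ^ x) ^ (6 * 121))).
      by rewrite leq_exp2r // ltn_expl.
    by rewrite -expnM leq_exp2l //; lia.
  rewrite natrX -[(50 * p)%:R%R]mulr1 expRM_natl lerXn2r ?nnegrE ?expR_ge0 //.
  by apply: le_trans (expR_ge1Dx _); lra.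
apply: (@leq_trans ((15 * x.+1) ^ 6)); first by rewrite leq_exp2r //; lia.
by rewrite expnMn leq_pmul2l // ltnW.
Qed.

(** * Reasoning about loop programs *)

Fixpoint mods (c : cmd) : seq nat :=
  match c with
  | CSet j _ _ | CRead j _ => [:: j]
  | CPrint _ => [::]
  | CSeq c1 c2 | CIf _ c1 c2 => mods c1 ++ mods c2
  | CLet _ c | CFor _ c => mods c
  end.

Fixpoint silent (c : cmd) : bool :=
  match c with
  | CSet _ _ _ => true
  | CRead _ _ | CPrint _ => false
  | CSeq c1 c2 | CIf _ c1 c2 => silent c1 && silent c2
  | CLet _ c | CFor _ c => silent c
  end.

Lemma run_seq c1 c2 env s : run (CSeq c1 c2) env s = run c2 env (run c1 env s).
Proof. by []. Qed.

Lemma run_set j i e env s :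
  run (CSet j i e) env s = put s j (eval i env (arr s)) (eval e env (arr s)).
Proof. by []. Qed.

Lemma run_if e c1 c2 env s : run (CIf e c1 c2) env s =
  if 0 < eval e env (arr s) then run c1 env (tick s) else run c2 env (tick s).
Proof. by []. Qed.

Lemma run_let e c env s :
  run (CLet e c) env s = run c (rcons env (eval e env (arr s))) (tick s).
Proof. by []. Qed.

Lemma run_read j i env s : run (CRead j i) env s =
  State (seta (arr s) j (upd (arr s j) (eval i env (arr s)) (head 0 (inp s))))
    (behead (inp s)) (out s) (ticks s).+1.
Proof. by []. Qed.

Lemma run_print e env s : run (CPrint e) env s =
  State (arr s) (inp s) (rcons (out s) (eval e env (arr s))) (ticks s).+1.
Proof. by []. Qed.

Lemma upd_eq (A : Type) (f : nat -> A) i v : upd f i v i = v.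
Proof. by rewrite updE eqxx. Qed.

Lemma upd_neq (A : Type) (f : nat -> A) i v i' : i' != i -> upd f i v i' = f i'.
Proof. by rewrite updE => /negPf ->. Qed.

Lemma upd_out (A : Type) (f : nat -> A) i v i' : i' <> i -> upd f i v i' = f i'.
Proof. by rewrite updE; case: eqP. Qed.

Lemma run_frame c env s j : j \notin mods c -> arr (run c env s) j = arr s j.
Proof.
elim: c env s => [j' i e|j' i|e|c1 IH1 c2 IH2|e c1 IH1 c2 IH2|e c IH|e c IH] env s /=.
- by rewrite inE -[eqn _ _]/(j == j') => /negPf ->.
- by rewrite inE -[eqn _ _]/(j == j') => /negPf ->.
- by [].
- by rewrite mem_cat => /norP[h1 h2]; rewrite IH2 // IH1.
- by rewrite mem_cat => /norP[h1 h2]; case: ifP => _; [rewrite IH1|rewrite IH2].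
- by move=> h; rewrite IH.
- by move=> h; elim: (eval _ _ _) => //= m IHm; rewrite IH.
Qed.

Lemma run_silent c env s :
  silent c -> inp (run c env s) = inp s /\ out (run c env s) = out s.
Proof.
elim: c env s => [j' i e|j' i|e|c1 IH1 c2 IH2|e c1 IH1 c2 IH2|e c IH|e c IH] env s //=.
- case/andP=> h1 h2; have [-> ->] := IH2 env (run c1 env s) h2; exact: IH1.
- by case/andP=> h1 h2; case: ifP => _; [apply: IH1|apply: IH2].
- by move=> h; have [-> ->] := IH (rcons env (eval e env (arr s))) (tick s) h.
- move=> h; elim: (eval _ _ _) => //= m IHm.
  by have [-> ->] := IH (rcons env m) (tick (iteri m
    (fun i s0 => run c (rcons env i) (tick s0)) (tick s))) h.
Qed.

Lemma for_rule (P : nat -> state -> Prop) e c env s :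
  P 0 (tick s) ->
  (forall i s', i < eval e env (arr s) ->
     (forall j, j \notin mods c -> arr s' j = arr s j) ->
     (silent c -> inp s' = inp s /\ out s' = out s) ->
     P i s' -> P i.+1 (run c (rcons env i) (tick s'))) ->
  P (eval e env (arr s)) (run (CFor e c) env s).
Proof.
move=> P0 PS /=; set N := eval _ _ _ in PS *.
suff H m : m <= N -> P m (iteri m (fun i s => run c (rcons env i) (tick s)) (tick s)).
  exact: H.
elim: m => //= m IHm lt_mN; apply: PS => //; last by apply: IHm; lia.
- move=> j hj; elim: m {IHm lt_mN} => //= m IHm.
  by rewrite run_frame.
- move=> hs; elim: m {IHm lt_mN} => //= m IHm.
  by have [-> ->] := run_silent (rcons env m) (tick (iteri m
    (fun i s0 => run c (rcons env i) (tick s0)) (tick s))) hs.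
Qed.

(** Register names.  Scalars: [sN], [sK], [sQ] hold [n], [k], [8 k]; [sM] ends up
    holding the ceiling of [2.42 log n]; [sB] holds [n ^ 121]; [sA], [sL] hold
    [a = 50 m] and [a ^ 3] for the candidate [m]; [sW], [sS], [sP] are the
    accumulators of the test of [m].  Arrays: [aRn], [aRq] hold the multiples of
    [n] and [8 k], in place of multiplication; [aA] is the adjacency matrix and
    [aDeg] the degrees among the vertices not yet ordered; [aOrd] and [aPos] are
    the degeneracy order and its inverse; row [i] of [aF] (of length [aFl i])
    lists the neighbours that follow the [i]-th vertex, row [i] of [aU] (of
    length [aUl i]) its unseparated nonneighbours; [aCol] is the current
    colouring, [aCnt] counts conflicts, [aTab] stores markers. *)
Local Notation sN := 0. Local Notation sK := 1. Local Notation sQ := 2.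
Local Notation sM := 3. Local Notation sB := 4. Local Notation sAcc := 5.
Local Notation sA := 6. Local Notation sL := 7. Local Notation sP := 8.
Local Notation sS := 9. Local Notation sW := 10. Local Notation sBest := 11.
Local Notation sNew := 12. Local Notation sBad := 13. Local Notation aRn := 14.
Local Notation aRq := 15. Local Notation aA := 16. Local Notation aDeg := 17.
Local Notation aOrd := 18. Local Notation aPos := 19. Local Notation aFl := 20.
Local Notation aF := 21. Local Notation aUl := 22. Local Notation aU := 23.
Local Notation aCol := 24. Local Notation aCnt := 25. Local Notation aTab := 26.

Local Notation zero := (ECst 0).
Local Notation one := (ECst 1).
Local Notation sc j := (EGet j zero).
Local Notation setc j e := (CSet j zero e).
Local Notation "c1 ;; c2" := (CSeq c1 c2) (at level 100, right associativity).
Local Notation skip := (setc sAcc zero).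
Local Notation incr j i := (CSet j i (EAdd (EGet j i) one)).
Local Notation eeq a b := (ESub one (EAdd (ESub a b) (ESub b a))).

(** [/=] would unfold the programs themselves. *)
Ltac eval_state :=
  cbn [eval head behead nth rcons arr inp out ticks tick put seta eqn].
Ltac eval_state_in H :=
  cbn [eval head behead nth rcons arr inp out ticks tick put seta eqn] in H.

(** * Products by repeated addition and the search for a minimum *)

Definition cmul (dst src : nat) (e : expr) : cmd :=
  CSeq (setc dst zero) (CFor e (setc dst (EAdd (sc dst) (sc src)))).

(** The number of rounds is evaluated after [dst] has been cleared, hence the state [put s dst 0 0].
    The cost depends on the multiplier [N] only. *)
Lemma run_cmul dst src e env s N :
  dst != src -> eval e env (arr (put s dst 0 0)) = N ->
  let s' := run (cmul dst src e) env s in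
  arr s' dst 0 = arr s src 0 * N /\ ticks s' <= ticks s + 2 * N + 2.
Proof.
move=> dsrc hN /=; have ds : eqn src dst = false.
  by apply/negbTE; rewrite -[eqn _ _]/(src == dst) eq_sym.
have dd : eqn dst dst by rewrite -[eqn _ _]/(dst == dst).
have := @for_rule (fun i s' => arr s' dst 0 = arr s src 0 * i /\
   ticks s' <= ticks s + 2 * i + 2) e (setc dst (EAdd (sc dst) (sc src))) env
   (put s dst 0 0).
rewrite /= in hN; rewrite /= hN; apply.
  by rewrite dd upd_eq; lia.
move=> i s' hi fr _ [h1 h2]; rewrite dd upd_eq h1 mulnS.
by rewrite (fr src) /= ?ds; [lia|rewrite inE eq_sym].
Qed.

Lemma frame_cmul dst src e env s j :
  j != dst -> arr (run (cmul dst src e) env s) j = arr s j.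
Proof. by move=> h; rewrite run_frame //= !inE negb_or h. Qed.

Ltac unfold_run := cbv zeta; repeat match goal with
  | |- context [run (CSeq ?a ?b) ?e ?s] => rewrite (run_seq a b e s)
  | |- context [run (CSet ?j ?i ?x) ?e ?s] => rewrite (run_set j i x e s)
  | |- context [run (CIf ?x ?a ?b) ?e ?s] => rewrite (run_if x a b e s)
  | |- context [run (CLet ?x ?a) ?e ?s] => rewrite (run_let x a e s)
  | |- context [run (CRead ?j ?i) ?e ?s] => rewrite (run_read j i e s)
  | |- context [run (CPrint ?x) ?e ?s] => rewrite (run_print x e s)
  end.

Definition cargmin (a : nat) (e : expr) (d : nat) : cmd :=
  setc sBest zero ;;
  CFor e (CIf (ESub (EGet a (sc sBest)) (EGet a (EVar d)))
      (setc sBest (EVar d)) skip).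

(** The bound [N.-1], rather than [b < N], also holds before the first round, when [sBest] is 0. *)
Lemma run_cargmin a e env s N :
  a != sBest -> a != sAcc -> eval e env (arr (put s sBest 0 0)) = N ->
  let s' := run (cargmin a e (size env)) env s in
  let b := arr s' sBest 0 in
  [/\ b <= N.-1, forall c, c < N -> arr s a b <= arr s a c
    & ticks s' <= ticks s + 3 * N + 2].
Proof.
move=> ab aa hN; rewrite /cargmin; unfold_run.
have Eb : eqn a sBest = false by apply: negbTE ab.
set cb := CIf _ _ _.
have H := @for_rule (fun i s' => [/\ arr s' sBest 0 <= i.-1,
   forall c, c < i -> arr s a (arr s' sBest 0) <= arr s a c &
   ticks s' <= ticks s + 3 * i + 2]) e cb env (put s sBest 0 0).
rewrite hN in H; apply: H.
  by split=> //; eval_state; rewrite ?upd_eq //; lia.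
move=> i s' hi fr _ [h1 h2 h3]; rewrite /cb; unfold_run; eval_state.
have Ea : arr s' a = arr s a by rewrite fr; [eval_state; rewrite Eb|rewrite /= !inE negb_or ab aa].
rewrite Ea nth_rcons ltnn eqxx; case: ifP; rewrite subn_gt0 => hb; eval_state.
  rewrite upd_eq; split=> //; last by lia.
  move=> c; rewrite ltnS leq_eqVlt => /orP[/eqP -> //|ci].
  by apply: leq_trans (h2 _ ci); apply: ltnW.
split; [by lia| |by lia].
move=> c; rewrite ltnS leq_eqVlt => /orP[/eqP ->|ci]; last exact: h2.
by rewrite leqNgt hb.
Qed.

Lemma frame_cargmin a e d env s j :
  j != sBest -> j != sAcc -> arr (run (cargmin a e d) env s) j = arr s j.
Proof. by move=> h1 h2; rewrite run_frame //= !inE !negb_or h1 h2. Qed.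

(** * Separating nonadjacent pairs by colourings *)

Definition nbrs (n : nat) (R : rel nat) (i : nat) : seq nat :=
  [seq j <- iota 0 n | R i j].

Lemma iotaE n : iota 0 n = index_iota 0 n.
Proof. by rewrite /index_iota subn0. Qed.

Lemma mem_nbrs n (R : rel nat) i j : (j \in nbrs n R i) = (j < n) && R i j.
Proof. by rewrite mem_filter mem_iota /= andbC. Qed.

Lemma size_nbrs n (R : rel nat) i : size (nbrs n R i) = \sum_(j < n) R i j.
Proof.
rewrite size_filter -sum1_count big_mkcond /= iotaE big_mkord.
by apply: eq_bigr => j _; case: (R i j).
Qed.

Lemma size_nbrs_le n (R : rel nat) i : size (nbrs n R i) <= n.
Proof. by rewrite size_filter -[leqRHS](size_iota 0); exact: count_size. Qed.

Lemma nil_or_rcons (T : Type) (l : seq T) :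
  l = [::] \/ exists l' x, l = rcons l' x.
Proof. by case/lastP: l => [|l' x]; [left|right; exists l', x]. Qed.

Section Greedy.
Variables (n k : nat) (F : nat -> seq nat).
Implicit Types (col : nat -> nat) (R : rel nat).

(** Vertices are positions in the degeneracy order and [F u] lists the neighbours
    after [u].  [unsep col u w] says that for [u < w] the pair is separated in
    none of the dimensions of [col]: one dimension for each colour [c], in which
    the interval of [u] starts at [left_end col u c]. *)
Definition unsep col (u w : nat) : bool :=
  (col u == col w) || has (fun x => (w < x) && (col x == col w)) (F u).

Definition shrink col R : rel nat :=
  fun w u => R w u && unsep col (minn w u) (maxn w u).

(** Conflicts created by giving colour [c] to [v], the later positions being
    already coloured, with respect to the unseparated pair of [v] and [u]. *)
Definition conflict col (v c u : nat) : nat :=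
  if v < u then nat_of_bool (col u == c)
  else count (fun x => (v < x) && (col x == c)) (F u).

Definition conflicts col (row : seq nat) (v c : nat) : nat :=
  \sum_(u <- row) conflict col v c u.

(** Conflicts at [v] depend only on colours of positions after [v], so the final colouring may be
    used here although [v] is coloured before the positions preceding it. *)
Definition greedy col R (q : nat) : Prop :=
  forall v, v < n -> col v < q /\
    forall c, c < q ->
      conflicts col (nbrs n R v) v (col v) <= conflicts col (nbrs n R v) v c.

(** Ordered pairs: for symmetric [R] each unordered pair counts twice. *)
Definition npairs R : nat := \sum_(w < n) size (nbrs n R w).

Lemma sum_eq_le1 q a : \sum_(c < q) (a == c :> nat) <= 1.
Proof.
case: (ltnP a q) => [aq|qa].
  rewrite (bigD1 (Ordinal aq)) //= eqxx big1 // => c.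
  by rewrite -val_eqE /= eq_sym => /negPf ->.
by rewrite big1 // => c _; case: eqP => // ac; have := ltn_ord c; lia.
Qed.

(** A coloured vertex conflicts with one colour only; those involved are [u] alone if [v < u], and
    otherwise at most the [k] members of [F u]. *)
Lemma sum_conflict_le col v u q : 0 < k -> size (F u) <= k ->
  \sum_(c < q) conflict col v c u <= k.
Proof.
move=> k0 Fk; rewrite /conflict; case: ltnP => _.
  exact: leq_trans (sum_eq_le1 _ _) k0.
apply: leq_trans Fk; elim: (F u) => [|x l IH]; first by rewrite big1.
rewrite /= big_split /= -[leqRHS]add1n leq_add //.
apply: leq_trans (sum_eq_le1 q (col x)); apply: leq_sum => c _.
by case: (v < x).
Qed.

Lemma sum_conflicts_le col v q (row : seq nat) : 0 < k ->
  {in row, forall u, size (F u) <= k} ->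
  \sum_(c < q) conflicts col row v c <= k * size row.
Proof.
move=> k0 Fk; rewrite /conflicts exchange_big /=.
rewrite -sum1_size big_distrr /= big_seq [leqRHS]big_seq; apply: leq_sum => u hu.
by rewrite muln1 sum_conflict_le // Fk.
Qed.

Lemma greedy_le col R q v : 0 < k ->
  (forall u, u < n -> size (F u) <= k) -> greedy col R q -> v < n ->
  q * conflicts col (nbrs n R v) v (col v) <= k * size (nbrs n R v).
Proof.
move=> k0 Fk gr vn; apply: leq_trans (sum_conflicts_le col v q k0 _); last first.
  by move=> u; rewrite mem_nbrs => /andP[un _]; exact: Fk.
rewrite -[X in X * _]card_ord -sum_nat_const; apply: leq_sum => c _.
by have [_ h] := gr _ vn; apply: h.
Qed.

Lemma sum_nbrs R (f : nat -> nat) v :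
  \sum_(u <- nbrs n R v) f u = \sum_(u < n) R v u * f u.
Proof.
rewrite big_filter big_mkcond /= iotaE big_mkord.
by apply: eq_bigr => u _; case: (R v u); rewrite ?mul1n.
Qed.

(** An unseparated pair [u < w] is charged to [u] if the colours agree, and to [w] if a neighbour of
    [u] after [w] has the colour of [w]: each time to the vertex whose colouring creates the
    conflict. The factor 2 accounts for ordered pairs. *)
Lemma npairs_shrink_le col R : symmetric R -> irreflexive R ->
  npairs (shrink col R) <= 2 * \sum_(v < n) conflicts col (nbrs n R v) v (col v).
Proof.
move=> Rs Ri.
pose lo (w u : 'I_n) := (u < w) * (R w u * unsep col u w).
have E1 : npairs (shrink col R) = 2 * \sum_(w < n) \sum_(u < n) lo w u.
  rewrite mul2n -addnn {2}exchange_big -big_split; apply: eq_bigr => w _ /=.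
  rewrite size_nbrs -big_split; apply: eq_bigr => u _ /=.
  rewrite /lo /shrink; case: (ltngtP u w) => [uw|wu|->].
  - by rewrite mul1n mul0n addn0 mulnb.
  - by rewrite mul1n mul0n add0n Rs mulnb.
  - by rewrite Ri.
rewrite E1 leq_mul2l /=.
pose same (w u : 'I_n) := (u < w) * (R w u * (col u == col w)).
pose fwd (w u : 'I_n) :=
  (u < w) * (R w u * count (fun x => (w < x) && (col x == col w)) (F u)).
apply: (@leq_trans (\sum_(w < n) \sum_(u < n) (same u w + fwd w u))).
  under [leqRHS]eq_bigr => w _ do rewrite big_split.
  rewrite big_split /= [X in _ <= X + _]exchange_big /= -big_split; apply: leq_sum => w _.
  rewrite -big_split; apply: leq_sum => u _ /=; rewrite /lo /same /fwd.
  rewrite -!mulnDr !leq_mul2l /unsep has_count; do 2 (apply/orP; right).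
  by case: eqP => _ /=; case: (count _ _) => [|m] /=; lia.
apply: leq_sum => w _; rewrite /conflicts sum_nbrs; apply: leq_sum => u _.
rewrite /same /fwd /conflict; case: (ltngtP w u) => [wu|uw|wu].
- by rewrite mul1n mul0n addn0 Rs eq_sym.
- by rewrite mul0n mul1n.
- by rewrite !mul0n.
Qed.

(** A least conflicting colour causes at most a [1 / 8k] fraction of the at most
    [k] conflicts per pair that all [8 k] colours together cause. *)
Lemma npairs_shrink col R : 0 < k -> symmetric R -> irreflexive R ->
  (forall u, u < n -> size (F u) <= k) -> greedy col R (8 * k) ->
  4 * npairs (shrink col R) <= npairs R.
Proof.
move=> k0 Rs Ri Fk gr; have := npairs_shrink_le col Rs Ri.
set S := \sum_(v < n) _ => h1.
have h2 : 8 * k * S <= k * npairs R.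
  rewrite /S big_distrr /npairs big_distrr; apply: leq_sum => v _.
  exact: greedy_le.
rewrite -(leq_pmul2l k0); apply: leq_trans h2; nia.
Qed.

Lemma shrink_sym col R : symmetric R -> symmetric (shrink col R).
Proof. by move=> Rs u w; rewrite /shrink Rs minnC maxnC. Qed.

Lemma shrink_irr col R : irreflexive R -> irreflexive (shrink col R).
Proof. by move=> Ri u; rewrite /shrink Ri. Qed.

Lemma npairs_eq0 R : npairs R = 0 -> forall u w, u < n -> w < n -> ~~ R u w.
Proof.
move=> /eqP; rewrite sum_nat_eq0 => /forallP h u w un wn.
have := h (Ordinal un); rewrite size_nbrs sum_nat_eq0 => /forallP /(_ (Ordinal wn)) /=.
by case: (R u w).
Qed.

(** * The intervals in the dimension of one colour *)

Definition marker col (u c : nat) : nat :=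
  if col u == c then n + u else last u [seq x <- F u | col x == c].

(** With [n + u] as marker of a vertex that has the colour itself, one subtraction covers both kinds
    of interval. *)
Definition left_end col (u c : nat) : nat := n + n - marker col u c.

Variable E : rel nat.
Hypothesis FE : forall u, u < n -> F u = nbrs n (fun u x => (u < x) && E u x) u.

Lemma marker_bounds col u c : u < n ->
  u <= last u [seq x <- F u | col x == c] < n.
Proof.
move=> un; rewrite FE //; set l := seq.filter _ _.
have [->|[l' [x El]]] := nil_or_rcons l; first by rewrite /= leqnn.
have xl : x \in l by rewrite El mem_rcons mem_head.
rewrite El last_rcons; move: xl; rewrite mem_filter mem_nbrs => /and3P[_ xn /andP[ux _]].
by rewrite xn ltnW.
Qed.

(** [F u] is increasing, so its last entry of colour [c] is the greatest one. *)
Lemma marker_ge col u c w : u < w -> w < n -> E u w -> col w = c ->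
  w <= last u [seq x <- F u | col x == c].
Proof.
move=> uw wn Euw cw; rewrite FE; last by lia.
set l := seq.filter _ _.
have wl : w \in l by rewrite mem_filter cw eqxx mem_nbrs wn uw Euw.
have sl : sorted ltn l.
  by apply: (sorted_filter ltn_trans); apply: (sorted_filter ltn_trans); exact: iota_ltn_sorted.
have [El|[l' [x El]]] := nil_or_rcons l; first by move: wl; rewrite El.
rewrite El last_rcons; move: wl sl; rewrite El mem_rcons inE => /orP[/eqP -> //|wl'].
rewrite (sorted_pairwise ltn_trans) -cats1 pairwise_cat => /and3P[/allrelP h _ _].
by apply: ltnW; apply: h => //; rewrite mem_head.
Qed.

(** Ends of two vertices of colour [c], or of two others, lie in a common window of length [n].
    Otherwise the vertex of colour [c], at position [p], starts at [n - p], and the marker of the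
    other is at least [p]: for [u] because [w] is a later neighbour of colour [c], for [w] because
    its marker is at least [w > u]. *)
Lemma left_end_edge col u w c : u < w -> w < n -> E u w ->
  left_end col u c <= left_end col w c + n /\
  left_end col w c <= left_end col u c + n.
Proof.
move=> uw wn Euw; rewrite /left_end /marker.
have /andP[b1 b2] := marker_bounds col c (ltn_trans uw wn).
have /andP[b3 b4] := marker_bounds col c wn.
case: eqP => cu; case: eqP => cw; try lia.
by have := marker_ge uw wn Euw cw; lia.
Qed.

(** All later neighbours of [u] with the colour of [w] lie strictly before [w], and so does [u];
    hence [u] starts after [2 n - w], where the interval of [w] ends. *)
Lemma left_end_sep col u w : u < w -> w < n -> ~~ E u w -> ~~ unsep col u w ->
  left_end col w (col w) + n < left_end col u (col w).
Proof.
move=> uw wn nE; rewrite /unsep negb_or => /andP[cuw /hasPn h].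
rewrite /left_end /marker (negPf cuw) eqxx.
have un : u < n by lia.
have /andP[b1 b2] := marker_bounds col (col w) un.
suff : last u [seq x <- F u | col x == col w] < w by lia.
set l := seq.filter _ _; have [->|[l' [x El]]] := nil_or_rcons l; first by [].
have xl : x \in l by rewrite El mem_rcons mem_head.
rewrite El last_rcons; move: xl; rewrite mem_filter => /andP[cx xF].
have := h x xF; rewrite cx andbT -leqNgt leq_eqVlt => /orP[/eqP xw|//].
by move: xF; rewrite FE // mem_nbrs xw => /and3P[_ _ /(negP nE)].
Qed.

End Greedy.

(** * The algorithm and its analysis *)

Definition cpow : cmd :=
  setc sB one ;;
  CFor (ECst 121) (cmul sAcc sB (sc sN) ;; setc sB (sc sAcc)).

Lemma run_cpow s n : arr s sN 0 = n ->
  let s' := run cpow [::] s in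
  arr s' sB 0 = n ^ 121 /\ ticks s' <= ticks s + 2 + 121 * (2 * n + 4).
Proof.
move=> hn; rewrite /cpow; unfold_run.
have := @for_rule (fun i s' => arr s' sB 0 = n ^ i /\
  ticks s' <= ticks s + 2 + i * (2 * n + 4)) (ECst 121)
  (cmul sAcc sB (sc sN) ;; setc sB (sc sAcc)) [::]
  (put s sB 0 1).
eval_state; apply; first by rewrite upd_eq; lia.
move=> i s' _ fr _ [h1 h2]; unfold_run.
have [|e1 t1] := @run_cmul sAcc sB (sc sN) [:: i] (tick s') n isT.
  by eval_state; rewrite fr.
move: t1 e1; eval_state; rewrite upd_eq => t1 ->.
by rewrite h1 expnSr; lia.
Qed.

Definition cstep : cmd :=
  cmul sAcc sW (sc sA) ;; setc sW (sc sAcc) ;;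
  cmul sAcc sS (EAdd (EVar 2) one) ;; setc sS (EAdd (sc sAcc) (sc sW)) ;;
  cmul sAcc sP (EAdd (EVar 2) one) ;; setc sP (sc sAcc).

(** After [i] rounds [sW], [sS], [sP] hold [a^i], [exp_numer a i] and [B i!]; before the loop [sW]
    serves to hold [a^2]. A failed test increments the candidate. *)
Definition ctest : cmd :=
  cmul sA sM (ECst 50) ;; cmul sW sA (sc sA) ;; cmul sL sW (sc sA) ;;
  setc sW one ;; setc sS one ;; setc sP (sc sB) ;;
  CFor (sc sL) cstep ;;
  CIf (ESub (sc sP) (sc sS)) (incr sM zero) skip.

Lemma run_cstep s i0 i1 i :
  let s' := run cstep [:: i0; i1; i] s in
  [/\ arr s' sW 0 = arr s sW 0 * arr s sA 0,
      arr s' sS 0 = arr s sS 0 * i.+1 + arr s sW 0 * arr s sA 0,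
      arr s' sP 0 = arr s sP 0 * i.+1
    & ticks s' <= ticks s + 2 * arr s sA 0 + 4 * i.+1 + 9].
Proof.
cbv zeta; rewrite /cstep; unfold_run.
have [|e1 t1] := @run_cmul sAcc sW (sc sA) [:: i0; i1; i] s (arr s sA 0) isT; first by [].
have f1 := @frame_cmul sAcc sW (sc sA) [:: i0; i1; i] s.
set s1 := run _ _ s in e1 t1 f1 *; set s2 := put s1 _ _ _.
have [|e2 t2] := @run_cmul sAcc sS (EAdd (EVar 2) one) [:: i0; i1; i] s2 i.+1 isT.
  by eval_state; lia.
have f2 := @frame_cmul sAcc sS (EAdd (EVar 2) one) [:: i0; i1; i] s2.
set s3 := run _ _ s2 in e2 t2 f2 *; set s4 := put s3 _ _ _.
have [|e3 t3] := @run_cmul sAcc sP (EAdd (EVar 2) one) [:: i0; i1; i] s4 i.+1 isT.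
  by eval_state; lia.
have f3 := @frame_cmul sAcc sP (EAdd (EVar 2) one) [:: i0; i1; i] s4.
set s5 := run _ _ s4 in e3 t3 f3 *.
move: e2 t2 e3 t3; rewrite /s4 /s2; eval_state; rewrite ?upd_eq => e2 t2 e3 t3.
rewrite f2 // /s2 in e3; eval_state_in e3.
eval_state; rewrite ?upd_eq e3 !f3 // /s4.
eval_state; rewrite ?upd_eq e2 !f2 // /s2; eval_state; rewrite ?upd_eq.
by rewrite e1 !f1 //; split=> //; lia.
Qed.

(** Each of the [N] rounds multiplies by [a] or by an index, all at most [N]; this gives the term
    [N^2 = (50 m)^6]. *)
Lemma run_ctest s i0 i1 :
  let m := arr s sM 0 in let a := 50 * m in let N := a ^ 3 in
  let s' := run ctest [:: i0; i1] s in
  arr s' sM 0 = m + (exp_numer a N < arr s sB 0 * N`!) /\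
  ticks s' <= ticks s + 120 + 20 * N ^ 2.
Proof.
cbv zeta; set m := arr s sM 0; set a := 50 * m; set N := a ^ 3; set B := arr s sB 0.
rewrite /ctest; unfold_run.
have [|e1 t1] := @run_cmul sA sM (ECst 50) [:: i0; i1] s 50 isT; first by [].
have f1 := @frame_cmul sA sM (ECst 50) [:: i0; i1] s.
set s1 := run _ _ s in e1 t1 f1 *.
have [|e2 t2] := @run_cmul sW sA (sc sA) [:: i0; i1] s1 a isT.
  by eval_state; rewrite e1 /a mulnC.
have f2 := @frame_cmul sW sA (sc sA) [:: i0; i1] s1.
set s2 := run _ _ s1 in e2 t2 f2 *.
have [|e3 t3] := @run_cmul sL sW (sc sA) [:: i0; i1] s2 a isT.
  by eval_state; rewrite f2 // e1 /a mulnC.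
have f3 := @frame_cmul sL sW (sc sA) [:: i0; i1] s2.
set s3 := run _ _ s2 in e3 t3 f3 *.
set s4 := put _ sP _ _; set s5 := run _ _ s4.
have aN : a <= N.
  by have [->|a0] := posnP a; rewrite // -[leqLHS]expn1 leq_pexp2l.
have A4 : arr s4 sA 0 = a by rewrite /s4; eval_state; rewrite f3 // f2 // e1 /a mulnC.
have L4 : arr s4 sL 0 = N.
  rewrite /s4; eval_state; rewrite e3 e2 e1 -/m [m * 50]mulnC -/a /N !expnS expn0; lia.
have M4 : arr s4 sM 0 = m by rewrite /s4; eval_state; rewrite f3 // f2 // f1.
have B4 : arr s4 sP 0 = B by rewrite /s4; eval_state; rewrite upd_eq f3 // f2 // f1.
have M5 : arr s5 sM 0 = m by rewrite /s5 run_frame.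
have T4 : ticks s4 = ticks s3 + 3 by rewrite /s4; eval_state; rewrite !addnS addn0.
have S4 : arr s4 sS 0 = 1 /\ arr s4 sW 0 = 1 by rewrite /s4; eval_state; rewrite !upd_eq.
have [S5 P5 T5] : [/\ arr s5 sS 0 = exp_numer a N, arr s5 sP 0 = B * N`!
    & ticks s5 <= ticks s4 + 1 + N * (2 * a + 4 * N + 10)].
  have := @for_rule (fun i s' => [/\ arr s' sW 0 = a ^ i, arr s' sS 0 = exp_numer a i,
    arr s' sP 0 = B * i`! & ticks s' <= ticks s4 + 1 + i * (2 * a + 4 * N + 10)])
    (sc sL) cstep [:: i0; i1] s4; eval_state; rewrite L4 -/s5 => H.
  suff [_ ? ? ?] : [/\ arr s5 sW 0 = a ^ N, arr s5 sS 0 = exp_numer a N,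
    arr s5 sP 0 = B * N`! & ticks s5 <= ticks s4 + 1 + N * (2 * a + 4 * N + 10)] by [].
  apply: H; first by case: S4 => -> ->; rewrite B4 fact0 expn0 muln1; split=> //; lia.
  move=> i s' iN fr _ [h1 h2 h3 h4].
  have [] := run_cstep (tick s') i0 i1 i; eval_state.
  rewrite (fr sA) // A4 h1 h2 h3 => -> -> -> h5; split=> //.
  - by rewrite expnSr.
  - by rewrite /= expnSr.
  - by rewrite factS; lia.
  - by apply: leq_trans h5 _; nia.
have T : ticks s5 <= ticks s + 118 + 20 * N ^ 2.
  have NN : N <= N * N by case: (N) => // N'; rewrite leq_pmulr.
  have aNN : N * a <= N * N by rewrite leq_mul2l aN orbT.
  have -> : N ^ 2 = N * N by [].
  have E : N * (2 * a + 4 * N + 10) = 2 * (N * a) + 4 * (N * N) + 10 * N by ring.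
  rewrite E T4 in T5; move: (N * a) (N * N) aNN NN T5 => x y; clear -t1 t2 t3 aN; lia.
eval_state; rewrite S5 P5; case: ifP; rewrite subn_gt0 => h; eval_state; rewrite ?upd_eq M5 h.
  by split=> //; lia.
by split; lia.
Qed.

Lemma cube_sqr x m : ((x * m) ^ 3) ^ 2 = x ^ 6 * m ^ 6.
Proof. by rewrite -expnM expnMn. Qed.

Lemma run_ctest_poly : exists d, forall s i0 i1 m, arr s sM 0 = m ->
  let s' := run ctest [:: i0; i1] s in
  arr s' sM 0 = m + (exp_numer (50 * m) ((50 * m) ^ 3) <
                       arr s sB 0 * ((50 * m) ^ 3)`!) /\
  ticks s' <= ticks s + 120 + d * m ^ 6.
Proof.
exists (20 * 50 ^ 6) => s i0 i1 m <-; have [h1 h2] := run_ctest s i0 i1; split=> //.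
by rewrite cube_sqr mulnA in h2.
Qed.

(** The candidate rises by one per failed test and stays once it is valid. Since the ceiling is at
    most [15 n], that many tests suffice. *)
Definition clog : cmd :=
  cpow ;; setc sM zero ;; CFor (sc sN) (CFor (ECst 15) ctest).

Lemma run_clog (R : realType) : exists C, forall s n, arr s sN 0 = n -> 0 < n ->
  let s' := run clog [::] s in
  arr s' sM 0 = log_dim R n /\ ticks s' <= ticks s + C * n ^ 2.
Proof.
have [d hd] := run_ctest_poly.
have [c Ec] : exists c, c = 15 ^ 6 := ex_intro _ _ erefl.
exists (15 * (d * c + 123) + 750) => s n hn n0; rewrite /clog; unfold_run.
have [e1 t1] := run_cpow hn.
have N1 : arr (run cpow [::] s) sN 0 = n by rewrite run_frame.
set s1 := run cpow _ s in e1 t1 N1 *; set s2 := put s1 _ _ _.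
set L := log_dim R n; set B := d * c * n + 121.
have t2 : ticks s2 <= ticks s + 3 + 121 * (2 * n + 4) by rewrite /s2; eval_state; lia.
have test s' i j : arr s' sM 0 = minn (15 * i + j) L -> arr s' sB 0 = n ^ 121 ->
    arr (run ctest [:: i; j] s') sM 0 = minn (15 * i + j.+1) L /\
    ticks (run ctest [:: i; j] s') + 1 <= ticks s' + B.
  move=> h1 h2; have [] := hd s' i j _ h1; rewrite h2.
  move Em : (minn _ L) => m; rewrite ltnNge (log_dim_test R _ n0) -/L => -> ht; split.
    by rewrite -Em; clear; lia.
  have mL : m ^ 6 <= c * n.
    rewrite Ec; apply: leq_trans (log_dim_poly R n0).
    by rewrite leq_exp2r // -Em -/L geq_minr.
  apply: leq_trans (leq_add ht (leqnn _)) _; rewrite /B.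
  by move: (m ^ 6) mL => z mL; clear -mL; nia.
have M2 : arr s2 sM 0 = 0 by rewrite /s2; eval_state; rewrite upd_eq.
have B2 : arr s2 sB 0 = n ^ 121 by rewrite /s2; eval_state.
have H := @for_rule (fun i s' => arr s' sM 0 = minn (15 * i) L /\
   ticks s' <= ticks s2 + 1 + i * (2 + 15 * B)) (sc sN) (CFor (ECst 15) ctest) [::] s2.
have N2 : eval (sc sN) [::] (arr s2) = n by rewrite /s2; eval_state.
rewrite N2 in H; have [] := H _ _.
- by eval_state; rewrite M2; lia.
- move=> i s' lin fr _ [h1 h2]; have B' : arr s' sB 0 = n ^ 121 by rewrite fr.
  have := @for_rule (fun j s' => arr s' sM 0 = minn (15 * i + j) L /\
     ticks s' <= ticks s2 + 1 + i * (2 + 15 * B) + 2 + j * B) (ECst 15) ctest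
     [:: i] (tick s').
  eval_state; rewrite mulnS [15 + _]addnC => H'; have [] := H' _ _.
  + by rewrite addn0 h1; lia.
  + move=> j s'' _ fr' _ [g1 g2].
    have [||u1 u2] := test (tick s'') i j; [by []|by eval_state; rewrite fr'|].
    by split=> //; move: u2; eval_state; clear -g2; lia.
  + by move=> -> h; split=> //; lia.
move=> -> h; split; last first.
  by apply: leq_trans h _; move: t2; rewrite /B -mulnn; clear -n0; nia.
have : L <= 15 * n.
  rewrite leqNgt; apply/negP => lt.
  have := log_dim_poly R n0; rewrite -/L leqNgt => /negP; apply.
  apply: (@leq_ltn_trans ((15 * n) ^ 6)); last by rewrite ltn_exp2r.
  by rewrite expnMn leq_mul2l -{1}(expn1 n) leq_pexp2l ?orbT.
by clear; lia.
Qed.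

(** * Tables of multiples and reading of the matrix *)

Lemma leq_cell n i j : i < n -> j < n -> i * n + j < n * n.
Proof.
move=> li lj; apply: (@leq_trans (i.+1 * n)); first by rewrite mulSn; lia.
by rewrite leq_mul2r li orbT.
Qed.

Lemma cell_inj n i j i' j' : j < n -> j' < n ->
  i * n + j = i' * n + j' -> i = i' /\ j = j'.
Proof.
move=> jn jn' h; have n0 : 0 < n by lia.
have := congr1 (fun t => t %/ n) h; rewrite !divnMDl // !divn_small // !addn0 => ?.
by split=> //; subst; lia.
Qed.

Definition cbase (a step : nat) : cmd :=
  setc sAcc zero ;;
  CFor (sc sN) (CSet a (EVar 0) (sc sAcc) ;; setc sAcc (EAdd (sc sAcc) (sc step))).

Lemma run_cbase a step s n : arr s sN 0 = n -> a \notin [:: sN; sAcc; step] ->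
  step != sAcc ->
  let s' := run (cbase a step) [::] s in
  (forall i, i < n -> arr s' a i = i * arr s step 0) /\
  ticks s' <= ticks s + 2 + 3 * n.
Proof.
move=> hn; rewrite !inE !negb_or => /and3P[aN aAcc ast] st; rewrite /cbase; unfold_run.
set body := (_ ;; _); set s1 := put _ _ _ _.
have H := @for_rule (fun i s' => [/\ forall t, t < i -> arr s' a t = t * arr s step 0,
  arr s' sAcc 0 = i * arr s step 0
  & ticks s' <= ticks s + 2 + 3 * i]) (sc sN) body [::] s1.
have N1 : eval (sc sN) [::] (arr s1) = n by [].
rewrite N1 in H; case: H => //.
  by split; rewrite /s1; eval_state; rewrite ?upd_eq; lia.
move=> i s' lin fr _ [h1 h2 h3]; rewrite /body; unfold_run.
have F1 : eqn sAcc a = false by apply: negbTE; rewrite -[eqn _ _]/(sAcc == a) eq_sym.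
have F2 : eqn a sAcc = false by apply: negbTE.
have F3 : eqn step a = false by apply: negbTE; rewrite -[eqn _ _]/(step == a) eq_sym.
have F4 : eqn step sAcc = false by apply: negbTE.
have F5 : eqn a a by rewrite -[eqn _ _]/(a == a).
have S' : arr s' step = arr s step.
  rewrite fr; first by rewrite /s1; eval_state; rewrite F4.
  by rewrite /= !inE eq_sym negb_or ast.
eval_state. rewrite ?F1 ?F2 ?F3 ?F4 ?F5; eval_state; rewrite ?upd_eq ?S' h2; split; try lia.
move=> t; rewrite ltnS leq_eqVlt => /orP[/eqP ->|ti]; first by rewrite upd_eq.
by rewrite upd_out ?h1 //; lia.
Qed.

Definition base (n k : nat) (s : state) : Prop :=
  [/\ arr s sN 0 = n, arr s sQ 0 = 8 * k,
      forall i, i < n -> arr s aRn i = i * n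
    & forall i, i < n -> arr s aRq i = i * (8 * k)].

Lemma base_frame n k s s' :
  (forall j, j \in [:: sN; sQ; aRn; aRq] -> arr s' j = arr s j) ->
  base n k s -> base n k s'.
Proof. by move=> h [? ? ? ?]; split; rewrite !h. Qed.

Definition cread : cmd :=
  CFor (sc sN) (CFor (sc sN) (CRead aA (EAdd (EGet aRn (EVar 0)) (EVar 1)))).

Lemma run_cread n k s xs : base n k s -> inp s = xs -> size xs = n * n ->
  let s' := run cread [::] s in
  [/\ forall t, t < n * n -> arr s' aA t = nth 0 xs t, out s' = out s &
    ticks s' <= ticks s + 1 + n * (2 + 2 * n)].
Proof.
move=> [hN hQ hn hq] hx szx; rewrite /cread; unfold_run.
pose I t s' := [/\ forall u, u < t -> arr s' aA u = nth 0 xs u,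
  inp s' = drop t xs & out s' = out s].
have H := @for_rule (fun i s' => I (i * n) s' /\
  ticks s' <= ticks s + 1 + i * (2 + 2 * n)) (sc sN)
  (CFor (sc sN) (CRead aA (EAdd (EGet aRn (EVar 0)) (EVar 1)))) [::] s.
have N1 : eval (sc sN) [::] (arr s) = n by [].
rewrite N1 in H; have [] := H _ _.
- by rewrite /I mul0n drop0; eval_state; split=> //; lia.
- move=> i s' lin fr _ [h1 h2].
  have H' := @for_rule (fun j s' => I (i * n + j) s' /\
    ticks s' <= ticks s + 1 + i * (2 + 2 * n) + 2 + 2 * j) (sc sN)
    (CRead aA (EAdd (EGet aRn (EVar 0)) (EVar 1))) [:: i] (tick s').
  have N2 : eval (sc sN) [:: i] (arr (tick s')) = n by eval_state; rewrite fr.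
  rewrite N2 in H'; rewrite [i.+1 * n]mulSn [n + _]addnC [i.+1 * _]mulSn.
  have [] := H' _ _; last by eval_state; move=> g1 g2; split=> //; lia.
  + by rewrite addn0 /I; eval_state; case: h1 => ? ? ?; split=> //; lia.
  + move=> j s'' ljn fr' _ [[g1 g2 g3] g4]; rewrite /I; unfold_run; eval_state.
    have -> : arr s'' aRn i = i * n by rewrite fr' //; eval_state; rewrite fr // hn.
    have lt := leq_cell lin ljn.
    rewrite g2 g3 addnS -drop1 drop_drop add1n -nth0 nth_drop addn0.
    split; last by lia.
    split=> // u; rewrite ltnS leq_eqVlt => /orP[/eqP ->|ui].
      by rewrite upd_eq.
    by rewrite upd_out ?g1 //; lia.
- by move=> [h1 _ h3] h4.
Qed.

Definition cinit : cmd :=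
  CRead sN zero ;; CRead sK zero ;;
  setc sQ (EAdd (sc sK) (sc sK)) ;; setc sQ (EAdd (sc sQ) (sc sQ)) ;;
  setc sQ (EAdd (sc sQ) (sc sQ)) ;;
  cbase aRn sN ;; cbase aRq sQ ;; cread.

Lemma run_cinit n k xs : size xs = n * n ->
  let s' := run cinit [::] (State (fun _ _ => 0) (n :: k :: xs) [::] 0) in
  [/\ base n k s', forall t, t < n * n -> arr s' aA t = nth 0 xs t, out s' = [::] &
    ticks s' <= 10 + 8 * n + 2 * n ^ 2].
Proof.
move=> szx; rewrite /cinit; unfold_run.
set s1 := put (put (put _ _ _ _) _ _ _) _ _ _.
have N1 : arr s1 sN 0 = n by rewrite /s1; eval_state; rewrite upd_eq.
have Q1 : arr s1 sQ 0 = 8 * k by rewrite /s1; eval_state; rewrite !upd_eq; lia.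
have T1 : ticks s1 = 5 by []. 
have [e2 t2] := run_cbase (a := aRn) (step := sN) N1 isT isT.
have i2 : inp (run (cbase aRn sN) [::] s1) = xs /\
    out (run (cbase aRn sN) [::] s1) = [::].
  by have [-> ->] := @run_silent (cbase aRn sN) [::] s1 isT; rewrite /s1; eval_state.
have f2 := @run_frame (cbase aRn sN) [::] s1.
set s2 := run _ _ s1 in e2 t2 i2 f2 *.
have N2 : arr s2 sN 0 = n by rewrite f2.
have [e3 t3] := run_cbase (a := aRq) (step := sQ) N2 isT isT.
have i3 : inp (run (cbase aRq sQ) [::] s2) = xs /\
    out (run (cbase aRq sQ) [::] s2) = [::].
  by have [-> ->] := @run_silent (cbase aRq sQ) [::] s2 isT.
have f3 := @run_frame (cbase aRq sQ) [::] s2.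
set s3 := run _ _ s2 in e3 t3 i3 f3 *.
have b3 : base n k s3.
  split=> [||i lin|i lin].
  - by rewrite f3.
  - by rewrite f3 // f2.
  - by rewrite f3 // e2 // N1.
  - by rewrite e3 // f2 // Q1.
have [i3a i3b] := i3.
have [h1 h2 h3] := run_cread b3 i3a szx.
split=> //.
- apply: base_frame b3 => j; rewrite !inE => hj; rewrite run_frame //.
  by case/or4P: hj => /eqP ->.
- by rewrite h2.
- by apply: leq_trans h3 _; rewrite -mulnn; lia.
Qed.

(** * The degeneracy order *)

Lemma iotaSr m : iota 0 m.+1 = rcons (iota 0 m) m.
Proof. by rewrite -addn1 iotaD cats1. Qed.

Lemma count_iotaS (p : pred nat) m :
  count p (iota 0 m.+1) = count p (iota 0 m) + p m.
Proof. by rewrite iotaSr -cats1 count_cat /= addn0. Qed.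

Definition matrix_is n (adj : rel nat) (A : nat -> nat) : Prop :=
  forall i j, i < n -> j < n -> A (i * n + j) = adj i j.

Definition cdeg : cmd :=
  CFor (sc sN) (CSet aDeg (EVar 0) zero ;;
    CFor (sc sN) (CSet aDeg (EVar 0)
      (EAdd (EGet aDeg (EVar 0)) (EGet aA (EAdd (EGet aRn (EVar 0)) (EVar 1)))))).

Lemma run_cdeg n k adj s : base n k s -> matrix_is n adj (arr s aA) ->
  let s' := run cdeg [::] s in
  (forall v, v < n -> arr s' aDeg v = count (adj v) (iota 0 n)) /\
  ticks s' <= ticks s + 1 + n * (3 + 2 * n).
Proof.
move=> [hN _ hn _] hA; rewrite /cdeg; unfold_run.
set body := (_ ;; _).
have H := @for_rule (fun i s' =>
  (forall v, v < i -> arr s' aDeg v = count (adj v) (iota 0 n)) /\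
  ticks s' <= ticks s + 1 + i * (3 + 2 * n)) (sc sN) body [::] s.
have N1 : eval (sc sN) [::] (arr s) = n by [].
rewrite N1 in H; apply: H; first by eval_state; split=> //; lia.
move=> i s' lin fr _ [h1 h2]; rewrite /body; unfold_run; eval_state.
set s1 := put _ _ _ _; set ib := CSet _ _ _.
have H := @for_rule (fun j s'' =>
  [/\ arr s'' aDeg i = count (adj i) (iota 0 j),
   forall v, v < i -> arr s'' aDeg v = count (adj v) (iota 0 n)
   & ticks s'' <= ticks s + 1 + i * (3 + 2 * n) + 3 + 2 * j]) (sc sN) ib [:: i] s1.
have N2 : eval (sc sN) [:: i] (arr s1) = n by rewrite /s1; eval_state; rewrite fr.
rewrite N2 in H; case: H.
- rewrite /s1; eval_state; rewrite upd_eq; split=> //; last by lia.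
  by move=> v vi; rewrite upd_out ?h1 //; lia.
- move=> j s'' ljn fr' _ [g1 g2 g3]; rewrite /ib; unfold_run; eval_state.
  have -> : arr s'' aRn i = i * n by rewrite fr' // /s1; eval_state; rewrite fr // hn.
  have -> : arr s'' aA (i * n + j) = adj i j by rewrite fr' // /s1; eval_state; rewrite fr // hA.
  rewrite upd_eq g1 count_iotaS; split=> //; last by lia.
  by move=> v vi; rewrite upd_out ?g2 //; lia.
move=> g1 g2 g3; split; last by rewrite mulSn; lia.
by move=> v; rewrite ltnS leq_eqVlt => /orP[/eqP ->|/g2].
Qed.

(** The degree of a removed vertex is set to [2 n], so that it exceeds the degrees
    of the others even after being decremented in all later rounds. *)
Definition corder : cmd :=
  CFor (sc sN) (
    cargmin aDeg (sc sN) 1 ;;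
    CSet aOrd (EVar 0) (sc sBest) ;; CSet aPos (sc sBest) (EVar 0) ;;
    CFor (sc sN) (CSet aDeg (EVar 1) (ESub (EGet aDeg (EVar 1))
      (EGet aA (EAdd (EGet aRn (sc sBest)) (EVar 1))))) ;;
    CSet aDeg (sc sBest) (EAdd (sc sN) (sc sN))).

(** The form of degeneracy that removal by minimum degree needs: every nonempty induced subgraph has
    a vertex of degree at most [k]. *)
Definition low_degree n k (adj : rel nat) : Prop :=
  forall P : pred nat, (exists2 v, v < n & P v) ->
    exists v, [/\ v < n, P v & count (fun y => P y && adj v y) (iota 0 n) <= k].

Definition seen (ord : nat -> nat) (p : nat) : seq nat := [seq ord i | i <- iota 0 p].

Lemma seenS ord p : seen ord p.+1 = rcons (seen ord p) (ord p).
Proof. by rewrite /seen iotaSr map_rcons. Qed.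

Lemma eq_seen ord ord' p : (forall i, i < p -> ord i = ord' i) -> seen ord p = seen ord' p.
Proof. by move=> h; apply/eq_in_map => i; rewrite mem_iota => /h. Qed.

Definition order_inv n k adj (ord pos deg : nat -> nat) p : Prop :=
  [/\ uniq (seen ord p), forall i, i < p -> ord i < n /\ pos (ord i) = i,
      forall v, v < n -> v \notin seen ord p ->
        deg v = count (fun y => (y \notin seen ord p) && adj v y) (iota 0 n),
      forall v, v < n -> v \in seen ord p -> 2 * n <= deg v + p
    & forall i, i < p ->
        count (fun y => (y \notin seen ord i) && adj (ord i) y) (iota 0 n) <= k].

Lemma count_notin_rcons n (L : seq nat) (Q : pred nat) b : b < n -> b \notin L ->
  count (fun y => (y \notin L) && Q y) (iota 0 n) =
  count (fun y => (y \notin rcons L b) && Q y) (iota 0 n) + Q b.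
Proof.
move=> bn bL.
have : count_mem b (iota 0 n) = 1.
  by rewrite count_uniq_mem ?iota_uniq // mem_iota bn.
elim: (iota 0 n) {bn} (iota_uniq 0 n) => //= x l IH /andP[xl ul].
rewrite mem_rcons inE; case: eqP => [->|xb] /=.
  rewrite add1n => -[]; rewrite bL /= => /eqP; rewrite -leqn0 leqNgt -has_count => nh.
  rewrite add0n addnC; congr (_ + _); apply: eq_in_count => y yl.
  rewrite mem_rcons inE; case: eqP => // yb; case/negP: nh.
  by apply/hasP; exists y => //=; apply/eqP.
by rewrite add0n => /(IH ul) ->; rewrite addnA.
Qed.

(** A remaining vertex has stored degree below [n], a removed one at least [2 n - p > n]; so the
    minimum [b] is a remaining vertex, and its degree is at most that of the vertex supplied by
    [low_degree]. *)
Lemma order_step n k adj ord pos deg p b : symmetric adj -> irreflexive adj ->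
  low_degree n k adj -> p < n ->
  order_inv n k adj ord pos deg p ->
  b <= n.-1 -> (forall c, c < n -> deg b <= deg c) ->
  order_inv n k adj (upd ord p b) (upd pos b p)
    (upd (fun v => deg v - adj b v) b (2 * n)) p.+1.
Proof.
move=> As Ai ld pn [I1 I2 I3 I4 I5] bn bmin; have {}bn : b < n by lia.
have [v [vn vL vk]] : exists v, [/\ v < n, v \notin seen ord p &
    count (fun y => (y \notin seen ord p) && adj v y) (iota 0 n) <= k].
  apply: (ld (fun v => v \notin seen ord p)).
  apply: contrapT => h; have : {subset iota 0 n <= seen ord p}.
    move=> v; rewrite mem_iota => /andP[_ vn]; apply: contraT => vL.
    by case: h; exists v.
  move=> /(uniq_leq_size (iota_uniq _ _)); rewrite size_map !size_iota; lia.
have dv : deg v = count (fun y => (y \notin seen ord p) && adj v y) (iota 0 n) by exact: I3.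
have dvn : deg v < n.
  have := count_predC (adj v) (iota 0 n); rewrite size_iota.
  have : 0 < count (predC (adj v)) (iota 0 n).
    by rewrite -has_count; apply/hasP; exists v; rewrite ?mem_iota //= Ai.
  have : deg v <= count (adj v) (iota 0 n).
    by rewrite dv; apply: sub_count => y /= /andP[].
  by lia.
have bL : b \notin seen ord p.
  by apply/negP => /(I4 _ bn); have := bmin _ vn; lia.
have S' : seen (upd ord p b) p.+1 = rcons (seen ord p) b.
  rewrite seenS upd_eq; congr rcons; apply: eq_seen => i ip; rewrite upd_out //; lia.
rewrite /order_inv S'; split.
- by rewrite rcons_uniq bL.
- move=> i; rewrite ltnS leq_eqVlt => /orP[/eqP ->|ip]; first by rewrite !upd_eq.
  have [oi pi] := I2 _ ip.
  have ib : ord i != b.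
    by apply: contraNneq bL => <-; apply: map_f; rewrite mem_iota.
  by rewrite [upd ord _ _ _]upd_out ?upd_neq //; lia.
- move=> x xn; rewrite mem_rcons inE negb_or => /andP[xb xL].
  by rewrite upd_neq // I3 // (count_notin_rcons _ bn bL) As addnK.
- move=> x xn; rewrite mem_rcons inE => /orP[/eqP ->|xL]; first by rewrite upd_eq; lia.
  have xb : x != b by apply: contraNneq bL => <-.
  rewrite upd_neq //; have := I4 _ xn xL; case: (adj b x); lia.
- move=> i; rewrite ltnS leq_eqVlt => /orP[/eqP ->|ip].
    rewrite upd_eq (@eq_seen _ ord) => [|i' ip']; last by rewrite upd_out //; lia.
    by rewrite -I3 //; apply: leq_trans (bmin _ vn) _; rewrite dv.
  rewrite upd_out; last by lia.
  rewrite (@eq_seen _ ord) => [|i' ip']; last by rewrite upd_out //; lia.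
  exact: I5.
Qed.

Lemma run_corder n k adj s : symmetric adj -> irreflexive adj ->
  low_degree n k adj ->
  base n k s -> matrix_is n adj (arr s aA) ->
  (forall v, v < n -> arr s aDeg v = count (adj v) (iota 0 n)) ->
  let s' := run corder [::] s in
  order_inv n k adj (arr s' aOrd) (arr s' aPos) (arr s' aDeg) n /\
  ticks s' <= ticks s + 1 + n * (10 + 5 * n).
Proof.
move=> As Ai ld [hN _ hn _] hA hd; rewrite /corder; unfold_run.
set body := (_ ;; _).
have H := @for_rule (fun p s' =>
  order_inv n k adj (arr s' aOrd) (arr s' aPos) (arr s' aDeg) p /\
  ticks s' <= ticks s + 1 + p * (10 + 5 * n)) (sc sN) body [::] s.
have N1 : eval (sc sN) [::] (arr s) = n by [].
rewrite N1 in H; apply: H.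
  eval_state; split; last by lia.
  by split=> // v vn _; rewrite hd //; apply: eq_count => y.
move=> p s' pn fr _ [h1 h2]; rewrite /body; unfold_run.
have N2 : eval (sc sN) [:: p] (arr (put (tick s') sBest 0 0)) = n by eval_state; rewrite fr.
have [] := @run_cargmin aDeg (sc sN) [:: p] (tick s') n isT isT N2.
rewrite [size _]/= [rcons _ _]/=.
have f1 := @frame_cargmin aDeg (sc sN) 1 [:: p] (tick s').
set s1 := run _ _ (tick s') in f1 *; set b := arr s1 sBest 0 => b1 b2 t1.
have bn : b < n by lia.
set s2 := put (put s1 _ _ _) _ _ _.
have A2 : arr s2 aA = arr s aA by rewrite /s2; eval_state; rewrite f1 //; eval_state; rewrite fr.
have R2 : arr s2 aRn = arr s aRn by rewrite /s2; eval_state; rewrite f1 //; eval_state; rewrite fr.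
have D2 : arr s2 aDeg = arr s' aDeg by rewrite /s2; eval_state; rewrite f1.
have O2 : arr s2 aOrd = upd (arr s' aOrd) p b by rewrite /s2; eval_state; rewrite f1.
have P2 : arr s2 aPos = upd (arr s' aPos) b p by rewrite /s2; eval_state; rewrite f1.
have B2 : arr s2 sBest 0 = b by [].
have T2 : ticks s2 = ticks s1 + 2 by rewrite /s2; eval_state; lia.
set ib := CSet _ _ _; set s3 := run (CFor _ ib) _ s2.
have [D3 T3] : (forall v, v < n -> arr s3 aDeg v = arr s' aDeg v - adj b v) /\
    ticks s3 <= ticks s2 + 1 + 2 * n.
  have H := @for_rule (fun j s'' =>
    (forall v, v < n -> arr s'' aDeg v =
        if v < j then arr s' aDeg v - adj b v else arr s' aDeg v) /\
    ticks s'' <= ticks s2 + 1 + 2 * j) (sc sN) ib [:: p] s2.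
  have N3 : eval (sc sN) [:: p] (arr s2) = n.
    by rewrite /s2; eval_state; rewrite f1 //; eval_state; rewrite fr.
  rewrite N3 in H; case: H; last 1 first.
  - by move=> g1 g2; split=> // v vn; rewrite g1 // vn.
  - by eval_state; rewrite D2; split=> //; lia.
  - move=> j s'' ljn fr' _ [g1 g2]; rewrite /ib; unfold_run; eval_state; split; last by lia.
    move=> v vn; have -> : arr s'' sBest 0 = b by rewrite fr'.
    have -> : arr s'' aRn b = b * n by rewrite fr' // R2 hn.
    have -> : arr s'' aA (b * n + j) = adj b j by rewrite fr' // A2 hA.
    rewrite updE ltnS; case: eqP => [->|vj]; first by rewrite leqnn g1 // ltnn.
    by rewrite g1 // [v <= j]leq_eqVlt; case: eqP vj.
have f3 := @run_frame (CFor (sc sN) ib) [:: p] s2; rewrite -/s3 in f3.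
eval_state; rewrite (f3 aOrd) // (f3 aPos) // (f3 sBest) // (f3 sN) //.
rewrite B2 O2 P2; split; last by move: t1; eval_state; rewrite mulSn; lia.
have -> : arr s2 sN 0 = n by rewrite /s2; eval_state; rewrite f1 //; eval_state; rewrite fr.
have := order_step As Ai ld pn h1 b1 b2; rewrite /order_inv => -[J1 J2 J3 J4 J5].
have D v : v < n -> upd (arr s3 aDeg) b (n + n) v =
    upd (fun v => arr s' aDeg v - adj b v) b (2 * n) v.
  by move=> vn; rewrite !updE D3 // mul2n addnn.
by split=> // v vn hv; rewrite D //; [exact: J3|exact: J4].
Qed.

(** A duplicate-free list of [n] numbers below [n] is a permutation, which makes [pos] a two-sided
    inverse and lets the bound on remaining neighbours be counted over later positions. *)
Lemma order_final n k adj ord pos deg : order_inv n k adj ord pos deg n ->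
  [/\ forall p, p < n -> ord p < n /\ pos (ord p) = p,
      forall v, v < n -> pos v < n /\ ord (pos v) = v
    & forall p, p < n ->
        count (fun x => (p < x) && adj (ord p) (ord x)) (iota 0 n) <= k].
Proof.
move=> [I1 I2 _ _ I5].
have sub : {subset seen ord n <= iota 0 n}.
  by move=> v /mapP[i]; rewrite mem_iota => /I2[? _] ->; rewrite mem_iota.
have [|_ perm] := uniq_min_size I1 sub; first by rewrite size_map !size_iota.
have onto v : v < n -> exists2 i, i < n & v = ord i.
  move=> vn; have : v \in seen ord n by rewrite perm mem_iota.
  by move=> /mapP[i]; rewrite mem_iota => hi ->; exists i.
split=> //.
  by move=> v /onto[i lin ->]; have [_ ->] := I2 _ lin.
move=> p pn; apply: leq_trans (I5 _ pn).
have /permP -> : perm_eq (iota 0 n) (seen ord n).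
  by apply: uniq_perm; rewrite ?iota_uniq // => v; rewrite perm.
rewrite count_map
  (@eq_in_count _ _ (fun x => (x < n) && ((p < x) && adj (ord p) (ord x)))).
  2: by move=> x; rewrite mem_iota => /andP[_ ->].
apply: sub_count => x /= /and3P[xn px ->].
rewrite andbT; apply/mapP => -[i]; rewrite mem_iota => ip oxi.
have [_ ex] := I2 _ xn; have [|_ ei] := I2 i; first by lia.
by move: ex; rewrite oxi ei; lia.
Qed.

(** * Lists of later neighbours and of nonneighbours *)

Definition row_is (n : nat) (A : nat -> nat) (len i : nat) (l : seq nat) : Prop :=
  len = size l /\ forall r, r < size l -> A (i * n + r) = nth 0 l r.

Definition rows_are (n : nat) (A Len : nat -> nat) (R : rel nat) : Prop :=
  forall i, i < n -> row_is n A (Len i) i (nbrs n R i).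

Lemma nbrsS j (R : rel nat) i :
  nbrs j.+1 R i = if R i j then rcons (nbrs j R i) j else nbrs j R i.
Proof. by rewrite /nbrs iotaSr filter_rcons. Qed.

Lemma row_push n A len i l x :
  row_is n A len i l -> row_is n (upd A (i * n + len) x) len.+1 i (rcons l x).
Proof.
move=> [-> h]; split=> [|r]; rewrite size_rcons // ltnS nth_rcons.
case: ltngtP => // [rl|->] _; last by rewrite upd_eq.
by rewrite upd_out ?h //; lia.
Qed.

Lemma row_other n A len i l i' r x : i' != i -> r < n -> size l <= n ->
  row_is n A len i l -> row_is n (upd A (i' * n + r) x) len i l.
Proof.
move=> ii rn ln [-> h]; split=> // t tl; rewrite upd_out ?h //.
move=> e; have [|||e1 _] := @cell_inj n i t i' r; lia.
Qed.

Definition rows_upto n (A Len : nat -> nat) (R : rel nat) i j : Prop :=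
  row_is n A (Len i) i (nbrs j R i) /\
  forall i', i' < i -> row_is n A (Len i') i' (nbrs n R i').

Lemma rows_upto_push n A Len (R : rel nat) i j : i < n -> j < n -> R i j ->
  rows_upto n A Len R i j ->
  rows_upto n (upd A (i * n + Len i) j) (upd Len i (Len i).+1) R i j.+1.
Proof.
move=> lin ljn Rij [h1 h2]; split; first by rewrite upd_eq nbrsS Rij; exact: row_push.
move=> i' ii; rewrite upd_out; last by lia.
apply: row_other (h2 _ ii); [by lia| |exact: size_nbrs_le].
by case: h1 => -> _; have := size_nbrs_le j R i; lia.
Qed.

Lemma rows_upto_skip n A Len (R : rel nat) i j : ~~ R i j ->
  rows_upto n A Len R i j -> rows_upto n A Len R i j.+1.
Proof. by move=> /negPf Rij [h1 h2]; split=> //; rewrite nbrsS Rij. Qed.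

Lemma rows_upto_init n A Len (R : rel nat) i :
  (forall i', i' < i -> row_is n A (Len i') i' (nbrs n R i')) ->
  rows_upto n A (upd Len i 0) R i 0.
Proof.
move=> h; split; first by rewrite upd_eq.
by move=> i' ii; rewrite upd_out; [exact: h|lia].
Qed.

Definition clists : cmd :=
  CFor (sc sN) (
    CSet aFl (EVar 0) zero ;; CSet aUl (EVar 0) zero ;;
    CFor (sc sN)
      (CIf (EGet aA (EAdd (EGet aRn (EGet aOrd (EVar 0))) (EGet aOrd (EVar 1))))
        (CIf (ESub (EVar 1) (EVar 0))
          (CSet aF (EAdd (EGet aRn (EVar 0)) (EGet aFl (EVar 0))) (EVar 1) ;;
           incr aFl (EVar 0))
          skip)
        (CIf (EAdd (ESub (EVar 1) (EVar 0)) (ESub (EVar 0) (EVar 1)))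
          (CSet aU (EAdd (EGet aRn (EVar 0)) (EGet aUl (EVar 0))) (EVar 1) ;;
           incr aUl (EVar 0))
          skip))).

Definition fwd_rel (E : rel nat) : rel nat := fun i x => (i < x) && E i x.
Definition non_rel (E : rel nat) : rel nat := fun i x => (i != x) && ~~ E i x.

Lemma run_clists n k adj s : base n k s -> matrix_is n adj (arr s aA) ->
  (forall p, p < n -> arr s aOrd p < n) ->
  let E := fun i j => adj (arr s aOrd i) (arr s aOrd j) in
  let s' := run clists [::] s in
  [/\ rows_are n (arr s' aF) (arr s' aFl) (fwd_rel E),
      rows_are n (arr s' aU) (arr s' aUl) (non_rel E)
    & ticks s' <= ticks s + 1 + n * (4 + 5 * n)].
Proof.
move=> [hN _ hn _] hA hord E; rewrite /clists; unfold_run.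
set body := (_ ;; _).
have H := @for_rule (fun i s' =>
  [/\ forall i', i' < i -> row_is n (arr s' aF) (arr s' aFl i') i' (nbrs n (fwd_rel E) i'),
      forall i', i' < i -> row_is n (arr s' aU) (arr s' aUl i') i' (nbrs n (non_rel E) i')
    & ticks s' <= ticks s + 1 + i * (4 + 5 * n)]) (sc sN) body [::] s.
have N1 : eval (sc sN) [::] (arr s) = n by [].
rewrite N1 in H; apply: H; first by eval_state; split=> //; lia.
move=> i s' lin fr _ [h1 h2 h3]; rewrite /body; unfold_run; eval_state.
set s1 := put (put _ _ _ _) _ _ _; set ib := CIf _ _ _.
have H := @for_rule (fun j s'' =>
  [/\ rows_upto n (arr s'' aF) (arr s'' aFl) (fwd_rel E) i j,
      rows_upto n (arr s'' aU) (arr s'' aUl) (non_rel E) i j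
   & ticks s'' <= ticks s + 1 + i * (4 + 5 * n) + 4 + 5 * j]) (sc sN) ib [:: i] s1.
have N2 : eval (sc sN) [:: i] (arr s1) = n by rewrite /s1; eval_state; rewrite fr.
rewrite N2 in H; case: H.
- rewrite /s1; eval_state; split; [exact: rows_upto_init|exact: rows_upto_init|by lia].
- move=> j s'' ljn fr' _ [g1 g2 g3]; rewrite /ib; unfold_run; eval_state.
  have -> : arr s'' aOrd i = arr s aOrd i by rewrite fr' // /s1; eval_state; rewrite fr.
  have -> : arr s'' aOrd j = arr s aOrd j by rewrite fr' // /s1; eval_state; rewrite fr.
  have -> : arr s'' aRn (arr s aOrd i) = arr s aOrd i * n.
    by rewrite fr' // /s1; eval_state; rewrite fr // hn // hord.
  have -> : arr s'' aRn i = i * n by rewrite fr' // /s1; eval_state; rewrite fr // hn.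
  have -> : arr s'' aA (arr s aOrd i * n + arr s aOrd j) = E i j.
    by rewrite fr' // /s1; eval_state; rewrite fr // hA // hord.
  case Eij : (E i j) => /=.
    have nU : ~~ non_rel E i j by rewrite /non_rel Eij andbF.
    case: ltnP => ij; eval_state; rewrite ?addn1.
      split; [|exact: rows_upto_skip|by lia].
      by apply: rows_upto_push => //; rewrite /fwd_rel Eij andbT; lia.
    split; [|exact: rows_upto_skip|by lia].
    by apply: rows_upto_skip => //; rewrite /fwd_rel Eij andbT; lia.
  have nF : ~~ fwd_rel E i j by rewrite /fwd_rel Eij andbF.
  case: ltnP => ij; eval_state; rewrite ?addn1.
    split; [exact: rows_upto_skip| |by lia].
    by apply: rows_upto_push => //; rewrite /non_rel Eij andbT; lia.
  split; [exact: rows_upto_skip| |by lia].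
  by apply: rows_upto_skip => //; rewrite /non_rel Eij andbT; lia.
move=> g1 g2 g3; split; last by rewrite mulSn; lia.
- by move=> i'; rewrite ltnS leq_eqVlt => /orP[/eqP ->|]; case: g1 => // ? g; exact: g.
- by move=> i'; rewrite ltnS leq_eqVlt => /orP[/eqP ->|]; case: g2 => // ? g; exact: g.
Qed.

(** * Conflict counts and the greedy colouring *)

Definition static (n k : nat) (E : rel nat) (s : state) : Prop :=
  base n k s /\ rows_are n (arr s aF) (arr s aFl) (fwd_rel E).

Lemma static_frame n k E s s' :
  (forall j, j \in [:: sN; sQ; aRn; aRq; aF; aFl] -> arr s' j = arr s j) ->
  static n k E s -> static n k E s'.
Proof.
move=> h [b r]; split; last by rewrite !h.
apply: base_frame b => j hj; apply: h; move: hj; rewrite !inE.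
by case/or4P => ->; rewrite ?orbT.
Qed.

Definition fwd n (E : rel nat) : nat -> seq nat := nbrs n (fwd_rel E).

(** Binders: 2 is the vertex [v] to colour, 4 its partner [u] in an unseparated
    pair, 6 a neighbour following [u]. *)
Definition ccount1 : cmd :=
  CIf (ESub (EVar 4) (EVar 2)) (incr aCnt (EGet aCol (EVar 4)))
    (CFor (EGet aFl (EVar 4))
      (CLet (EGet aF (EAdd (EGet aRn (EVar 4)) (EVar 5)))
        (CIf (ESub (EVar 6) (EVar 2)) (incr aCnt (EGet aCol (EVar 6))) skip))).

Lemma run_ccount1 n k E s i0 i1 w i3 u : static n k E s -> u < n ->
  let s' := run ccount1 [:: i0; i1; w; i3; u] s in
  (forall c, arr s' aCnt c =
     arr s aCnt c + conflict (fwd n E) (arr s aCol) w c u) /\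
  ticks s' <= ticks s + 2 + 4 * size (fwd n E u).
Proof.
move=> [[hN _ hn _] hF] un; rewrite /ccount1 /conflict; unfold_run; eval_state; rewrite subn_gt0.
case: ltnP => wu.
  eval_state; split=> [c|]; last by lia.
  rewrite updE eq_sym; case: eqP => [->|]; by rewrite ?addn0.
set ib := CLet _ _; set l := fwd n E u.
have [lenF nthF] := hF _ un; rewrite -/(fwd n E u) -/l in lenF nthF.
have H := @for_rule (fun t s' =>
  (forall c, arr s' aCnt c = arr s aCnt c +
     count (fun x => (w < x) && (arr s aCol x == c)) (take t l)) /\
  ticks s' <= ticks s + 2 + 4 * t) (EGet aFl (EVar 4)) ib [:: i0; i1; w; i3; u] (tick s).
have N1 : eval (EGet aFl (EVar 4)) [:: i0; i1; w; i3; u] (arr (tick s)) = size l by [].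
rewrite N1 in H; case: H.
- by rewrite take0; eval_state; split=> [c|]; rewrite ?addn0 //; lia.
- move=> t s' tl fr _ [h1 h2]; rewrite /ib; unfold_run; eval_state.
  have -> : arr s' aRn u = u * n by rewrite fr //; eval_state; rewrite hn.
  have -> : arr s' aF (u * n + t) = nth 0 l t by rewrite fr //; eval_state; rewrite nthF.
  have cE : arr s' aCol = arr s aCol by rewrite fr.
  rewrite cE subn_gt0; case: ltnP => wx; eval_state; rewrite ?cE; split; try lia;
    move=> c; rewrite (take_nth 0 tl) -cats1 count_cat /= addn0.
    by rewrite wx /= updE eq_sym h1; case: eqP => [->|_]; rewrite ?h1 ?addn0 ?addnA.
  by rewrite ltnNge wx /= addn0.
by rewrite take_size => h1 h2; split=> //.
Qed.

Definition crowcount : cmd :=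
  CFor (sc sQ) (CSet aCnt (EVar 3) zero) ;;
  CFor (EGet aUl (EVar 2))
    (CLet (EGet aU (EAdd (EGet aRn (EVar 2)) (EVar 3))) ccount1).

Lemma run_crowcount n k E (R : rel nat) s i0 i1 w :
  static n k E s -> rows_are n (arr s aU) (arr s aUl) R -> w < n ->
  (forall u, u < n -> size (fwd n E u) <= k) ->
  let s' := run crowcount [:: i0; i1; w] s in
  (forall c, c < 8 * k -> arr s' aCnt c =
     conflicts (fwd n E) (arr s aCol) (nbrs n R w) w c) /\
  ticks s' <= ticks s + 2 + 2 * (8 * k) + (4 + 4 * k) * size (nbrs n R w).
Proof.
move=> st hU wn Fk; rewrite /crowcount; unfold_run.
have [[hN hQ hn _] hF] := st.
set s1 := run _ _ s; set cb := CLet _ _.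
have [Z1 T1] : (forall c, c < 8 * k -> arr s1 aCnt c = 0) /\
    ticks s1 <= ticks s + 1 + 2 * (8 * k).
  have H := @for_rule (fun t s' => (forall c, c < t -> arr s' aCnt c = 0) /\
    ticks s' <= ticks s + 1 + 2 * t) (sc sQ) (CSet aCnt (EVar 3) zero) [:: i0; i1; w] s.
  have N1 : eval (sc sQ) [:: i0; i1; w] (arr s) = 8 * k by [].
  rewrite N1 in H; apply: H; first by eval_state; split=> //; lia.
  move=> t s' tl fr _ [h1 h2]; unfold_run; eval_state; split; last by lia.
  by move=> c; rewrite ltnS updE; case: eqP => // ct cl; apply: h1; lia.
have f1 := @run_frame (CFor (sc sQ) (CSet aCnt (EVar 3) zero)) [:: i0; i1; w] s.
rewrite -/s1 in f1; set l := nbrs n R w.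
have [lenU nthU] := hU _ wn; rewrite -/l in lenU nthU.
have H := @for_rule (fun t s' =>
  (forall c, c < 8 * k -> arr s' aCnt c =
     conflicts (fwd n E) (arr s aCol) (take t l) w c) /\
  ticks s' <= ticks s1 + 1 + (4 + 4 * k) * t) (EGet aUl (EVar 2)) cb [:: i0; i1; w] s1.
have N1 : eval (EGet aUl (EVar 2)) [:: i0; i1; w] (arr s1) = size l.
  by eval_state; rewrite f1 // -lenU.
rewrite N1 in H; case: H.
- by rewrite take0; eval_state; split=> [c cq|]; [rewrite Z1 // /conflicts big_nil|lia].
- move=> t s' tl fr _ [h1 h2]; rewrite /cb; unfold_run; eval_state.
  have -> : arr s' aRn w = w * n by rewrite fr // f1 // hn.
  have -> : arr s' aU (w * n + t) = nth 0 l t by rewrite fr // f1 // nthU.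
  have : nth 0 l t \in l by rewrite mem_nth.
  rewrite mem_nbrs => /andP[un _].
  have st' : static n k E (tick (tick s')).
    apply: static_frame st => j hj; eval_state; rewrite fr; first rewrite f1 //.
    + by move: hj; rewrite !inE; repeat (case/orP); move/eqP => ->.
    + by move: hj; rewrite !inE; repeat (case/orP); move/eqP => ->.
  have := @run_ccount1 n k E _ i0 i1 w t _ st' un; eval_state => -[g1 g2].
  have cE : arr s' aCol = arr s aCol by rewrite fr // f1.
  rewrite cE in g1; split.
    move=> c cq; rewrite g1 h1 // (take_nth 0 tl) /conflicts -cats1 big_cat big_seq1 //.
  have := Fk _ un; move: g2 h2; set a := size _; set b := ticks (run _ _ _); clear; nia.
by rewrite take_size => h1 h2; split=> //; lia.
Qed.

(** Colouring a position therefore changes neither its own counts nor those of the positions after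
    it. *)
Lemma conflicts_eq F col col' row v c : (forall x, v < x -> col x = col' x) ->
  conflicts F col row v c = conflicts F col' row v c.
Proof.
move=> h; apply: eq_bigr => u _; rewrite /conflict; case: ltnP => vu; first by rewrite h.
by apply: eq_count => x; case: ltnP => //= vx; rewrite h.
Qed.

Definition cgreedy : cmd :=
  CFor (sc sN) (CLet (ESub (ESub (sc sN) one) (EVar 1))
    (crowcount ;; cargmin aCnt (sc sQ) 3 ;; CSet aCol (EVar 2) (sc sBest))).

Lemma run_cgreedy n k E (R : rel nat) s i0 : 0 < k ->
  static n k E s -> rows_are n (arr s aU) (arr s aUl) R ->
  (forall u, u < n -> size (fwd n E u) <= k) ->
  let s' := run cgreedy [:: i0] s in
  greedy n (fwd n E) (arr s' aCol) R (8 * k) /\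
  ticks s' <= ticks s + 1 + n * (7 + 40 * k) + (4 + 4 * k) * npairs n R.
Proof.
move=> k0 st hU Fk; rewrite /cgreedy; unfold_run.
set body := CLet _ _; set F := fwd n E.
pose B v := 7 + 40 * k + (4 + 4 * k) * size (nbrs n R v).
have [[hN hQ hn _] hF] := st.
have H := @for_rule (fun i s' =>
  (forall v, n - i <= v < n -> arr s' aCol v < 8 * k /\
     forall c, c < 8 * k -> conflicts F (arr s' aCol) (nbrs n R v) v (arr s' aCol v) <=
       conflicts F (arr s' aCol) (nbrs n R v) v c) /\
  ticks s' <= ticks s + 1 + \sum_(n - i <= v < n) B v) (sc sN) body [:: i0] s.
have N1 : eval (sc sN) [:: i0] (arr s) = n by [].
rewrite N1 in H; case: H.
- rewrite subn0 big_geq //; eval_state; split; last by lia.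
  by move=> v; lia.
- move=> i s' lin fr _ [h1 h2]; rewrite /body; unfold_run; eval_state.
  have -> : arr s' sN 0 = n by rewrite fr.
  set w := n - 1 - i; have wn : w < n by rewrite /w; lia.
  have wE : n - i.+1 = w by rewrite /w; lia.
  have wS : n - i = w.+1 by rewrite /w; lia.
  set s0 := tick (tick s').
  have st0 : static n k E s0.
    apply: static_frame st => j hj; rewrite /s0; eval_state; rewrite fr //.
    by move: hj; rewrite !inE; repeat (case/orP); move/eqP => ->.
  have hU0 : rows_are n (arr s0 aU) (arr s0 aUl) R by rewrite /s0; eval_state; rewrite !fr.
  have [e1 t1] := @run_crowcount n k E R s0 i0 i w st0 hU0 wn Fk.
  have f1 := @run_frame crowcount [:: i0; i; w] s0.
  set s1 := run _ _ s0 in e1 t1 f1 *.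
  have N2 : eval (sc sQ) [:: i0; i; w] (arr (put s1 sBest 0 0)) = 8 * k.
    by eval_state; rewrite f1 // /s0; eval_state; rewrite fr.
  have [] := @run_cargmin aCnt (sc sQ) [:: i0; i; w] s1 (8 * k) isT isT N2.
  rewrite [size _]/=.
  have f2 := @frame_cargmin aCnt (sc sQ) 3 [:: i0; i; w] s1.
  set s2 := run _ _ s1 in f2 *; move=> b1 b2 t2.
  set b := arr s2 sBest 0 in b1 b2 *.
  have bq : b < 8 * k by lia.
  have cE : arr s2 aCol = arr s' aCol by rewrite f2 // f1.
  rewrite cE wE; have cE0 : arr s0 aCol = arr s' aCol by [].
  rewrite cE0 in e1; split; last first.
    rewrite big_ltn // -wS; move: t1 t2 h2; rewrite /s0; eval_state; rewrite /B.
    set S := \sum_(_ <= _ < _) _; set a := size _.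
    move: (ticks s1) (ticks s2) => x y; clear; nia.
  have upE x : w < x -> upd (arr s' aCol) w b x = arr s' aCol x.
    by move=> wx; rewrite upd_out //; lia.
  move=> v /andP[]; rewrite leq_eqVlt => /orP[/eqP <- _|wv vn].
    rewrite upd_eq; split=> // c cq.
    by rewrite !(conflicts_eq _ _ _ upE) -!e1 // b2.
  rewrite upE //; have [|h3 h4] := h1 v; first by rewrite wS wv.
  split=> // c cq; have upE' x : v < x -> upd (arr s' aCol) w b x = arr s' aCol x.
    by move=> vx; rewrite upE //; lia.
  by rewrite !(conflicts_eq _ _ _ upE') h4.
rewrite subnn => h1 h2; split; first by move=> v vn; apply: h1.
apply: leq_trans h2 _; rewrite big_mkord /B big_split /= sum_nat_const card_ord.
by rewrite -big_distrr /= addnA.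
Qed.

(** * Discarding the separated pairs *)

Lemma eq_subn a b : 1 - (a - b + (b - a)) = (a == b).
Proof. by case: eqP; lia. Qed.

(** Binders: 4 and 5 are the pair [u < w], 7 a neighbour following [u]. *)
Definition csep : cmd :=
  setc sBad (eeq (EGet aCol (EVar 4)) (EGet aCol (EVar 5))) ;;
  CFor (EGet aFl (EVar 4))
    (CLet (EGet aF (EAdd (EGet aRn (EVar 4)) (EVar 6)))
      (CIf (ESub (EVar 7) (EVar 5))
        (CIf (eeq (EGet aCol (EVar 7)) (EGet aCol (EVar 5))) (setc sBad one) skip)
        skip)).

Lemma run_csep n k E s i0 i1 i2 i3 u w : static n k E s -> u < n ->
  let s' := run csep [:: i0; i1; i2; i3; u; w] s in
  arr s' sBad 0 = unsep (fwd n E) (arr s aCol) u w /\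
  ticks s' <= ticks s + 2 + 5 * size (fwd n E u).
Proof.
move=> [[hN _ hn _] hF] un; rewrite /csep; unfold_run; eval_state.
set s1 := put _ _ _ _; set ib := CLet _ _; set l := fwd n E u.
have [lenF nthF] := hF _ un; rewrite -/(fwd n E u) -/l in lenF nthF.
have H := @for_rule (fun t s' =>
  arr s' sBad 0 = (arr s aCol u == arr s aCol w) ||
    has (fun x => (w < x) && (arr s aCol x == arr s aCol w)) (take t l) /\
  ticks s' <= ticks s + 2 + 5 * t) (EGet aFl (EVar 4)) ib [:: i0; i1; i2; i3; u; w] s1.
have N1 : eval (EGet aFl (EVar 4)) [:: i0; i1; i2; i3; u; w] (arr s1) = size l by [].
rewrite N1 in H; case: H.
- by rewrite take0 /s1; eval_state; rewrite upd_eq eq_subn orbF; split=> //; lia.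
- move=> t s' tl fr _ [h1 h2]; rewrite /ib; unfold_run; eval_state.
  have -> : arr s' aRn u = u * n by rewrite fr //; rewrite /s1; eval_state; rewrite hn.
  have -> : arr s' aF (u * n + t) = nth 0 l t by rewrite fr //; rewrite /s1; eval_state; rewrite nthF.
  have cE : arr s' aCol = arr s aCol by rewrite fr.
  rewrite cE subn_gt0 eq_subn lt0b (take_nth 0 tl) -cats1 has_cat /= orbF orbA.
  case: ltnP => wx; last by eval_state; rewrite h1 orbF; split=> //; lia.
  case: (arr s aCol (nth 0 l t) =P arr s aCol w) => cx; eval_state;
    last by rewrite h1 orbF; split=> //; lia.
  by rewrite upd_eq orbT; split=> //; lia.
by rewrite take_size => h1 h2; split=> //.
Qed.

(** The rows are filtered in place. Truncated subtraction gives the minimum [u - (u - w)] and the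
    maximum [w + (u - w)] of a pair. *)
Definition cfilter : cmd :=
  CFor (sc sN)
    (setc sNew zero ;;
     CFor (EGet aUl (EVar 1))
       (CLet (EGet aU (EAdd (EGet aRn (EVar 1)) (EVar 2)))
         (CLet (ESub (EVar 3) (ESub (EVar 3) (EVar 1)))
           (CLet (EAdd (EVar 1) (ESub (EVar 3) (EVar 1)))
             (csep ;;
              CIf (sc sBad)
                (CSet aU (EAdd (EGet aRn (EVar 1)) (sc sNew)) (EVar 3) ;;
                 incr sNew zero)
                skip)))) ;;
     CSet aUl (EVar 1) (sc sNew)).

Lemma run_cfilter n k E (R : rel nat) s i0 :
  static n k E s -> rows_are n (arr s aU) (arr s aUl) R ->
  (forall u, u < n -> size (fwd n E u) <= k) ->
  let s' := run cfilter [:: i0] s in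
  rows_are n (arr s' aU) (arr s' aUl) (shrink (fwd n E) (arr s aCol) R) /\
  ticks s' <= ticks s + 1 + n * 4 + (10 + 5 * k) * npairs n R.
Proof.
move=> st hU Fk; rewrite /cfilter; unfold_run.
set body := (_ ;; _); set F := fwd n E; set R' := shrink _ _ R.
pose B v := 4 + (10 + 5 * k) * size (nbrs n R v).
have [[hN hQ hn _] hF] := st.
have H := @for_rule (fun i s' =>
  [/\ forall v, v < i -> row_is n (arr s' aU) (arr s' aUl v) v (nbrs n R' v),
      forall v, i <= v < n -> row_is n (arr s' aU) (arr s' aUl v) v (nbrs n R v)
    & ticks s' <= ticks s + 1 + \sum_(0 <= v < i) B v]) (sc sN) body [:: i0] s.
have N1 : eval (sc sN) [:: i0] (arr s) = n by [].
rewrite N1 in H; case: H.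
- rewrite big_geq //; eval_state; split=> [//| |]; last by lia.
  by move=> v /andP[_ vn]; exact: hU.
- move=> w s' wn fr _ [h1 h2 h3]; rewrite /body; unfold_run; eval_state.
  set s1 := put _ _ _ _; set ib := CLet _ _; set l := nbrs n R w.
  have [|lenU nthU] := h2 w; first by rewrite leqnn.
  rewrite -/l in lenU nthU.
  pose g u := unsep F (arr s aCol) (minn w u) (maxn w u).
  have gE : nbrs n R' w = [seq u <- l | g u].
    by rewrite /nbrs -filter_predI; apply: eq_filter => u; rewrite /= andbC.
  have szl : size l <= n by exact: size_nbrs_le.
  have H := @for_rule (fun t s'' => [/\
    row_is n (arr s'' aU) (arr s'' sNew 0) w [seq u <- take t l | g u],
    forall r, t <= r < size l -> arr s'' aU (w * n + r) = nth 0 l r,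
    forall v, v < w -> row_is n (arr s'' aU) (arr s' aUl v) v (nbrs n R' v),
    forall v, w < v < n -> row_is n (arr s'' aU) (arr s' aUl v) v (nbrs n R v)
    & ticks s'' <= ticks s1 + 1 + (10 + 5 * k) * t]) (EGet aUl (EVar 1)) ib [:: i0; w] s1.
  have N2 : eval (EGet aUl (EVar 1)) [:: i0; w] (arr s1) = size l by rewrite /s1; eval_state.
  rewrite N2 in H; have T1 : ticks s1 = (ticks s').+2 by [].
  have fr1 j : j \notin mods body -> arr s1 j = arr s j.
    move=> hj; rewrite -(fr j hj) /s1; eval_state; case E0 : (eqn j sNew) => //.
    by move: hj; rewrite (eqP E0 : j = sNew).
  have f2 := @run_frame (CFor (EGet aUl (EVar 1)) ib) [:: i0; w] s1.
  have sN' : arr (run (CFor (EGet aUl (EVar 1)) ib) [:: i0; w] s1) aUl = arr s' aUl.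
    by rewrite f2.
  rewrite sN'; case: H.
  + rewrite take0 /s1; eval_state; rewrite upd_eq.
    split; [by split|by move=> r /andP[_]; exact: nthU|exact: h1| |by lia].
    by move=> v /andP[wv vn]; apply: h2; rewrite vn ltnW.
  + move=> t s'' tl fr' _ [g1 g2 g3 g4 g5]; rewrite /ib; unfold_run; eval_state.
    have -> : arr s'' aRn w = w * n by rewrite fr' // fr1 // hn.
    rewrite g2; last by rewrite leqnn.
    set u := nth 0 l t; set s2 := tick _.
    have : u \in l by rewrite mem_nth.
    rewrite mem_nbrs => /andP[un _].
    have loE : u - (u - w) = minn w u by rewrite /minn; case: ltnP; lia.
    have hiE : w + (u - w) = maxn w u by rewrite /maxn; case: ltnP; lia.
    rewrite loE hiE.
    have st2 : static n k E s2.
      apply: static_frame st => j hj; rewrite /s2; eval_state; rewrite fr'; first rewrite fr1 //.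
      * by move: hj; rewrite !inE; repeat (case/orP); move/eqP => ->.
      * by move: hj; rewrite !inE; repeat (case/orP); move/eqP => ->.
    have lon : minn w u < n by rewrite gtn_min wn.
    have [e3 t3] := @run_csep n k E s2 i0 w t u (minn w u) (maxn w u) st2 lon.
    have f3 := @run_frame csep [:: i0; w; t; u; minn w u; maxn w u] s2.
    set s3 := run _ _ s2 in e3 t3 f3 *.
    have c2 : arr s2 aCol = arr s aCol by rewrite /s2; eval_state; rewrite fr' // fr1.
    rewrite c2 -/(g u) in e3.
    have U3 : arr s3 aU = arr s'' aU by rewrite f3.
    have W3 : arr s3 sNew 0 = arr s'' sNew 0 by rewrite f3.
    have Rn3 : arr s3 aRn w = w * n by rewrite f3 // /s2; eval_state; rewrite fr' // fr1 // hn.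
    have T3 : (ticks s3).+3 <= ticks s1 + 1 + (10 + 5 * k) * t.+1.
      move: t3 g5 (Fk _ lon); rewrite /s2; eval_state; set a := size _; set b := ticks s3.
      by clear; nia.
    (* The writing position never overtakes the reading position, so no unread entry is lost. *)
    have newt : arr s'' sNew 0 <= t.
      case: g1 => -> _; rewrite size_filter (leq_trans (count_size _ _)) //.
      by rewrite size_take; case: ltnP; lia.
    rewrite (take_nth 0 tl) filter_rcons -/u e3 lt0b; case: (g u); eval_state.
      rewrite ?upd_eq U3 W3 Rn3 addn1; split=> //.
      * exact: row_push.
      * move=> r /andP[tr rl]; rewrite upd_out ?g2 //; [by rewrite rl ltnW|].
        by clear -newt tr; lia.
      * by move=> v vw; apply: row_other (g3 _ vw); [lia|lia|exact: size_nbrs_le].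
      * by move=> v vw; apply: row_other (g4 _ vw); [lia|lia|exact: size_nbrs_le].
    rewrite U3 W3; split=> //.
    * by move=> r /andP[tr rl]; apply: g2; rewrite rl ltnW.
    * by apply: leq_trans T3; lia.
  + rewrite take_size -gE; move=> g1 g2 g3 g4 g5; rewrite big_nat_recr //=; split.
    * move=> v; rewrite ltnS leq_eqVlt => /orP[/eqP ->|vw]; first by rewrite upd_eq.
      by rewrite upd_out ?g3 //; [exact: g3|lia].
    * by move=> v /andP[wv vn]; rewrite upd_out; [apply: g4; rewrite wv|lia].
    * apply: (leq_ltn_trans g5); move: h3; rewrite T1 /B -/l.
      by move: (\sum_(_ <= _ < _) _) (_ * size l) => S x; clear; lia.
move=> h1 _ h3; split; first by move=> v vn; apply: h1.
apply: leq_trans h3 _; rewrite big_mkord /B big_split /= sum_nat_const card_ord.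
by rewrite -big_distrr /= addnA.
Qed.

(** * The marker table and the output of a round *)

Definition ctab : cmd :=
  CFor (sc sN)
    (CFor (sc sQ) (CSet aTab (EAdd (EGet aRq (EVar 1)) (EVar 2)) (EVar 1)) ;;
     CFor (EGet aFl (EVar 1))
       (CLet (EGet aF (EAdd (EGet aRn (EVar 1)) (EVar 2)))
         (CSet aTab (EAdd (EGet aRq (EVar 1)) (EGet aCol (EVar 3))) (EVar 3))) ;;
     CSet aTab (EAdd (EGet aRq (EVar 1)) (EGet aCol (EVar 1)))
       (EAdd (sc sN) (EVar 1))).

Lemma upd_cell (A : nat -> nat) q u c u' c' v : c < q -> c' < q ->
  upd A (u' * q + c') v (u * q + c) =
    if (u == u') && (c == c') then v else A (u * q + c).
Proof.
move=> cq cq'; rewrite updE; case: eqP => [/(cell_inj cq cq')[-> ->]|h].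
  by rewrite !eqxx.
by case: eqP => //= uu; case: eqP => // cc; case: h; rewrite uu cc.
Qed.

Lemma run_ctab n k E s i0 : static n k E s ->
  (forall x, x < n -> arr s aCol x < 8 * k) ->
  (forall u, u < n -> size (fwd n E u) <= k) ->
  let s' := run ctab [:: i0] s in
  (forall u c, u < n -> c < 8 * k ->
     arr s' aTab (u * (8 * k) + c) = marker n (fwd n E) (arr s aCol) u c) /\
  ticks s' <= ticks s + 1 + n * (4 + 19 * k).
Proof.
move=> [[hN hQ hn hq] hF] hcol Fk; rewrite /ctab; unfold_run.
set body := (_ ;; _); set q := 8 * k in hQ hq hcol *.
have H := @for_rule (fun i s' =>
  (forall u c, u < i -> c < q ->
     arr s' aTab (u * q + c) = marker n (fwd n E) (arr s aCol) u c) /\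
  ticks s' <= ticks s + 1 + i * (4 + 19 * k)) (sc sN) body [:: i0] s.
have N1 : eval (sc sN) [:: i0] (arr s) = n by [].
rewrite N1 in H; apply: H; first by eval_state; split=> //; lia.
move=> i s' lin fr _ [h1 h2]; rewrite /body; unfold_run; eval_state.
set ib1 := CSet _ _ (EVar 1); set s1 := run (CFor _ ib1) _ _.
have [Z1 P1 T1] : [/\ forall c, c < q -> arr s1 aTab (i * q + c) = i,
    forall u c, u < i -> c < q ->
      arr s1 aTab (u * q + c) = marker n (fwd n E) (arr s aCol) u c
    & ticks s1 <= ticks s' + 2 + 2 * q].
  have H := @for_rule (fun j s'' => [/\ forall c, c < j -> arr s'' aTab (i * q + c) = i,
    forall u c, u < i -> c < q ->
      arr s'' aTab (u * q + c) = marker n (fwd n E) (arr s aCol) u c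
    & ticks s'' <= ticks s' + 2 + 2 * j]) (sc sQ) ib1 [:: i0; i] (tick s').
  have N2 : eval (sc sQ) [:: i0; i] (arr (tick s')) = q by eval_state; rewrite fr.
  rewrite N2 in H; apply: H; first by eval_state; split=> //; lia.
  move=> j s'' jq fr' _ [g1 g2 g3]; rewrite /ib1; unfold_run; eval_state.
  have -> : arr s'' aRq i = i * q by rewrite fr' //; eval_state; rewrite fr // hq.
  split; last by lia.
    move=> c cj; rewrite upd_cell //; last by lia.
    by rewrite eqxx /=; case: eqP => // cN; apply: g1; lia.
  by move=> u c ui cq; rewrite upd_cell // (ltn_eqF ui) g2.
have f1 := @run_frame (CFor (sc sQ) ib1) [:: i0; i] (tick s'); rewrite -/s1 in f1.
set ib2 := CLet _ _; set s2 := run (CFor _ ib2) _ _; set l := fwd n E i.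
have [lenF nthF] := hF _ lin; rewrite -/(fwd n E i) -/l in lenF nthF.
have fr1 j : j \notin mods body -> arr s1 j = arr s j.
  by move=> hj; rewrite -(fr j hj) f1 //; move: hj; rewrite /= !inE !negb_or => /and3P[].
have [Z2 P2 T2] : [/\ forall c, c < q ->
      arr s2 aTab (i * q + c) = last i [seq x <- l | arr s aCol x == c],
    forall u c, u < i -> c < q ->
      arr s2 aTab (u * q + c) = marker n (fwd n E) (arr s aCol) u c
    & ticks s2 <= ticks s1 + 1 + 3 * size l].
  have H := @for_rule (fun t s'' => [/\ forall c, c < q ->
      arr s'' aTab (i * q + c) = last i [seq x <- take t l | arr s aCol x == c],
    forall u c, u < i -> c < q ->
      arr s'' aTab (u * q + c) = marker n (fwd n E) (arr s aCol) u c
    & ticks s'' <= ticks s1 + 1 + 3 * t]) (EGet aFl (EVar 1)) ib2 [:: i0; i] s1.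
  have N2 : eval (EGet aFl (EVar 1)) [:: i0; i] (arr s1) = size l by eval_state; rewrite fr1.
  rewrite N2 take_size in H; apply: H.
    by eval_state; rewrite take0; split=> //=; lia.
  move=> t s'' tl fr' _ [g1 g2 g3]; rewrite /ib2; unfold_run; eval_state.
  have -> : arr s'' aRq i = i * q by rewrite fr' // fr1 // hq.
  have -> : arr s'' aRn i = i * n by rewrite fr' // fr1 // hn.
  have -> : arr s'' aF (i * n + t) = nth 0 l t by rewrite fr' // fr1 // nthF.
  have -> : arr s'' aCol = arr s aCol by rewrite fr' // fr1.
  set x := nth 0 l t; have : x \in l by rewrite mem_nth.
  rewrite mem_nbrs => /andP[xn _]; split; last by lia.
    move=> c cq; rewrite upd_cell ?hcol // (take_nth 0 tl) filter_rcons -/x eqxx eq_sym /=.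
    by case: eqP => _; rewrite ?last_rcons ?g1.
  by move=> u c ui cq; rewrite upd_cell ?hcol // (ltn_eqF ui) g2.
have f2 := @run_frame (CFor (EGet aFl (EVar 1)) ib2) [:: i0; i] s1; rewrite -/s2 in f2.
have -> : arr s2 aRq i = i * q by rewrite f2 // fr1 // hq.
have -> : arr s2 aCol = arr s aCol by rewrite f2 // fr1.
have -> : arr s2 sN 0 = n by rewrite f2 // fr1.
split.
  move=> u c; rewrite ltnS leq_eqVlt => /orP[/eqP ->|ui] cq; rewrite upd_cell ?hcol //.
    by rewrite eqxx /= /marker eq_sym; case: eqP => // _; rewrite Z2.
  by rewrite (ltn_eqF ui) P2.
by have := Fk _ lin; move: T1 T2 h2; rewrite -/l /q; move: (size l) => a; clear; nia.
Qed.

(** [pos] maps input vertices to positions, so a block lists the vertices in input order. *)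
Definition block n E col (pos : nat -> nat) c : seq nat :=
  n :: [seq left_end n (fwd n E) col (pos v) c | v <- iota 0 n].

Definition blocks n k E col (pos : nat -> nat) : seq nat :=
  flatten [seq block n E col pos c | c <- iota 0 (8 * k)].

Definition cprint : cmd :=
  CFor (sc sQ)
    (CPrint (sc sN) ;;
     CFor (sc sN) (CPrint (ESub (EAdd (sc sN) (sc sN))
       (EGet aTab (EAdd (EGet aRq (EGet aPos (EVar 2))) (EVar 1)))))).

Lemma run_cprint n k E s i0 col : static n k E s ->
  (forall v, v < n -> arr s aPos v < n) ->
  (forall u c, u < n -> c < 8 * k ->
     arr s aTab (u * (8 * k) + c) = marker n (fwd n E) col u c) ->
  let s' := run cprint [:: i0] s in
  out s' = out s ++ blocks n k E col (arr s aPos) /\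
  ticks s' <= ticks s + 1 + 8 * k * (3 + 2 * n).
Proof.
move=> [[hN hQ hn hq] hF] hpos htab; rewrite /cprint; unfold_run.
set body := (_ ;; _); set q := 8 * k in hQ hq htab *.
have H := @for_rule (fun c s' =>
  out s' = out s ++ flatten [seq block n E col (arr s aPos) c' | c' <- iota 0 c] /\
  ticks s' <= ticks s + 1 + c * (3 + 2 * n)) (sc sQ) body [:: i0] s.
have N1 : eval (sc sQ) [:: i0] (arr s) = q by [].
rewrite N1 in H; apply: H; first by eval_state; rewrite cats0; split=> //; lia.
move=> c s' cq fr _ [h1 h2]; rewrite /body; unfold_run; eval_state.
have -> : arr s' sN 0 = n by rewrite fr.
set s1 := State _ _ _ _; set ib := CPrint _.
have H := @for_rule (fun v s'' =>
  out s'' = out s' ++ n :: [seq left_end n (fwd n E) col (arr s aPos v) c | v <- iota 0 v] /\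
  ticks s'' <= ticks s' + 3 + v * 2) (sc sN) ib [:: i0; c] s1.
have N2 : eval (sc sN) [:: i0; c] (arr s1) = n by rewrite /s1; eval_state; rewrite fr.
rewrite N2 in H; case: H.
- by rewrite /s1; eval_state; rewrite -cats1; split=> //; lia.
- move=> v s'' vn fr' _ [g1 g2]; rewrite /ib; unfold_run; eval_state; split; last by lia.
  have fr2 j : arr s'' j = arr s j by rewrite fr' // /s1; eval_state; rewrite fr.
  rewrite !fr2 hN hq ?hpos // htab ?hpos // g1 iotaSr map_rcons rcons_cat //.
move=> g1 g2; split; last by move: h2 g2; clear; lia.
by rewrite g1 h1 iotaSr map_rcons flatten_rcons -catA.
Qed.

(** * The rounds and their total cost *)

Definition cround : cmd := cgreedy ;; cfilter ;; ctab ;; cprint.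

Lemma run_cround n k E (R : rel nat) s i0 : 0 < n -> 0 < k ->
  static n k E s -> rows_are n (arr s aU) (arr s aUl) R ->
  (forall v, v < n -> arr s aPos v < n) ->
  (forall u, u < n -> size (fwd n E u) <= k) ->
  let s' := run cround [:: i0] s in
  exists col, [/\ greedy n (fwd n E) col R (8 * k),
    out s' = out s ++ blocks n k E col (arr s aPos),
    rows_are n (arr s' aU) (arr s' aUl) (shrink (fwd n E) col R)
    & ticks s' <= ticks s + 118 * (n * k) + 23 * k * npairs n R].
Proof.
move=> n0 k0 st hU hpos Fk; rewrite /cround; unfold_run.
have frame_static s1 c e : static n k E s1 ->
    ~~ has (mem (mods c)) [:: sN; sQ; aRn; aRq; aF; aFl] -> static n k E (run c e s1).
  by move=> st1 /hasPn h; apply: static_frame st1 => j /h; exact: run_frame.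
have [gr t1] := run_cgreedy i0 k0 st hU Fk.
have f1 := @run_frame cgreedy [:: i0] s.
have st1 := frame_static _ cgreedy [:: i0] st isT.
have [_ o1] := @run_silent cgreedy [:: i0] s isT.
set s1 := run cgreedy _ s in gr t1 f1 st1 o1 *; set col := arr s1 aCol in gr.
have hU1 : rows_are n (arr s1 aU) (arr s1 aUl) R by rewrite !f1.
have [r2 t2] := run_cfilter i0 st1 hU1 Fk.
have f2 := @run_frame cfilter [:: i0] s1.
have st2 := frame_static _ cfilter [:: i0] st1 isT.
have [_ o2] := @run_silent cfilter [:: i0] s1 isT.
set s2 := run cfilter _ s1 in r2 t2 f2 st2 o2 *.
have c2 : arr s2 aCol = col by rewrite f2.
have hcol x : x < n -> arr s2 aCol x < 8 * k by rewrite c2 => /gr[].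
have [r3 t3] := run_ctab i0 st2 hcol Fk.
have f3 := @run_frame ctab [:: i0] s2.
have st3 := frame_static _ ctab [:: i0] st2 isT.
have [_ o3] := @run_silent ctab [:: i0] s2 isT.
set s3 := run ctab _ s2 in r3 t3 f3 st3 o3 *.
have p3 : arr s3 aPos = arr s aPos by rewrite f3 // f2 // f1.
have hpos3 v : v < n -> arr s3 aPos v < n by rewrite p3; apply: hpos.
have [r4 t4] := run_cprint i0 st3 hpos3 r3.
have f4 := @run_frame cprint [:: i0] s3.
set s4 := run cprint _ s3 in r4 t4 f4 *.
exists col; split=> //.
- by rewrite r4 o3 o2 o1 p3 c2.
- by rewrite !f4 // !f3.
- have nk : n <= n * k by rewrite leq_pmulr.
  have kn : k <= n * k by rewrite leq_pmull.
  have Uk : npairs n R <= k * npairs n R by rewrite leq_pmull.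
  move: t1 t2 t3 t4; clear -nk kn Uk n0 k0.
  have -> : n * (7 + 40 * k) = 7 * n + 40 * (n * k) by ring.
  have -> : n * (4 + 19 * k) = 4 * n + 19 * (n * k) by ring.
  have -> : 8 * k * (3 + 2 * n) = 24 * k + 16 * (n * k) by ring.
  have -> : (4 + 4 * k) * npairs n R = 4 * npairs n R + 4 * (k * npairs n R) by ring.
  have -> : (10 + 5 * k) * npairs n R = 10 * npairs n R + 5 * (k * npairs n R) by ring.
  have -> : 23 * k * npairs n R = 23 * (k * npairs n R) by ring.
  move: nk kn Uk; move: (k * npairs n R) (npairs n R) (n * k) => x y z.
  lia.
Qed.

Definition crounds : cmd := CFor (EAdd (sc sM) one) cround.

(** The term [46 * k * npairs n R] of the invariant is a potential summing the geometric series: a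
    round costs [23 * k * npairs n R] besides [O(n k)], and quartering [npairs] frees more than
    that. The round's own tick raises 118 to 119. *)
Lemma run_crounds n k E s m : 0 < n -> 0 < k -> symmetric E ->
  static n k E s -> rows_are n (arr s aU) (arr s aUl) (non_rel E) ->
  (forall v, v < n -> arr s aPos v < n) ->
  (forall u, u < n -> size (fwd n E u) <= k) ->
  arr s sM 0 = m -> n <= 2 ^ m ->
  let s' := run crounds [::] s in
  exists cols : seq (nat -> nat), [/\ size cols = m.+1,
    forall i v, i < m.+1 -> v < n -> nth id cols i v < 8 * k,
    out s' = out s ++ flatten [seq blocks n k E col (arr s aPos) | col <- cols],
    forall u w, u < w -> w < n -> ~~ E u w -> exists2 i, i < m.+1 &
      ~~ unsep (fwd n E) (nth id cols i) u w
    & ticks s' <= ticks s + 1 + m.+1 * (119 * (n * k)) + 46 * k * n ^ 2].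
Proof.
move=> n0 k0 Es st hU hpos Fk hm n2m; rewrite /crounds; unfold_run.
set F := fwd n E; set R0 := non_rel E; set pos := arr s aPos.
have R0s : symmetric R0 by move=> u w; rewrite /R0 /non_rel eq_sym Es.
have R0i : irreflexive R0 by move=> u; rewrite /R0 /non_rel eqxx.
have H := @for_rule (fun r s' => exists cols : seq (nat -> nat), exists R : rel nat,
  [/\ size cols = r, forall i v, i < r -> v < n -> nth id cols i v < 8 * k,
    out s' = out s ++ flatten [seq blocks n k E col pos | col <- cols] /\
    rows_are n (arr s' aU) (arr s' aUl) R,
    [/\ symmetric R, irreflexive R, 4 ^ r * npairs n R <= npairs n R0 &
      forall u w, R0 u w -> ~~ R u w -> u < w ->
        exists2 i, i < r & ~~ unsep F (nth id cols i) u w]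
    & ticks s' + 46 * k * npairs n R <=
        ticks s + 1 + r * (119 * (n * k)) + 46 * k * npairs n R0])
  (EAdd (sc sM) one) cround [::] s.
have N1 : eval (EAdd (sc sM) one) [::] (arr s) = m.+1 by eval_state; rewrite hm addn1.
rewrite N1 in H; case: H.
- exists [::], R0; eval_state; rewrite cats0 mul0n expn0 mul1n; split=> //.
    by split=> // u w -> .
  by rewrite addn1 addn0.
- move=> r s' rm fr _ [cols [R [h1 h2 [h3 h4] [h5 h6 h7 h8] h9]]].
  have fr' j : j \notin mods cround -> arr (tick s') j = arr s j by exact: fr.
  have st' : static n k E (tick s').
    apply: static_frame st => j hj; apply: fr'.
    by move: hj; rewrite !inE; repeat (case/orP); move/eqP => ->.
  have hU' : rows_are n (arr (tick s') aU) (arr (tick s') aUl) R by [].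
  have P' : arr (tick s') aPos = pos by rewrite fr'.
  have hpos' v : v < n -> arr (tick s') aPos v < n by rewrite P'; apply: hpos.
  have [col [g1 g2 g3 g4]] := run_cround r n0 k0 st' hU' hpos' Fk.
  have sh := npairs_shrink k0 h5 h6 Fk g1.
  rewrite P' in g2; exists (rcons cols col), (shrink F col R); split.
  + by rewrite size_rcons h1.
  + move=> i v; rewrite ltnS leq_eqVlt nth_rcons h1 => /orP[/eqP ->|ir] vn.
      by rewrite ltnn eqxx; have [] := g1 _ vn.
    by rewrite ir h2.
  + split=> //; rewrite [out _]g2 [out _]h3 map_rcons flatten_rcons catA //.
  + split; [exact: shrink_sym|exact: shrink_irr| |].
      rewrite expnSr -mulnA; apply: leq_trans h7; rewrite leq_mul2l sh orbT //.
    move=> u w Ruw; rewrite /shrink negb_and => hR uw.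
    case: (boolP (R u w)) => [Ruw'|nR].
      exists r => //; rewrite nth_rcons h1 ltnn eqxx.
      have Ruw2 := Ruw'; move: hR; rewrite Ruw' /= => hR.
      by rewrite (minn_idPl (ltnW uw)) (maxn_idPr (ltnW uw)) in hR.
    have [i ir hi] := h8 _ _ Ruw nR uw; exists i; first by lia.
    by rewrite nth_rcons h1 ir.
  + have sh2 := leq_mul (leqnn k) sh.
    move: g4 h9 sh2; have -> : ticks (tick s') = (ticks s').+1 by [].
    have nk : 0 < n * k by rewrite muln_gt0 n0.
    have -> : 23 * k * npairs n R = 23 * (k * npairs n R) by ring.
    have -> : 46 * k * npairs n R = 46 * (k * npairs n R) by ring.
    have E4 x : 46 * k * x = 46 * (k * x) by ring.
    have -> : k * (4 * npairs n (shrink F col R)) =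
        4 * (k * npairs n (shrink F col R)) by ring.
    rewrite !E4 mulSn.
    move: (k * npairs n R) (k * npairs n R0) (k * npairs n (shrink F col R)) nk.
    move: (n * k) (ticks _) (ticks _) (ticks _) => z a b c x y t; clear; lia.
move=> cols [R [h1 h2 [h3 h4] [h5 h6 h7 h8] h9]]; exists cols.
have n2 : npairs n R0 <= n ^ 2.
  rewrite -mulnn -[X in X * _]card_ord -sum_nat_const; apply: leq_sum => w _.
  exact: size_nbrs_le.
(* A surviving pair would give [4^(m + 1) <= n^2], against [n <= 2^m]. *)
have R_0 : npairs n R = 0.
  apply/eqP; rewrite -leqn0 leqNgt; apply/negP => pos0.
  have : 4 ^ m.+1 <= n ^ 2.
    by apply: leq_trans n2; apply: leq_trans h7; rewrite leq_pmulr.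
  rewrite leqNgt => /negP; apply; rewrite -[4]/(2 ^ 2) -expnM mulnC expnM ltn_exp2r //.
  by apply: leq_ltn_trans n2m _; rewrite ltn_exp2l.
split=> //.
- move=> u w uw wn nE; have un : u < n by lia.
  apply: h8 => //; first by rewrite /R0 /non_rel nE andbT; lia.
  exact: npairs_eq0 R_0 _ _ un wn.
- apply: leq_trans (leq_addr _ _) (leq_trans h9 _).
  by rewrite leq_add2l leq_mul2l n2 orbT.
Qed.

(** * The whole program, on graphs with natural numbers as vertices *)

Definition construct_cub_rep : cmd :=
  cinit ;; clog ;; cdeg ;; corder ;; clists ;; crounds.

Lemma nth_block n E col (pos : nat -> nat) c v : v < n ->
  nth 0 (block n E col pos c) v.+1 = left_end n (fwd n E) col (pos v) c.
Proof. by move=> vn; rewrite /= (nth_map 0) ?size_iota // nth_iota. Qed.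

Lemma flatten_blocks n k E pos (cols : seq (nat -> nat)) :
  flatten [seq blocks n k E col pos | col <- cols] =
  flatten [seq block n E col pos c | col <- cols, c <- iota 0 (8 * k)].
Proof. by elim: cols => //= col cols ->; rewrite flatten_cat. Qed.

(** The intervals of block [b] have common length [n]. *)
Definition represents n (adj : rel nat) (ss : seq (seq nat)) : Prop :=
  [/\ {in ss, forall b, size b = n.+1 /\ nth 0 b 0 = n},
      forall x y, x < n -> y < n -> adj x y ->
        {in ss, forall b, nth 0 b x.+1 <= nth 0 b y.+1 + n}
    & forall x y, x < n -> y < n -> x != y -> ~~ adj x y ->
        exists2 b, b \in ss & (nth 0 b x.+1 + n < nth 0 b y.+1) ||
                              (nth 0 b y.+1 + n < nth 0 b x.+1)].

Lemma blocks_represent n k adj (ord pos : nat -> nat) (cols : seq (nat -> nat)) :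
  let E := fun i j => adj (ord i) (ord j) in
  symmetric adj -> irreflexive adj ->
  (forall v, v < n -> pos v < n /\ ord (pos v) = v) ->
  (forall i v, i < size cols -> v < n -> nth id cols i v < 8 * k) ->
  (forall u w, u < w -> w < n -> ~~ E u w -> exists2 i, i < size cols &
      ~~ unsep (fwd n E) (nth id cols i) u w) ->
  represents n adj [seq block n E col pos c | col <- cols, c <- iota 0 (8 * k)].
Proof.
move=> E As Ai hpos hcol hsep.
have FE u : u < n -> fwd n E u = nbrs n (fun u x => (u < x) && E u x) u by [].
have posN x y : x < n -> y < n -> x != y -> pos x != pos y.
  move=> xn yn; apply: contra => /eqP e.
  by have [_ <-] := hpos _ xn; rewrite e; have [_ ->] := hpos _ yn.
have Epos x y : x < n -> y < n -> E (pos x) (pos y) = adj x y.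
  by move=> xn yn; rewrite /E (hpos _ xn).2 (hpos _ yn).2.
split.
- move=> b /allpairsP[[col c] [_ _ ->]] /=.
  by rewrite size_map size_iota.
- move=> x y xn yn xy b /allpairsP[[col c] [_ _ ->]]; rewrite !nth_block //.
  have xNy : x != y by apply: contraTneq xy => ->; rewrite Ai.
  have := posN _ _ xn yn xNy; rewrite neq_ltn => /orP[lt|lt].
    have [] := left_end_edge FE col c lt (hpos _ yn).1 _; first by rewrite Epos.
    by [].
  have [] := left_end_edge FE col c lt (hpos _ xn).1 _; first by rewrite Epos // As.
  by [].
- move=> x y xn yn xNy nxy.
  have sep x' y' : x' < n -> y' < n -> ~~ adj x' y' -> pos x' < pos y' ->
      exists2 b, b \in [seq block n E col pos c | col <- cols, c <- iota 0 (8 * k)] &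
        nth 0 b y'.+1 + n < nth 0 b x'.+1.
    move=> xn' yn' nxy' lt; have nE : ~~ E (pos x') (pos y') by rewrite Epos.
    have [i lti nsep] := hsep _ _ lt (hpos _ yn').1 nE.
    set col := nth id cols i in nsep.
    exists (block n E col pos (col (pos y'))).
      apply: allpairs_f; first by rewrite mem_nth.
      by rewrite mem_iota hcol // (hpos _ yn').1.
    by rewrite !nth_block //; exact: left_end_sep FE _ _ _ lt (hpos _ yn').1 nE nsep.
  have := posN _ _ xn yn xNy; rewrite neq_ltn => /orP[lt|lt].
    by have [b bss h] := sep _ _ xn yn nxy lt; exists b; rewrite // h orbT.
  have [|b bss h] := sep _ _ yn xn _ lt; first by rewrite As.
  by exists b; rewrite // h.
Qed.

Lemma run_construct_cub_rep (R : realType) : exists C, forall n k adj xs,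
  0 < n -> 0 < k -> symmetric adj -> irreflexive adj -> low_degree n k adj ->
  size xs = n * n -> matrix_is n adj (nth 0 xs) ->
  let s' := run construct_cub_rep [::]
    (State (fun _ _ => 0) (n :: k :: xs) [::] 0) in
  exists ss, [/\ out s' = flatten ss, size ss = 8 * k * (log_dim R n + 1),
    represents n adj ss & ticks s' <= C * (n ^ 2 * k)].
Proof.
have [C hC] := run_clog R; exists (C + 2100) => n k adj xs n0 k0 As Ai ld szx hx.
rewrite /construct_cub_rep; unfold_run; set s0 := State _ _ _ _.
have frame_base s c e : base n k s ->
    ~~ has (mem (mods c)) [:: sN; sQ; aRn; aRq] -> base n k (run c e s).
  by move=> b /hasPn h; apply: base_frame b => j /h; exact: run_frame.
have [b1 A1 o1 t1] := run_cinit k szx; rewrite -/s0 in b1 A1 o1 t1.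
set s1 := run cinit _ s0 in b1 A1 o1 t1 *.
have N1 : arr s1 sN 0 = n by case: b1.
have [M2 t2] := hC s1 n N1 n0.
have f2 := @run_frame clog [::] s1; have b2 := frame_base _ clog [::] b1 isT.
have [_ o2] := @run_silent clog [::] s1 isT.
set s2 := run clog _ s1 in M2 t2 f2 b2 o2 *.
have A2 : matrix_is n adj (arr s2 aA).
  move=> i j lin ljn; rewrite f2 // A1 ?hx //; exact: leq_cell.
have [D3 t3] := run_cdeg b2 A2.
have f3 := @run_frame cdeg [::] s2; have b3 := frame_base _ cdeg [::] b2 isT.
have [_ o3] := @run_silent cdeg [::] s2 isT.
set s3 := run cdeg _ s2 in D3 t3 f3 b3 o3 *.
have A3 : matrix_is n adj (arr s3 aA) by rewrite f3.
have [Q4 t4] := run_corder As Ai ld b3 A3 D3.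
have f4 := @run_frame corder [::] s3; have b4 := frame_base _ corder [::] b3 isT.
have [_ o4] := @run_silent corder [::] s3 isT.
set s4 := run corder _ s3 in Q4 t4 f4 b4 o4 *.
have A4 : matrix_is n adj (arr s4 aA) by rewrite f4.
have [ordP posP degP] := order_final Q4.
have hord p : p < n -> arr s4 aOrd p < n by move=> /ordP[].
have [F5 U5 t5] := run_clists b4 A4 hord.
have f5 := @run_frame clists [::] s4; have b5 := frame_base _ clists [::] b4 isT.
have [_ o5] := @run_silent clists [::] s4 isT.
set s5 := run clists _ s4 in F5 U5 t5 f5 b5 o5 *.
set E := fun i j => adj (arr s4 aOrd i) (arr s4 aOrd j) in F5 U5.
have P5 : arr s5 aPos = arr s4 aPos by rewrite f5.
have M5 : arr s5 sM 0 = log_dim R n by rewrite f5 // f4 // f3.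
have hpos v : v < n -> arr s5 aPos v < n by rewrite P5 => /posP[].
have Fk u : u < n -> size (fwd n E u) <= k by rewrite size_filter; exact: degP.
have Es : symmetric E by move=> u w; rewrite /E As.
have [cols [c1 c2 c3 c4 t6]] :=
  run_crounds n0 k0 Es (conj b5 F5) U5 hpos Fk M5 (log_dim_expn R n0).
set s6 := run crounds _ s5 in c3 t6 *.
exists [seq block n E col (arr s5 aPos) c | col <- cols, c <- iota 0 (8 * k)].
split.
- by rewrite c3 o5 o4 o3 o2 o1 flatten_blocks.
- by rewrite size_allpairs c1 size_iota addn1 mulnC.
- rewrite P5; apply: blocks_represent As Ai posP _ _ => [i v|u w uw wn nE].
    by rewrite c1; exact: c2.
  by rewrite c1; exact: c4.
(* Apart from the geometric part a round costs [O(n k)], so a linear bound on their number is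
   enough. *)
have L15 : log_dim R n <= 15 * n.
  have := log_dim_poly R n0; set L := log_dim R n; clear -n0 => h.
  rewrite leqNgt; apply/negP => lt; move: h; rewrite leqNgt => /negP; apply.
  apply: (@leq_ltn_trans ((15 * n) ^ 6)); last by rewrite ltn_exp2r.
  by rewrite expnMn leq_mul2l -{1}(expn1 n) leq_pexp2l ?orbT.
have n1 : n <= n ^ 2 by rewrite -mulnn leq_pmulr.
have n2 : n ^ 2 <= n ^ 2 * k by rewrite leq_pmulr.
have nk : n * k <= n ^ 2 * k by rewrite leq_mul2r n1 orbT.
have t6' : ticks s6 <= ticks s5 + 1 + 119 * (16 * (n ^ 2 * k)) + 46 * (n ^ 2 * k).
  have e1 : (16 * n) * (119 * (n * k)) = 119 * (16 * (n ^ 2 * k)).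
    by rewrite -mulnn; ring.
  have e2 : 46 * k * n ^ 2 = 46 * (n ^ 2 * k) by ring.
  apply: leq_trans t6 _; rewrite e2 leq_add2r leq_add2l -e1 leq_mul2r.
  by apply/orP; right; move: L15; clear -n0; lia.
have Cn : C * n ^ 2 <= C * (n ^ 2 * k) by rewrite leq_mul2l n2 orbT.
move: t1 t2 t3 t4 t5 t6' n1 n2 nk Cn; rewrite mulnDl.
have -> : n * (3 + 2 * n) = 3 * n + 2 * n ^ 2 by rewrite -mulnn; ring.
have -> : n * (10 + 5 * n) = 10 * n + 5 * n ^ 2 by rewrite -mulnn; ring.
have -> : n * (4 + 5 * n) = 4 * n + 5 * n ^ 2 by rewrite -mulnn; ring.
move: (ticks s1) (ticks s2) (ticks s3) (ticks s4) (ticks s5) (ticks s6).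
move: (C * n ^ 2) (C * (n ^ 2 * k)) (n ^ 2) (n ^ 2 * k) => a b c d u v w x y z.
by clear -n0; lia.
Qed.

(** * Transfer to graphs on ['I_n] and to cubes *)

Definition nat_rel n (e : rel 'I_n) : rel nat := fun i j =>
  if (insub i, insub j) is (Some i', Some j') then e i' j' else false.

Lemma nat_relE n (e : rel 'I_n) (i j : 'I_n) : nat_rel e i j = e i j.
Proof. by rewrite /nat_rel !valK. Qed.

Lemma nat_rel_sym n (e : rel 'I_n) : symmetric e -> symmetric (nat_rel e).
Proof. by move=> es i j; rewrite /nat_rel; case: insub => [i'|]; case: insub. Qed.

Lemma nat_rel_irr n (e : rel 'I_n) : irreflexive e -> irreflexive (nat_rel e).
Proof. by move=> ei i; rewrite /nat_rel; case: insub => // i'; exact: ei. Qed.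

Lemma count_iota_card n (p : pred nat) : count p (iota 0 n) = #|[pred i : 'I_n | p i]|.
Proof. by rewrite -val_enum_ord count_map cardE size_filter enumT. Qed.

(** In the given enumeration, the first vertex that belongs to [P] has all its neighbours in [P]
    after it. *)
Lemma degenerate_low_degree n k (e : rel 'I_n) :
  irreflexive e -> degenerate k e -> low_degree n k (nat_rel e).
Proof.
move=> ei [s sE hs] P [v vn Pv].
have mem_s (x : 'I_n) : x \in s by rewrite (perm_mem sE) mem_enum.
have hasP : has (fun x : 'I_n => P x) s by apply/hasP; exists (Ordinal vn).
set x := nth (Ordinal vn) s (find (fun x : 'I_n => P x) s).
have Px : P x by exact: (nth_find (Ordinal vn) hasP).
exists x; split=> //; rewrite count_iota_card; apply: leq_trans (hs x).
apply: subset_leq_card; apply/fintype.subsetP => y; rewrite !inE => /andP[Py].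
rewrite nat_relE => exy; rewrite exy /=.
have idx : index x s = find (fun x : 'I_n => P x) s.
  by rewrite index_uniq -?has_find // (perm_uniq sE) enum_uniq.
rewrite idx ltn_neqAle; apply/andP; split.
  apply: contraTneq exy => exy; suff -> : x = y by rewrite ei.
  by rewrite -(nth_index x (mem_s x)) idx exy nth_index.
rewrite leqNgt; apply/negP => /(before_find (Ordinal vn)).
by rewrite nth_index // Py.
Qed.

Lemma nth_flatten_const b (ss : seq (seq nat)) i j :
  {in ss, forall s, size s = b} -> i < size ss -> j < b ->
  nth 0 (flatten ss) (i * b + j) = nth 0 (nth [::] ss i) j.
Proof.
elim: ss i => //= s ss IH i hs ilt jb.
have sb : size s = b by apply: hs; rewrite mem_head.
rewrite nth_cat sb; case: i ilt => [|i] ilt; first by rewrite mul0n jb.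
rewrite mulSn -addnA ltnNge leq_addr /= addKn; apply: IH => //.
by move=> t ts; apply: hs; rewrite inE ts orbT.
Qed.

Lemma nth_allpairs_ord n (f : 'I_n -> 'I_n -> nat) (i j : 'I_n) :
  nth 0 [seq f x y | x <- enum 'I_n, y <- enum 'I_n] (i * n + j) = f i j.
Proof.
rewrite (@nth_flatten_const n); last exact: ltn_ord.
- rewrite (nth_map i) ?size_enum_ord // (nth_map j) ?size_enum_ord //.
  by rewrite !nth_ord_enum.
- by move=> s /mapP[x _ ->]; rewrite size_map size_enum_ord.
- by rewrite size_map size_enum_ord.
Qed.

Lemma represents_encodes (R : realType) n d (e : rel 'I_n) ss : 0 < n ->
  symmetric e -> size ss = d -> represents n (nat_rel e) ss ->
  encodes_cube_representation R d e (flatten ss).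
Proof.
move=> n0 es szd [h1 h2 h3].
have sz : {in ss, forall b, size b = n.+1} by move=> b /h1[].
have szi (i : 'I_d) : i < size ss by rewrite szd.
have lenE (i : 'I_d) : block_length n (flatten ss) i = n.
  rewrite /block_length -[_ * _]addn0 nth_flatten_const //.
  by have [] := h1 _ (mem_nth [::] (szi i)).
have leftE (i : 'I_d) (v : 'I_n) :
    block_left n (flatten ss) i v = nth 0 (nth [::] ss i) v.+1.
  by rewrite /block_left nth_flatten_const // ltnS.
split.
- rewrite size_flatten /shape.
  have -> : [seq size s | s <- ss] = nseq d n.+1.
    apply: (@eq_from_nth _ 0) => [|i]; rewrite size_map ?size_nseq // => iss.
    by rewrite (nth_map [::]) // nth_nseq -szd iss sz ?mem_nth.
  by rewrite sumn_nseq mulnC.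
- by move=> i; rewrite lenE.
have nR : (0 < n%:R :> R)%R by rewrite ltr0n.
have cornerE (v : 'I_n) (i : 'I_d) : decoded_corner R d (flatten ss) v 0%R i =
    ((nth 0%N (nth [::] ss i) v.+1)%:R / n%:R)%R.
  by rewrite /decoded_corner mxE lenE leftE.
have near (a b : nat) : (b%:R / n%:R <= a%:R / n%:R + 1 :> R)%R = (b <= a + n).
  rewrite -[X in (_ + X)%R](divff (lt0r_neq0 nR)) -mulrDl ler_pM2r ?invr_gt0 //.
  by rewrite -natrD ler_nat.
move=> x y xNy; split.
- move=> exy.
  (* Two intervals of equal length that meet share the larger left end, so the coordinatewise
     maximum of the corners lies in both cubes. *)
  pose p : 'rV[R]_d := (\row_i Num.max (decoded_corner R d (flatten ss) x 0 i)
    (decoded_corner R d (flatten ss) y 0 i))%R.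
  have pE i : p 0%R i = Num.max (decoded_corner R d (flatten ss) x 0%R i)
    (decoded_corner R d (flatten ss) y 0%R i) by rewrite mxE.
  exists p; split => i; rewrite pE le_max lexx ?orbT /= ge_max !cornerE.
    rewrite lerDl ler01 /= near.
    by apply: h2 => //; [rewrite nat_relE es|exact: mem_nth].
  rewrite lerDl ler01 andbT near.
  by apply: h2 => //; [rewrite nat_relE|exact: mem_nth].
- move=> [p [px py]]; apply: contraT => nexy.
  have [||||b bss hb] := h3 x y; rewrite ?nat_relE //.
  have ib : index b ss < d by rewrite -szd index_mem.
  have := px (Ordinal ib); have := py (Ordinal ib); rewrite !cornerE /= nth_index //.
  move=> /andP[y1 y2] /andP[x1 x2].
  have := le_trans y1 x2; have := le_trans x1 y2; rewrite !near => k1 k2.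
  by case/orP: hb; clear -k1 k2; lia.
Qed.

Theorem theorem3 (R : realType) :
  exists (P : seq instr) (C : nat),
    forall (n k : nat) (e : rel 'I_n),
      0 < n -> 0 < k -> symmetric e -> irreflexive e -> degenerate k e ->
      exists (t : nat) (y : seq nat),
        [/\ runs_within P (graph_input k e) t y,
            t <= C * (n ^ 2 * k)
          & encodes_cube_representation R (cub_dim R n k) e y].
Proof.
have [C hC] := run_construct_cub_rep R.
(* [M = 2^6 = 64] exceeds every array name and every scratch register of the program, as the
   evaluation of [wf] checks. *)
set P := compile 6 construct_cub_rep 0 0.
exists P, ((size P + 8) * C) => n k e n0 k0 es ei ed.
set xs := [seq nat_of_bool (e i j) | i <- enum 'I_n, j <- enum 'I_n].
have szx : size xs = n * n by rewrite size_allpairs size_enum_ord.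
have hx : matrix_is n (nat_rel e) (nth 0 xs).
  move=> i j lin ljn.
  rewrite (nth_allpairs_ord (fun x y => nat_of_bool (e x y)) (Ordinal lin) (Ordinal ljn)).
  by rewrite -nat_relE.
have [ss [h1 h2 h3 h4]] := hC n k (nat_rel e) xs n0 k0 (nat_rel_sym es)
  (nat_rel_irr ei) (degenerate_low_degree ei ed) szx hx.
have wfP : wf 6 construct_cub_rep 0 by vm_compute.
have [t [rt tt]] := compile_runs_within (n :: k :: xs) wfP.
exists t, (flatten ss); split.
- by rewrite -h1.
- apply: leq_trans tt _; rewrite -mulnA leq_mul2l h4 orbT //.
- exact: represents_encodes.
Qed.
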